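(* Let $\mathbb{k}$ be an algebraically closed field of any characteristic, $N>0$, $\mathfrak{g}=\mathfrak{gl}_N(\mathbb{k})$, let $\mathfrak{p}\subseteq\mathfrak{g}$ be a parabolic subalgebra with nilradical $\mathfrak{n}$ and Levi factor $\mathfrak{g}_0\cong\mathfrak{gl}_{\lambda_1}\oplus\cdots\oplus\mathfrak{gl}_{\lambda_n}$, where the factors are ordered compatibly with $\mathfrak{p}$ as described in the context. Let $\mathcal{O}_0\subseteq\mathfrak{g}_0$ be the nilpotent orbit classified by a tuple of partitions $(\mu_1,\dots,\mu_n)$ with $\mu_i\vdash\lambda_i$, let $e_0\in\mathcal{O}_0$ and let $e\in(e_0+\mathfrak{n})\cap\operatorname{Ind}_{\mathfrak{g}_0}^{\mathfrak{g}}(\mathcal{O}_0)$. Then the Lusztig--Spaltenstein morphism $\mathbf{LS}:\mathcal{B}^0_{e_0}\to\mathcal{B}_e$ maps each irreducible component of $\mathcal{B}^0_{e_0}$ onto an irreducible component of $\mathcal{B}_e$, and the induced map $\mathbf{LS}:\operatorname{Comp}\mathcal{B}^0_{e_0}\to\operatorname{Comp}\mathcal{B}_e$ satisfies $$\Phi\circ\mathbf{LS}=\mathbf{stk}\circ\Phi_0$$ as maps $\operatorname{Comp}\mathcal{B}^0_{e_0}\to\operatorname{Std}(\mu^\Sigma)$. Equivalently, for all standard tableaux $\sigma^{(i)}\in\operatorname{Std}(\mu_i)$ $(i=1,\dots,n)$, $$\mathbf{LS}(C_{\sigma^{(1)},\dots,\sigma^{(n)}})=C_{\mathbf{stk}(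\sigma^{(1)},\dots,\sigma^{(n)})}.$$
   Context: **Partitions and tableaux.** A composition $\lambda\vDash N$ is a tuple of positive integers with sum $N$; a partition $\lambda\vdash N$ is a non-increasing composition. The Young diagram of a partition has $i$-th row (from the top) of length $\lambda_i$. $\operatorname{Std}(\lambda)$ is the set of standard tableaux of shape $\lambda$ (fillings by $1,\dots,N$, each used once, increasing along rows and down columns). **Stacking.** Let $\lambda=(\lambda_1,\dots,\lambda_n)\vDash N$ and $\mu_i=(\mu_{i,1},\dots,\mu_{i,m_i})\vdash\lambda_i$, with $\mu_{i,j}:=0$ for $j>m_i$, and $m:=\max_i m_i$. Let $\mu^\Sigma=(\mu^\Sigma_1,\dots,\mu^\Sigma_m)$ with $\mu^\Sigma_j:=\sum_{i=1}^n\mu_{i,j}$, a partition of $N$. The map $\mathbf{stk}:\prod_{i=1}^n\operatorname{Std}(\mu_i)\to\operatorname{Std}(\mu^\Sigma)$ sends $(T^{\mu_1},\dots,T^{\mu_n})$, where $T^{\mu_k}$ has $(i,j)$-entry $t^{\mu_k}_{i,j}$, to the tableau $T^\Sigma$ of shape $\mu^\Sigma$ whose $(i,j)$-entry ($1\le i\le m$, $1\le j\le\mu^\Sigma_i$) is $t^{\mu_k}_{i,\tilde j}+\sum_{l=1}^{k-1}\lambda_l$, where $k\in\{1,\dots,n\}$ is maximal with $\mu_{1,i}+\cdots+\mu_{k-1,i}<j$ and $\tilde j=j-(\mu_{1,i}+\cdots+\mu_{k-1,i})$. **Levi and parabolic.** $G=\operatorname{GL}_N(\mathbb{k})$, and $G_0$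 is the Levi subgroup with Lie algebra $\mathfrak{g}_0$. The decomposition $\mathfrak{g}_0\cong\bigoplus_j\mathfrak{gl}_{\lambda_j}$ gives $\mathbb{k}^N=\bigoplus_{j=1}^n V_j$ with $\dim V_j=\lambda_j$, $\mathfrak{gl}_{\lambda_j}$ identified with $\operatorname{End}(V_j)$; the $V_j$ are ordered so that $\mathfrak{p}$ maps $V_j$ into $V_1\oplus\cdots\oplus V_j$ for every $j$ (so $\mathfrak{p}$ is the stabiliser of the partial flag with terms $W_j=V_1\oplus\cdots\oplus V_j$). So $\lambda=(\lambda_1,\dots,\lambda_n)$ is a composition of $N$. The nilpotent orbit classified by $(\mu_1,\dots,\mu_n)$ is the $G_0$-orbit of nilpotent elements whose restriction to $V_i$ has Jordan type $\mu_i$. $\operatorname{Ind}_{\mathfrak{g}_0}^{\mathfrak{g}}(\mathcal{O}_0)$ is the unique dense $G$-orbit in $\operatorname{Ad}(G)(\mathcal{O}_0+\mathfrak{n})$; its elements have Jordan type $\mu^\Sigma$. **Springer fibres and $\mathbf{LS}$.** $\mathcal{B}$ (resp. $\mathcal{B}^0$) is the flag variety of Borel subalgebras of $\mathfrak{g}$ (resp. $\mathfrak{g}_0$); $\mathcal{B}_e=\{\mathfrak{b}\in\mathcal{B}\mid e\in\mathfrak{b}\}$ and $\mathcal{B}^0_{e_0}=\{\mathfrak{b}_0\in\mathcal{B}^0\mid e_0\in\mathfrak{b}_0\}$. The morphism is $\mathbf{LS}(\mathfrak{b}_0)=\mathfrak{b}_0\oplus\mathfrak{n}$. $\operatorname{Comp}(X)$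 is the set of irreducible components of $X$. **Spaltenstein's map.** Identify $\mathcal{B}$ with full flags $F_\bullet=(0\subset F_1\subset\cdots\subset F_N=\mathbb{k}^N)$, so that $\mathcal{B}_e$ is the set of flags with $e(F_i)\subseteq F_{i-1}$. Define $\Phi:\mathcal{B}_e\to\operatorname{Std}(\mu^\Sigma)$ by sending $F_\bullet$ to the standard tableau in which $i$ is placed in the box added in passing from the Young diagram of the Jordan type of $e|_{F_{i-1}}$ to that of $e|_{F_i}$. By Spaltenstein, for each $\sigma\in\operatorname{Std}(\mu^\Sigma)$, $C_\sigma:=\overline{\Phi^{-1}(\sigma)}$ is an irreducible component of $\mathcal{B}_e$, and $\sigma\mapsto C_\sigma$ is a bijection $\operatorname{Std}(\mu^\Sigma)\to\operatorname{Comp}\mathcal{B}_e$, whose inverse is also denoted $\Phi$. Likewise, identifying $\mathcal{B}^0_{e_0}$ with $\prod_{i=1}^n\mathcal{B}_{e_0|_{V_i}}$ (tuples of flags of the $V_i$), applying Spaltenstein's map in each factor gives $\Phi_0:\mathcal{B}^0_{e_0}\to\prod_i\operatorname{Std}(\mu_i)$; $C_{\sigma^{(1)},\dots,\sigma^{(n)}}:=\overline{\Phi_0^{-1}(\sigma^{(1)},\dots,\sigma^{(n)})}$ are the irreducible components, and $\Phi_0$ also denotes the inverse bijection $\operatorname{Comp}\mathcal{B}^0_{e_0}\to\prod_i\operatorname{Std}(\mu_i)$. *)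

(* Defs.v *)
From HB Require Import structures.
From mathcomp Require Import all_boot all_order all_algebra.
From mathcomp Require Import mpoly.
From mathcomp Require Import boolp classical_sets.
Set Implicit Arguments.
Unset Strict Implicit.
Unset Printing Implicit Defensive.
Import GRing.Theory.
Local Open Scope classical_set_scope.
Local Open Scope ring_scope.

Definition composition (lam : seq nat) (m : nat) : Prop :=
  all (leq 1) lam /\ sumn lam = m.

Definition partition_of (nu : seq nat) (m : nat) : Prop :=
  sorted geq nu /\ composition nu m.

(* Rows and columns are numbered from 0; the entries of a tableau are 1..N. *)
Definition in_diagram (nu : seq nat) (r c : nat) : bool := (c < nth 0 nu r)%N.

Definition tableau := seq (seq nat).

Definition entry (T : tableau) (r c : nat) : nat := nth 0%N (nth [::] T r) c.

Definition is_std (nu : seq nat) (T : tableau) : Prop :=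
  [/\ shape T = nu,
      perm_eq (flatten T) (iota 1 (sumn nu)),
      (forall r c, in_diagram nu r c.+1 -> (entry T r c < entry T r c.+1)%N) &
      (forall r c, in_diagram nu r.+1 c -> (entry T r c < entry T r.+1 c)%N)].

Section Stacking.
Variables (n : nat) (lam : n.-tuple nat) (mu : n.-tuple (seq nat)).

(* The padding mu_{i,j} = 0 for j > m_i is the default value of [nth 0]. *)
Definition muSigma : seq nat :=
  mkseq (fun j => \sum_(i < n) nth 0 (tnth mu i) j)%N
        (\max_(i < n) size (tnth mu i)).

(* [row_sum k i] is mu_{1,i} + ... + mu_{k,i}. *)
Definition row_sum (k i : nat) : nat :=
  (\sum_(l < n | (l < k)%N) nth 0 (tnth mu l) i)%N.

(* As k and j are numbered from 0, the condition
   mu_{1,i} + ... + mu_{k-1,i} < j reads [row_sum k i <= j]. *)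
Definition stk_block (i j : nat) : nat :=
  (\max_(k < n | (row_sum k i <= j)%N) k)%N.

Definition stk_entry (T : n.-tuple tableau) (i j : nat) : nat :=
  let k := stk_block i j in
  (entry (nth [::] T k) i (j - row_sum k i) + \sum_(l < n | l < k) tnth lam l)%N.

Definition stk (T : n.-tuple tableau) : tableau :=
  mkseq (fun i => mkseq (stk_entry T i) (nth 0%N muSigma i)) (size muSigma).

End Stacking.

Section Topology.
Variables (T : Type) (closed : set (set T)).

Definition closure_of (S : set T) : set T :=
  [set x | forall Z, closed Z -> S `<=` Z -> Z x].

Definition irreducible (X : set T) : Prop :=
  X !=set0 /\
  forall Z1 Z2, closed Z1 -> closed Z2 -> X `<=` Z1 `|` Z2 ->
    X `<=` Z1 \/ X `<=` Z2.

Definition irr_components (Y : set T) : set (set T) :=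
  [set X | [/\ X `<=` Y, irreducible X &
      forall X', X' `<=` Y -> irreducible X' -> X `<=` X' -> X' = X]].

End Topology.

Section Springer.
Variables (k : closedFieldType) (N : nat).

(* gl_N is 'M[k]_N, acting on the space of columns. *)
Notation gl := 'M[k]_N.
Notation kN := 'cV[k]_N.

Definition zero_locus (P : set {mpoly k[N * N]}) : set gl :=
  [set x | forall p, P p -> p.@[fun i => mxvec x 0 i] = 0].

(* The Zariski closed subsets of D, for the topology induced from gl_N. *)
Definition zclosed_in (D : set gl) : set (set gl) :=
  [set S | exists P, S = D `&` zero_locus P].

Definition GL : set gl := [set g | g \in unitmx].

Definition Ad (g x : gl) : gl := g *m x *m invmx g.

Definition AdV (g : gl) (b : {vspace gl}) : {vspace gl} := (linfun (Ad g) @: b)%VS.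

(* { x in gl_N | x U <= U' } *)
Definition transporter (U U' : {vspace kN}) : {vspace gl} :=
  (\bigcap_(u <- vbasis U) (linfun (mulmxr u : gl -> kN) @^-1: U'))%VS.

Lemma transporterP (U U' : {vspace kN}) (x : gl) :
  reflect (forall u, u \in U -> x *m u \in U') (x \in transporter U U').
Proof.
apply: (iffP idP) => [xT u uU|xT].
  rewrite (coord_vbasis uU) mulmx_sumr rpred_sum // => i _.
  rewrite -scalemxAr rpredZ //; move: xT; rewrite /transporter.
  rewrite (big_rem (vbasis U)`_i) ?mem_nth ?size_tuple //= memv_cap.
  by case/andP; rewrite -memv_preim lfunE.
rewrite /transporter big_seq; elim/big_rec: _ => [|u W uU xW].
  exact: memvf.
by rewrite memv_cap xW andbT -memv_preim lfunE /= xT // vbasis_mem.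
Qed.

Lemma memv_bigcapP (vT : vectType k) (I : finType) (Us : I -> {vspace vT})
    (x : vT) :
  reflect (forall i, x \in Us i) (x \in (\bigcap_i Us i)%VS).
Proof.
apply: (iffP idP) => [xU i|xU]; last first.
  by rewrite memvE; apply/subv_bigcapP => i _; rewrite -memvE xU.
by move: xU; rewrite memvE => /subv_bigcapP/(_ i isT); rewrite -memvE.
Qed.

Section Decomposition.
Variables (n : nat) (V : 'I_n -> {vspace kN}).

(* The flag W_j = V_1 + ... + V_j, and its previous term W_{j-1}. *)
Definition flagW (j : 'I_n) : {vspace kN} := (\sum_(i < n | (i <= j)%N) V i)%VS.
Definition flagW_pred (j : 'I_n) : {vspace kN} :=
  (\sum_(i < n | (i < j)%N) V i)%VS.

Definition parabolic : {vspace gl} :=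
  (\bigcap_(j < n) transporter (flagW j) (flagW j))%VS.

(* The Lie algebra of the unipotent radical of the stabiliser of the flag W
   (centre of gl_N excluded, unlike in the largest nilpotent ideal). *)
Definition nilradical : {vspace gl} :=
  (\bigcap_(j < n) transporter (flagW j) (flagW_pred j))%VS.

Definition levi : {vspace gl} := (\bigcap_(i < n) transporter (V i) (V i))%VS.

Definition levi_group : set gl := [set g | g \in unitmx /\ g \in levi].

End Decomposition.

Lemma levi_nilradical (n : nat) (V : 'I_n -> {vspace kN}) :
    directv (\sum_(i < n) V i)%VS -> (\sum_(i < n) V i)%VS = fullv ->
  (levi V :&: nilradical V)%VS = 0%VS /\ (levi V + nilradical V)%VS = parabolic V.
Proof.
move=> dV fV.
have VW (i j : 'I_n) : (i <= j)%N -> (V i <= flagW V j)%VS.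
  by move=> ij; rewrite /flagW (sumv_sup i).
have VWp (i j : 'I_n) : (i < j)%N -> (V i <= flagW_pred V j)%VS.
  by move=> ij; rewrite /flagW_pred (sumv_sup i).
have WpW (j : 'I_n) : (flagW_pred V j <= flagW V j)%VS.
  by apply/subv_sumP => i ij; apply: VW; apply: ltnW.
pose pi i := sumv_pi_for (esym fV) i.
have piV i u : pi i u \in V i by exact: memv_sum_pi.
have sum_pi u : \sum_i pi i u = u by apply: sumv_pi_sum; rewrite ?memvf.
have piE (w : 'I_n -> kN) i : (forall j, w j \in V j) -> pi i (\sum_j w j) = w i.
  move=> wV; have := sum_pi (\sum_j w j).
  move/eqP; rewrite (directv_sum_unique dV) // => /forallP/(_ i)/=.
  by move/eqP.
split.
  apply/eqP; rewrite -subv0; apply/subvP => x; rewrite memv_cap memv0.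
  case/andP=> /memv_bigcapP xL /memv_bigcapP xN.
  have x0 i u : u \in V i -> x *m u = 0.
    move=> uV; have /transporterP/(_ u uV) xuV := xL i.
    have /transporterP/(_ u (subvP (VW i i (leqnn i)) _ uV)) xuW := xN i.
    have := directv_sumP dV i isT => /eqP; rewrite -subv0 => /subvP/(_ (x *m u)).
    rewrite memv_cap xuV memv0 => H; apply/eqP/H.
    apply: subvP xuW; apply/subv_sumP => j ji; rewrite (sumv_sup j) //=.
    by apply/eqP => E; rewrite E ltnn in ji.
  have xm (u : kN) : x *m u = 0.
    by rewrite -(sum_pi u) mulmx_sumr big1 // => i _; apply: x0 (piV _ _).
  apply/eqP/trmx_inj/row_matrixP => i; rewrite -tr_col colE xm.
  by apply/rowP => j; rewrite !mxE.
apply/eqP; rewrite eqEsubv; apply/andP; split.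
  rewrite subv_add; apply/andP; split; apply/subvP => x /memv_bigcapP xL;
      apply/memv_bigcapP => j; apply/transporterP => u; last first.
    by move=> uW; apply: (subvP (WpW j)); have /transporterP := xL j; apply.
  case/memv_sumP => us usV ->; rewrite mulmx_sumr; apply: memv_suml => i ij.
  by apply: (subvP (VW i j ij)); have /transporterP := xL i; apply; apply: usV.
apply/subvP => x /memv_bigcapP xP.
pose y : gl := \matrix_(a, b) (\sum_i pi i (x *m pi i (delta_mx b 0))) a 0.
have yE (u : kN) : y *m u = \sum_i pi i (x *m pi i u).
  rewrite {2}[u]matrix_sum_delta.
  under eq_bigr => i _.
    under eq_bigr => j _ do rewrite big_ord1.
    rewrite linear_sum mulmx_sumr linear_sum /=.
    under eq_bigr => j _ do rewrite linearZ /= -scalemxAr linearZ.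
    over.
  rewrite exchange_big /=; apply/colP => a; rewrite mxE summxE.
  by apply: eq_bigr => b _; rewrite mxE -scaler_sumr mxE mulrC.
have pi_id i u : u \in V i -> forall j, pi j u = if j == i then u else 0.
  move=> uV j; rewrite -{1}(_ : \sum_l (if l == i then u else 0) = u).
    by rewrite piE // => l; case: eqP => [->|] //; rewrite mem0v.
  by rewrite -big_mkcond big_pred1_eq.
have yV i u : u \in V i -> y *m u = pi i (x *m u).
  move=> uV; rewrite yE (bigD1 i) //= (pi_id i u uV i) eqxx big1 ?addr0 // => j ji.
  by rewrite (pi_id i u uV) (negPf ji) mulmx0 linear0.
rewrite -[x](subrK y) addrC memv_add //.
  by apply/memv_bigcapP => i; apply/transporterP => u uV; rewrite (yV i).
apply/memv_bigcapP => j; apply/transporterP => _ /memv_sumP[us usV ->].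
rewrite mulmx_sumr; apply: memv_suml => i ij; rewrite mulmxBl (yV i) ?usV //.
have /transporterP/(_ (us i) (subvP (VW i i (leqnn i)) _ (usV i ij))) := xP i.
case/memv_sumP=> ws wsV ->.
pose ws' (l : 'I_n) : kN := if (l <= i)%N then ws l else 0.
have ws'V l : ws' l \in V l by rewrite /ws'; case: ifP => [/wsV|]; rewrite ?mem0v.
rewrite big_mkcond (piE ws') // [X in X - _](bigD1 i) //=.
have -> : ws' i = if (i <= i)%N then ws i else 0 by [].
rewrite [X in X - _]addrC addrK.
apply: memv_suml => l li; rewrite /ws'; case: ifP => [le|]; rewrite ?mem0v //.
apply: (subvP (VWp l j _) _ (wsV l le)).
by rewrite (leq_trans _ ij) // ltn_neqAle le andbT.
Qed.

(* A full flag of U; only the values F 0, ..., F (\dim U) are relevant. *)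
Definition full_flag (U : {vspace kN}) (F : nat -> {vspace kN}) : Prop :=
  [/\ forall i, (i <= \dim U)%N -> \dim (F i) = i,
      forall i, (i < \dim U)%N -> (F i <= F i.+1)%VS &
      F (\dim U) = U].

Definition flag_stab (d : nat) (F : nat -> {vspace kN}) : {vspace gl} :=
  (\bigcap_(i < d.+1) transporter (F i) (F i))%VS.

(* The Borel subalgebra attached to a full flag of k^N.  Every Borel subalgebra
   of gl_N (the Lie algebra of a Borel subgroup of GL_N) is of this form; the
   intrinsic description "maximal solvable subalgebra" is not available here,
   as it fails in characteristic 2. *)
Definition borel (F : nat -> {vspace kN}) : {vspace gl} := flag_stab N F.

(* The Borel subalgebra of g_0 attached to a tuple of full flags of the V_i. *)
Definition borel0 (n : nat) (V : 'I_n -> {vspace kN})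
    (F : 'I_n -> nat -> {vspace kN}) : {vspace gl} :=
  (levi V :&: \bigcap_(i < n) flag_stab (\dim (V i)) (F i))%VS.

Definition flag_variety : set {vspace gl} :=
  [set b | exists2 F, full_flag fullv F & b = borel F].

Definition flag_variety0 (n : nat) (V : 'I_n -> {vspace kN}) : set {vspace gl} :=
  [set b | exists2 F, (forall i, full_flag (V i) (F i)) & b = borel0 V F].

(* The Zariski topology of a flag variety B on which the algebraic group
   H <= GL_N acts transitively: it is the quotient topology of H along the orbit
   map h |-> Ad(h) b of any point b of B. *)
Definition flag_closed (H : set gl) (B : set {vspace gl}) : set (set {vspace gl}) :=
  [set Z | Z `<=` B /\
     forall b, B b -> zclosed_in H [set h | H h /\ Z (AdV h b)]].

Definition zclosed_flag : set (set {vspace gl}) := flag_closed GL flag_variety.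

Definition zclosed_flag0 (n : nat) (V : 'I_n -> {vspace kN}) :
    set (set {vspace gl}) :=
  flag_closed (levi_group V) (flag_variety0 V).

(* x stabilises U, is nilpotent on it, and has Jordan type nu there: for each
   part nu_r there is a Jordan chain v_r, x v_r, ..., x^(nu_r - 1) v_r, with
   x^(nu_r) v_r = 0, and these chains together form a basis of U. *)
Definition jordan_type (x : gl) (U : {vspace kN}) (nu : seq nat) : Prop :=
  partition_of nu (\dim U) /\
  exists v : nat -> kN,
    basis_of U [seq x ^+ j *m v r | r <- iota 0 (size nu),
                                    j <- iota 0 (nth 0%N nu r)] /\
    forall r, (r < size nu)%N -> x ^+ (nth 0%N nu r) *m v r = 0.

Definition nilp_orbit (n : nat) (V : 'I_n -> {vspace kN})
    (mu : n.-tuple (seq nat)) : set gl :=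
  [set x | x \in levi V /\ forall i, jordan_type x (V i) (tnth mu i)].

(* Ad(G)(O_0 + n), with n the nilradical. *)
Definition Ad_saturation (n : nat) (V : 'I_n -> {vspace kN}) (O0 : set gl) : set gl :=
  [set x | exists g y z,
     [/\ GL g, O0 y, z \in nilradical V & x = Ad g (y + z)]].

(* The elements of Ad(G)(O_0 + n) whose G-orbit is dense in it. *)
Definition Ind (n : nat) (V : 'I_n -> {vspace kN}) (O0 : set gl) : set gl :=
  [set x | Ad_saturation V O0 x /\
     Ad_saturation V O0 `<=` closure_of (zclosed_in setT) [set Ad g x | g in GL]].

Definition springer (e : gl) : set {vspace gl} :=
  [set b | flag_variety b /\ e \in b].

Definition springer0 (n : nat) (V : 'I_n -> {vspace kN}) (e0 : gl) :
    set {vspace gl} :=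
  [set b | flag_variety0 V b /\ e0 \in b].

Definition Comp (e : gl) : set (set {vspace gl}) :=
  irr_components zclosed_flag (springer e).

Definition Comp0 (n : nat) (V : 'I_n -> {vspace kN}) (e0 : gl) :
    set (set {vspace gl}) :=
  irr_components (zclosed_flag0 V) (springer0 V e0).

Definition LS (n : nat) (V : 'I_n -> {vspace kN}) (b0 : {vspace gl}) : {vspace gl} :=
  (b0 + nilradical V)%VS.

(* Spaltenstein's map sends the flag F_0 < ... < F_d to the tableau T: the entry
   i lies in the box added in passing from the Young diagram of the Jordan type
   of x on F_{i-1} to that of x on F_i. *)
Definition spaltenstein (x : gl) (d : nat) (F : nat -> {vspace kN})
    (T : tableau) : Prop :=
  exists nu : nat -> seq nat,
    [/\ forall i, (i <= d)%N -> jordan_type x (F i) (nu i),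
        is_std (nu d) T &
        forall i r c, (0 < i <= d)%N ->
          (in_diagram (nu d) r c && (entry T r c == i)) =
          (in_diagram (nu i) r c && ~~ in_diagram (nu i.-1) r c)].

Definition Phi_fibre (e : gl) (sigma : tableau) : set {vspace gl} :=
  [set b | springer e b /\
     exists F, [/\ full_flag fullv F, b = borel F & spaltenstein e N F sigma]].

Definition Phi0_fibre (n : nat) (V : 'I_n -> {vspace kN}) (e0 : gl)
    (sigma : n.-tuple tableau) : set {vspace gl} :=
  [set b | springer0 V e0 b /\
     exists F : 'I_n -> nat -> {vspace kN},
       [/\ forall i, full_flag (V i) (F i), b = borel0 V F &
           forall i, spaltenstein e0 (\dim (V i)) (F i) (tnth sigma i)]].

Definition C (e : gl) (sigma : tableau) : set {vspace gl} :=
  closure_of zclosed_flag (Phi_fibre e sigma).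

Definition C0 (n : nat) (V : 'I_n -> {vspace kN}) (e0 : gl)
    (sigma : n.-tuple tableau) : set {vspace gl} :=
  closure_of (zclosed_flag0 V) (Phi0_fibre V e0 sigma).

(* The inverses of sigma |-> C_sigma, on standard tableaux; the value is a dummy
   on sets which are not of the form C_sigma. *)
Definition Phi (e : gl) (nu : seq nat) (X : set {vspace gl}) : tableau :=
  xget [::] [set sigma | is_std nu sigma /\ C e sigma = X].

Definition Phi0 (n : nat) (V : 'I_n -> {vspace kN}) (e0 : gl)
    (mu : n.-tuple (seq nat)) (X : set {vspace gl}) : n.-tuple tableau :=
  xget (nseq_tuple n [::])
    [set sigma | (forall i, is_std (tnth mu i) (tnth sigma i)) /\
                 C0 V e0 sigma = X].

End Springer.

(* Main.v *)
Require Import Defs.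
From HB Require Import structures.
From mathcomp Require Import all_boot all_order all_algebra.
From mathcomp Require Import mpoly.
From mathcomp Require Import boolp classical_sets.
From mathcomp Require Import zify.
Set Implicit Arguments.
Unset Strict Implicit.
Unset Printing Implicit Defensive.
Import GRing.Theory.
Local Open Scope classical_set_scope.
Local Open Scope ring_scope.

(** Jordan types are read off from the dimensions of the kernels of the powers
    of a nilpotent matrix.  The morphism [LS] sends a tuple of flags of the V_i
    to the flag of k^N which it induces through W_1 < ... < W_n, and it is a
    closed embedding.  The image X of a fibre of Phi_0 over a tuple sigma
    consists of the flags through W whose terms have prescribed Jordan types
    modulo the W_j.

    The type of an extension is bounded by the sum of the types, and e attains
    this bound on every W_j.  Going down a flag of type stk(sigma), each
    hyperplane therefore contains the W_j in question and has the type modulo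
    W_j given by sigma, so that the fibre of Phi over stk(sigma) is contained in
    X; it is cut out of X by conditions of maximal rank, hence it is open in X.
    As X is irreducible, being dominated by a tower of products of matrices
    1 + f with f commuting with e up to a lower term, the closures agree.

    That the closure of a fibre of Phi is a component is shown without dimension
    theory: fibres over tableaux of the same shape nu are parametrised by the same
    number M of parameters, namely sum_r r nu_r besides those of a Borel
    subalgebra, and such a parametrisation carries M algebraically independent
    functions.  Since M + 1 polynomials in M variables are algebraically
    dependent, a fibre contained in the closure of another one is dense in it. *)

(** * Linear algebra *)

Section Linear.
Variables (k : closedFieldType) (N : nat).
Notation gl := 'M[k]_N.
Notation kN := 'cV[k]_N.
Implicit Types (g h x e : gl) (u v w : kN) (U A B : {vspace kN}).

Definition mv g U : {vspace kN} := (linfun (mulmx g : kN -> kN) @: U)%VS.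

Lemma mvP g U w : reflect (exists2 u, u \in U & w = g *m u) (w \in mv g U).
Proof.
by apply: (iffP memv_imgP) => -[u uU ->]; exists u; rewrite ?lfunE.
Qed.

Lemma mem_mv g U u : u \in U -> g *m u \in mv g U.
Proof. by move=> uU; apply/mvP; exists u. Qed.

Lemma mvS g U A : (U <= A)%VS -> (mv g U <= mv g A)%VS.
Proof. exact: limgS. Qed.

Lemma mv_sub g U A : (forall u, u \in U -> g *m u \in A) -> (mv g U <= A)%VS.
Proof. by move=> H; apply/subvP => w /mvP[u uU ->]; apply: H. Qed.

Lemma mvM g h U : mv (g *m h) U = mv g (mv h U).
Proof.
apply/vspaceP => w; apply/mvP/mvP => [[u uU ->]|[_ /mvP[u uU ->] ->]].
  by exists (h *m u); rewrite ?mulmxA // mem_mv.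
by exists u; rewrite ?mulmxA.
Qed.

Lemma mv1 U : mv 1%:M U = U.
Proof.
apply/vspaceP => w; apply/mvP/idP => [[u uU ->]|wU]; first by rewrite mul1mx.
by exists w; rewrite ?mul1mx.
Qed.

Lemma mvV g U : g \in unitmx -> mv (invmx g) (mv g U) = U.
Proof. by move=> gu; rewrite -mvM mulVmx // mv1. Qed.

Lemma mem_mvE g U w : g \in unitmx -> (w \in mv g U) = (invmx g *m w \in U).
Proof.
move=> gu; apply/mvP/idP => [[u uU ->]|wU]; first by rewrite mulKmx.
by exists (invmx g *m w); rewrite ?mulKVmx.
Qed.

Lemma mem_mv_mul g U u : g \in unitmx -> (g *m u \in mv g U) = (u \in U).
Proof. by move=> gu; rewrite mem_mvE // mulKmx. Qed.

Lemma dim_mv_le g U : (\dim (mv g U) <= \dim U)%N.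
Proof. by rewrite -(limg_ker_dim (linfun (mulmx g : kN -> kN)) U) leq_addl. Qed.

Lemma dim_mv g U : g \in unitmx -> \dim (mv g U) = \dim U.
Proof.
move=> gu; apply/eqP; rewrite eqn_leq dim_mv_le /= -{1}(mvV U gu).
exact: dim_mv_le.
Qed.

Lemma mv_stable g U : g \in unitmx -> (forall u, u \in U -> g *m u \in U) -> mv g U = U.
Proof.
by move=> gu H; apply/eqP; rewrite eqEdim mv_sub //= dim_mv.
Qed.

Lemma dimN : \dim {:kN} = N.
Proof. by rewrite dimvf /= dim_matrix; exact: muln1. Qed.

Lemma dim_le U : (\dim U <= N)%N.
Proof. by have := dimvS (subvf U); rewrite dimN. Qed.

Lemma unitmxP g : (forall u, g *m u = 0 -> u = 0) -> g \in unitmx.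
Proof.
move=> H; rewrite -unitmx_tr -row_free_unit -kermx_eq0; apply/rowV0P => r.
move/sub_kermxP => rg; apply: trmx_inj; rewrite trmx0; apply: H.
by apply: trmx_inj; rewrite trmx_mul trmxK rg trmx0.
Qed.

Lemma unitmx0 g u : g \in unitmx -> g *m u = 0 -> u = 0.
Proof. by move=> gu H; rewrite -(mulKmx gu u) H mulmx0. Qed.

Definition qker e A b U : {vspace kN} :=
  (U :&: (linfun (mulmx (e ^+ b) : kN -> kN) @^-1: A))%VS.

Lemma mem_qker e A b U u : (u \in qker e A b U) = (u \in U) && (e ^+ b *m u \in A).
Proof. by rewrite memv_cap -memv_preim lfunE. Qed.

Lemma qker_sub e A b U : (qker e A b U <= U)%VS.
Proof. exact: capvSl. Qed.

Lemma dim_qker e b U : (\dim (qker e 0 b U) + \dim (mv (e ^+ b) U) = \dim U)%N.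
Proof. by rewrite /qker lpreim0 limg_ker_dim. Qed.

Lemma exprS_mulmx e b u : e ^+ b.+1 *m u = e *m (e ^+ b *m u).
Proof. by rewrite exprS mulmxA. Qed.
Lemma exprSr_mulmx e b u : e ^+ b.+1 *m u = e ^+ b *m (e *m u).
Proof. by rewrite exprSr mulmxA. Qed.
Lemma exprD_mulmx e b c u : e ^+ (b + c) *m u = e ^+ b *m (e ^+ c *m u).
Proof. by rewrite exprD mulmxA. Qed.
Lemma expr0_mulmx e u : e ^+ 0 *m u = u.
Proof. by rewrite expr0 mul1mx. Qed.

Definition stab e U := forall u, u \in U -> e *m u \in U.

Lemma stab_exp e U b u : stab e U -> u \in U -> e ^+ b *m u \in U.
Proof.
by move=> eU uU; elim: b => [|b IH]; rewrite ?expr0_mulmx // exprS_mulmx eU.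
Qed.

Lemma qker_mono e A b c U : stab e A -> (b <= c)%N -> (qker e A b U <= qker e A c U)%VS.
Proof.
move=> eA bc; apply/subvP => u; rewrite !mem_qker => /andP[-> ebu] /=.
by rewrite -(subnK bc) exprD_mulmx stab_exp.
Qed.

Lemma row_of_form (f : {linear kN -> k^o}) :
  exists xi : 'rV[k]_N, forall u, (xi *m u) 0 0 = f u.
Proof.
exists (\row_j f (delta_mx j 0)) => u; rewrite mxE.
rewrite [in RHS](matrix_sum_delta u) linear_sum.
apply: eq_bigr => i _; rewrite big_ord1 linearZ mxE /= mulrC.
by [].
Qed.

Lemma dual_forms (T D : {vspace kN}) : (T :&: D = 0)%VS ->
  exists th : 'I_(\dim T) -> 'rV[k]_N,
    (forall l u, u \in D -> (th l *m u) 0 0 = 0) /\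
    (forall l m : 'I_(\dim T), (th l *m (vbasis T)`_m) 0 0 = (l == m)%:R).
Proof.
move=> TD.
have ex l : exists xi : 'rV[k]_N, forall u,
    (xi *m u) 0 0 = coord (vbasis T) l (daddv_pi T D u).
  have [xi H] := row_of_form
    (GRing.Linear.clone _ _ _ _ (coord (vbasis T) l \o daddv_pi T D) _).
  by exists xi.
pose th l := projT1 (cid (ex l)).
have thE l u : (th l *m u) 0 0 = coord (vbasis T) l (daddv_pi T D u).
  by rewrite /th; case: cid.
exists th; split => [l u uD|l m].
  rewrite thE; suff -> : daddv_pi T D u = 0 by rewrite linear0.
  have uTD : u \in (T + D)%VS by rewrite -[u]add0r memv_add // mem0v.
  have := daddv_pi_add TD uTD; have DT : (D :&: T = 0)%VS by rewrite capvC.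
  by rewrite (daddv_pi_id DT uD) => /(canRL (addrK _)); rewrite subrr.
rewrite thE daddv_pi_id // ?coord_free //; [by rewrite eq_sym|exact: (basis_free (vbasisP _))|].
by apply/vbasis_mem/mem_nth; rewrite size_tuple.
Qed.

Lemma sep_form A u : u \notin A ->
  exists xi : 'rV[k]_N, (forall a, a \in A -> (xi *m a) 0 0 = 0) /\ (xi *m u) 0 0 = 1.
Proof.
move=> uA; have u0 : u != 0 by apply: contraNneq uA => ->; apply: mem0v.
have TD : (<[u]> :&: A = 0)%VS.
  apply/eqP; rewrite -subv0; apply/subvP => w; rewrite memv_cap memv0.
  case/andP => /vlineP[c ->] cuA; rewrite scaler_eq0 (negPf u0) orbF.
  apply: contraNT uA => c0; have := memvZ (c^-1) cuA.
  by rewrite scalerA mulVf // scale1r.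
have [th [thD thT]] := dual_forms TD.
have d1 : \dim <[u]> = 1%N by rewrite dim_vline u0.
have l : 'I_(\dim <[u]>) by rewrite d1; exact: ord0.
have /vlineP[c uE] : (vbasis <[u]>)`_l \in <[u]>%VS.
  by apply/vbasis_mem/mem_nth; rewrite size_tuple.
exists (c *: th l); split => [a aA|].
  by rewrite -scalemxAl mxE thD // mulr0.
by rewrite -scalemxAl scalemxAr -uE thT eqxx.
Qed.

Lemma form_scale (xi : 'rV[k]_N) v u : v *m xi *m u = (xi *m u) 0 0 *: v.
Proof.
by rewrite -mulmxA {1}[xi *m u]mx11_scalar mul_mx_scalar.
Qed.

End Linear.

Lemma sum_prefix (n : nat) (P : pred nat) : (forall r, P r.+1 -> P r) ->
  forall r, (r < n)%N -> (r < \sum_(i < n) P i)%N = P r.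
Proof.
move=> Pd; have Pdd r s : (r <= s)%N -> P s -> P r.
  by move=> /subnK <-; elim: (s - r)%N => // d IH /Pd.
elim: n => // n IH r; rewrite ltnS => rn; rewrite big_ord_recr /=.
have le_n m : (\sum_(i < m) P i <= m)%N.
  by elim: m => [|m IHm]; rewrite ?big_ord0 // big_ord_recr /= -addn1 leq_add // leq_b1.
case PN: (P n).
  have -> : (\sum_(i < n) P i = n)%N.
    under eq_bigr => i _ do rewrite (Pdd i n (ltnW (ltn_ord i)) PN).
    by rewrite sum_nat_const card_ord muln1.
  by rewrite addn1 ltnS rn (Pdd r n rn PN).
rewrite addn0; case: (ltngtP r n) rn => // [rn _|-> _]; first exact: IH.
by rewrite PN ltnNge le_n.
Qed.

Lemma minnSr (f a : nat) : minn f a.+1 = (minn f a + (a < f))%N.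
Proof. by lia. Qed.

Lemma nonincreasing_le (f : nat -> nat) : (forall r, f r.+1 <= f r)%N ->
  forall r s, (r <= s)%N -> (f s <= f r)%N.
Proof.
move=> fd r s /subnK <-; elim: (s - r)%N => // d IH; exact: leq_trans (fd _) IH.
Qed.

Lemma sum_minn_inj (n : nat) (f g : nat -> nat) :
    (forall r, f r.+1 <= f r)%N -> (forall r, g r.+1 <= g r)%N ->
    (forall a, \sum_(r < n) minn (f r) a = \sum_(r < n) minn (g r) a)%N ->
  forall r, (r < n)%N -> f r = g r.
Proof.
move=> fd gd E r rn.
have H a : (a < f r)%N = (a < g r)%N.
  rewrite -(@sum_prefix n (fun i => a < f i)%N _ r rn); last first.
    by move=> i /leq_trans; apply.
  rewrite -(@sum_prefix n (fun i => a < g i)%N _ r rn); last first.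
    by move=> i /leq_trans; apply.
  have := E a.+1; under eq_bigr do rewrite minnSr.
  under [X in _ = X -> _]eq_bigr do rewrite minnSr.
  by rewrite !big_split /= E => /addnI ->.
by have := H (f r); have := H (g r); rewrite !ltnn; lia.
Qed.

Lemma sum_nth_le (nu : seq nat) n : (size nu <= n)%N -> (\sum_(r < n) nth 0%N nu r = sumn nu)%N.
Proof.
move=> sn; rewrite sumnE (big_nth 0%N) big_mkord (big_ord_widen _ (nth 0%N nu) sn).
rewrite [RHS]big_mkcond; apply: eq_bigr => i _; case: ifP => // /negbT.
by rewrite -leqNgt => ?; rewrite nth_default.
Qed.

Lemma partition_size nu m : partition_of nu m -> (size nu <= m)%N.
Proof.
case=> _ [+ <-]; elim: nu => //= a nu IH /andP[a0 /IH]; move: a0; lia.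
Qed.

Lemma partition_noninc nu m : partition_of nu m -> forall r, (nth 0%N nu r.+1 <= nth 0%N nu r)%N.
Proof.
case=> so _ r; case: (ltnP r.+1 (size nu)) => [lt|ge]; last by rewrite nth_default.
by have /(sortedP 0%N)/(_ r lt) := so.
Qed.

Lemma partition_pos nu m r : partition_of nu m -> (r < size nu)%N = (0 < nth 0%N nu r)%N.
Proof.
case=> _ [/allP pos _]; case: (ltnP r (size nu)) => [lt|ge].
  by rewrite pos // mem_nth.
by rewrite nth_default.
Qed.

Lemma partition_sum nu m n : partition_of nu m -> (m <= n)%N ->
  (\sum_(r < n) nth 0%N nu r = m)%N.
Proof.
move=> p mn; rewrite sum_nth_le ?(leq_trans (partition_size p)) //.
by case: p => _ [].
Qed.

Lemma partition_nth_le nu m r : partition_of nu m -> (nth 0%N nu r <= m)%N.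
Proof.
move=> p; case: (ltnP r (size nu)) => [lt|ge]; last by rewrite nth_default.
rewrite -(partition_sum p (leqnn m)).
have rm := leq_trans lt (partition_size p).
by rewrite (bigD1 (Ordinal rm)) //= leq_addr.
Qed.

Lemma eq_partition nu nu' m m' : partition_of nu m -> partition_of nu' m' ->
  (forall r, nth 0%N nu r = nth 0%N nu' r)%N -> nu = nu'.
Proof.
move=> p p' E; apply: (@eq_from_nth _ 0%N) => // .
have H r : (r < size nu)%N = (r < size nu')%N.
  by rewrite (partition_pos _ p) (partition_pos _ p') E.
by have := H (size nu); have := H (size nu'); rewrite !ltnn; lia.
Qed.

Section Jordan.
Variables (k : closedFieldType) (N : nat).
Notation gl := 'M[k]_N.
Notation kN := 'cV[k]_N.
Implicit Types (x : gl) (u : kN) (v : nat -> kN) (s : nat) (U : {vspace kN}).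

Lemma free_subseq (vT : vectType k) (X Y : seq vT) : subseq X Y -> free Y -> free X.
Proof.
move=> st ft; have /(subseq_uniqP (free_uniq ft)) -> := st; exact: filter_free.
Qed.

Lemma free_dim_le (X : seq kN) U : free X -> {subset X <= U} -> (size X <= \dim U)%N.
Proof. by move=> /eqP <- /span_subvP; exact: dimvS. Qed.

Definition chains x (v : nat -> kN) s (lo len : nat -> nat) : seq kN :=
  [seq x ^+ j *m v r | r <- iota 0 s, j <- iota (lo r) (len r)].

Lemma chains_subseq x v s lo len len' :
  (forall r, len r = 0%N \/ (lo r + len r <= len' r)%N) ->
  subseq (chains x v s lo len) (chains x v s (fun=> 0%N) len').
Proof.
move=> H; rewrite /chains; elim: (iota 0 s) => //= r t IH.
apply: cat_subseq => //; apply: map_subseq.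
case: (H r) => [->|]; first exact: sub0seq.
move=> le; rewrite -(subnKC le) -addnA iotaD iotaD add0n.
apply: subseq_trans (suffix_subseq _ _); exact: prefix_subseq.
Qed.

Lemma size_chains x v s lo len : size (chains x v s lo len) = (\sum_(r < s) len r)%N.
Proof.
rewrite size_allpairs_dep sumnE big_map -(big_mkord xpredT) /index_iota subn0.
by apply: eq_bigr => i _; rewrite size_iota.
Qed.

Lemma mem_chains x v s lo len r j : (r < s)%N -> (lo r <= j < lo r + len r)%N ->
  x ^+ j *m v r \in chains x v s lo len.
Proof.
move=> rs jl; apply/allpairsPdep; exists r, j; split=> //; rewrite mem_iota //.
Qed.

Lemma chainsP x v s lo len u : u \in chains x v s lo len ->
  exists r j, [/\ (r < s)%N, (lo r <= j < lo r + len r)%N & u = x ^+ j *m v r].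
Proof.
by case/allpairsPdep => r [j [rs js ->]]; exists r, j; move: rs js; rewrite !mem_iota.
Qed.

Lemma sum_size_minn nu m a (F : nat -> nat -> nat) : partition_of nu m -> (m <= N)%N ->
  (forall a, F 0%N a = 0%N) ->
  (\sum_(r < size nu) F (nth 0%N nu r) a = \sum_(r < N) F (nth 0%N nu r) a)%N.
Proof.
move=> p mN F0; have sN := leq_trans (partition_size p) mN.
rewrite (big_ord_widen _ (fun r => F (nth 0%N nu r) a) sN) big_mkcond.
apply: eq_bigr => i _; case: ifP => // /negbT; rewrite -leqNgt => ?.
by rewrite nth_default ?F0.
Qed.

Lemma jordan_kappa x U nu : jordan_type x U nu ->
  stab x U /\ forall a, \dim (qker x 0 a U) = (\sum_(r < N) minn (nth 0%N nu r) a)%N.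
Proof.
case=> p [v [bX v0]].
have mN := dim_le U.
have fX : free (chains x v (size nu) (fun=> 0%N) (nth 0%N nu)) := basis_free bX.
have XU u : u \in chains x v (size nu) (fun=> 0%N) (nth 0%N nu) -> u \in U.
  by move=> uX; apply: (basis_mem bX).
have sx : stab x U.
  suff /subvP H : (mv x U <= U)%VS by move=> u uU; apply/H/mem_mv.
  rewrite -{1}(span_basis bX) /mv limg_span; apply/span_subvP => _ /mapP[u uX ->].
  rewrite lfunE /=; have [r [j [rs js ->]]] := chainsP uX.
  rewrite -exprS_mulmx; move: js; rewrite /= add0n.
  rewrite leq_eqVlt => /orP[/eqP ->|lt]; first by rewrite v0 // mem0v.
  exact/XU/mem_chains.
split=> // a.
have le1 : (\sum_(r < N) minn (nth 0%N nu r) a <= \dim (qker x 0 a U))%N.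
  rewrite -(sum_size_minn a p mN (F := minn)) => [|b]; last by rewrite min0n.
  rewrite -(size_chains x v _ (fun r => nth 0%N nu r - minn (nth 0%N nu r) a)%N (fun r => minn (nth 0%N nu r) a)%N).
  apply: free_dim_le.
    apply: free_subseq fX; apply: chains_subseq => r /=; right.
    lia.
  move=> u uK; rewrite mem_qker XU /=.
    have [r [j [rs /= js ->]]] := chainsP uK.
    have -> : x ^+ a *m (x ^+ j *m v r) =
        x ^+ (a + j - nth 0%N nu r) *m (x ^+ (nth 0%N nu r) *m v r).
      by rewrite -!exprD_mulmx; congr (_ ^+ _ *m _); lia.
    by rewrite v0 // mulmx0 mem0v.
  have [r [j [rs /= js ->]]] := chainsP uK; apply: mem_chains => //; lia.
have le2 : (\sum_(r < N) (nth 0%N nu r - a) <= \dim (mv (x ^+ a) U))%N.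
  rewrite -(sum_size_minn a p mN (F := subn)) => [|b]; last by rewrite sub0n.
  rewrite -(size_chains x v _ (fun r => a)%N (fun r => nth 0%N nu r - a)%N).
  apply: free_dim_le; first by apply: free_subseq fX; apply: chains_subseq => r /=; lia.
  move=> u /chainsP[r [j [rs /= js ->]]].
  have -> : j = (a + (j - a))%N by lia.
  by rewrite exprD_mulmx mem_mv // XU // mem_chains //; lia.
have := dim_qker x a U; rewrite -[RHS](partition_sum p mN).
have -> : (\sum_(r < N) nth 0%N nu r =
           \sum_(r < N) minn (nth 0%N nu r) a + \sum_(r < N) (nth 0%N nu r - a))%N.
  by rewrite -big_split /=; apply: eq_bigr => i _; lia.
lia.
Qed.

Lemma adapted_basis (vT : vectType k) (K : nat -> {vspace vT}) m :
    (forall a, K a.+1 <= K a)%VS -> K m = 0%VS ->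
  exists L : seq vT, forall a, basis_of (K a) (take (\dim (K a)) L).
Proof.
elim: m K => [|m IH] K Kd K0.
  exists [::] => a; have -> : K a = 0%VS; last exact: nil_basis.
  by elim: a => // a IH; apply/eqP; rewrite -subv0 -IH.
have [L bL] := IH (fun a => K a.+1) (fun a => Kd a.+1) K0.
have sz : size (take (\dim (K 1%N)) L) = \dim (K 1%N).
  by have := bL 0%N => /basis_free/eqP <-; rewrite (span_basis (bL 0%N)).
exists (take (\dim (K 1%N)) L ++ vbasis (K 0%N :\: K 1%N)) => -[|a].
  rewrite take_oversize; last first.
    rewrite size_cat sz size_tuple -(dimv_cap_compl (K 0%N) (K 1%N)) leq_add2r.
    by rewrite (capv_idPr (Kd 0%N)).
  have E : (K 1%N + (K 0%N :\: K 1%N))%VS = K 0%N.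
    by rewrite addvC addv_diff; apply/addv_idPl.
  rewrite -{1}E; apply: cat_basis; [|exact: bL 0%N|exact: vbasisP].
  by apply/directv_addP; rewrite capvC capv_diff.
have le : (\dim (K a.+1) <= \dim (K 1%N))%N.
  by apply: dimvS; elim: a => // a; exact: subv_trans (Kd _).
rewrite takel_cat ?sz // take_takel //; exact: bL.
Qed.

Lemma kappa_jordan x U nu : partition_of nu (\dim U) -> stab x U ->
    (forall a, \dim (qker x 0 a U) = (\sum_(r < N) minn (nth 0%N nu r) a)%N) ->
  jordan_type x U nu.
Proof.
move=> p sx kap; split=> //; have mN := dim_le U.
have nud := partition_noninc p.
have sN : (size nu <= N)%N := leq_trans (partition_size p) mN.
have qN : qker x 0 N U = U.
  apply/eqP; rewrite eqEdim qker_sub /= kap -{1}(partition_sum p mN).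
  apply: leq_sum => i _; rewrite leq_min leqnn /=.
  exact: leq_trans (partition_nth_le _ p) mN.
pose K a := qker x 0 1 (mv (x ^+ a) U).
have dK a : \dim (K a) = (\sum_(r < N) (a < nth 0%N nu r))%N.
  have := dim_qker x 1 (mv (x ^+ a) U); rewrite -mvM expr1 -/(K a) -[x *m _]exprS.
  have := dim_qker x a U; have := dim_qker x a.+1 U; rewrite !kap.
  under eq_bigr do rewrite minnSr.
  rewrite big_split /=; lia.
have Kd a : (K a.+1 <= K a)%VS.
  apply/subvP => u; rewrite !mem_qker => /andP[/mvP[w wU ->] ->].
  by rewrite exprSr_mulmx mem_mv ?sx.
have [L bL] : exists L : seq kN, forall a, basis_of (K a) (take (\dim (K a)) L).
  apply: (@adapted_basis _ K N) => //; apply/eqP; rewrite -dimv_eq0 dK.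
  rewrite big1 // => i _; rewrite ltnNge (leq_trans (partition_nth_le _ p)) //.
have dKr a r : (r < N)%N -> (r < \dim (K a))%N = (a < nth 0%N nu r)%N.
  move=> rN; rewrite dK (@sum_prefix N (fun r => a < nth 0%N nu r)%N) // => i.
  by move/leq_trans; apply.
have LK a r : (r < \dim (K a))%N -> L`_r \in K a.
  move=> lt; have := bL a => /basis_mem; apply; rewrite -(nth_take 0 lt) mem_nth //.
  by have := bL a => /basis_free/eqP <-; rewrite (span_basis (bL a)).
have /choice[v Hv] : forall r, exists v : kN, (r < size nu)%N ->
    [/\ v \in U, x ^+ (nth 0%N nu r).-1 *m v = L`_r & x ^+ (nth 0%N nu r) *m v = 0].
  move=> r; case: (ltnP r (size nu)) => [lt|_]; last by exists 0.
  have pos : (0 < nth 0%N nu r)%N by rewrite -(partition_pos _ p).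
  have : L`_r \in K (nth 0%N nu r).-1.
    apply: LK; rewrite dKr; [lia | exact: leq_trans sN].
  rewrite mem_qker => /andP[/mvP[w wU E] z]; exists w => _; split=> //.
  rewrite -(prednK pos) exprS_mulmx -E.
  by move: z; rewrite expr1 memv0 => /eqP.
exists v; split; last by move=> r /Hv[].
rewrite -/(chains x v (size nu) (fun=> 0%N) (nth 0%N nu)) basisEdim; apply/andP; split; last first.
  rewrite size_chains; have := sum_nth_le (leqnn (size nu)) => ->.
  by case: p => _ [_ ->].
set X := chains _ _ _ _ _.
suff H a u : u \in U -> x ^+ a *m u = 0 -> u \in <<X>>%VS.
  apply/subvP => u uU; apply: (H N) => //; move: uU; rewrite -{1}qN mem_qker memv0.
  by case/andP => _ /eqP.
elim: a u => [|a IH] u uU; first by rewrite expr0_mulmx => ->; apply: mem0v.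
move=> xu; have : x ^+ a *m u \in K a.
  by rewrite mem_qker mem_mv //= expr1 -exprS_mulmx xu mem0v.
have szt : size (take (\dim (K a)) L) = \dim (K a).
  by have := bL a => /basis_free/eqP <-; rewrite (span_basis (bL a)).
rewrite -(span_basis (bL a)) => /(@coord_span _ _ _ (in_tuple _)) E.
pose c i := coord (in_tuple (take (\dim (K a)) L)) i (x ^+ a *m u).
pose w := \sum_i c i *: (x ^+ ((nth 0%N nu i).-1 - a) *m v i).
have Hi (i : 'I_(size (take (\dim (K a)) L))) : (i < size nu)%N /\ (a < nth 0%N nu i)%N.
  have lt : (i < \dim (K a))%N by rewrite -[X in (_ < X)%N]szt.
  have iN : (i < N)%N by apply: leq_trans lt _; exact: dim_le.
  move: lt; rewrite dKr // => lt; split=> //.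
  by rewrite (partition_pos _ p); apply: leq_trans lt.
have wU : w \in U.
  by apply: memv_suml => i _; apply: memvZ; apply: stab_exp => //; case: (Hv i (Hi i).1).
have wX : w \in <<X>>%VS.
  apply: memv_suml => i _; apply: memvZ; apply: memv_span; apply: mem_chains.
    by case: (Hi i).
  have := (Hi i).2; lia.
rewrite -(subrK w u) memvD // IH //; first exact: memvB.
rewrite mulmxBr /w mulmx_sumr {1}E; apply/eqP; rewrite subr_eq0; apply/eqP.
apply: eq_bigr => i _; rewrite -scalemxAr /c; congr (_ *: _).
have [si ai] := Hi i; rewrite -exprD_mulmx.
rewrite subnKC; last by rewrite -ltnS prednK // (leq_ltn_trans _ ai).
case: (Hv i si) => _ -> _; rewrite /= nth_take // -[X in (_ < X)%N]szt; exact: ltn_ord.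
Qed.

End Jordan.

(** * Standard tableaux *)

Section NatTableaux.
Local Open Scope nat_scope.

(* [rowle T i r] is the length of row r of the shape occupied by the entries <= i. *)
Definition rowle (T : tableau) (i r : nat) : nat := count (fun t => t <= i) (nth [::] T r).

Lemma count_leq_sorted s i c : sorted ltn s ->
  (c < count (fun t => t <= i) s) = (c < size s) && (nth 0 s c <= i).
Proof.
elim: s c => [|a s IH] c /=; first by rewrite !ltn0.
move=> pa; have so := path_sorted pa.
case: (leqP a i) => ai.
  by case: c => [|c] /=; rewrite ?add1n ?ltnS ?add0n //= IH.
rewrite add0n; have -> : count (fun t => t <= i) s = 0.
  apply/eqP; rewrite -leqn0 leqNgt -has_count -all_predC; apply/allP => t ts /=.
  rewrite -ltnNge (ltn_trans ai) //.
  by have /allP := order_path_min ltn_trans pa; apply.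
rewrite ltn0; apply/esym/negP => /andP[cs].
case: c cs => [|c] /=; first by move=> _; rewrite leqNgt ai.
rewrite ltnS => cs; rewrite leqNgt (ltn_trans ai) //.
by have /allP := order_path_min ltn_trans pa; apply; apply: mem_nth.
Qed.

Lemma nth_shape (T : tableau) r : nth 0 (shape T) r = size (nth [::] T r).
Proof.
case: (ltnP r (size T)) => ?; first by rewrite (nth_map [::]).
by rewrite !nth_default ?size_map.
Qed.

Lemma sum_nat1 n (f : nat -> nat) : \sum_(r < n) f r = 1 ->
  exists2 r0, r0 < n & forall r, r < n -> f r = (r == r0).
Proof.
elim: n => [|n IH]; first by rewrite big_ord0.
rewrite big_ord_recr /=; case: (posnP (f n)) => [fn0|fn].
  rewrite fn0 addn0 => /IH[r0 r0n H]; exists r0; first exact: ltnW.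
  move=> r; rewrite ltnS leq_eqVlt => /orP[/eqP ->|/H //]; rewrite fn0.
  by rewrite (gtn_eqF r0n).
move=> E; have f1 : f n = 1 by lia.
move: E; rewrite f1 => /eqP; rewrite -[X in _ == X]add0n eqn_add2r.
rewrite sum_nat_eq0 => /forallP Z; exists n => // r.
rewrite ltnS leq_eqVlt => /orP[/eqP ->|lt]; first by rewrite eqxx f1.
by have /eqP := Z (Ordinal lt); rewrite /= => ->; rewrite (ltn_eqF lt).
Qed.

Lemma sum_widen s n (F : nat -> nat) : s <= n -> (forall r, s <= r -> F r = 0) ->
  \sum_(r < s) F r = \sum_(r < n) F r.
Proof.
move=> sn F0; rewrite (big_ord_widen _ F sn) big_mkcond; apply: eq_bigr => i _.
by case: ifP => // /negbT; rewrite -leqNgt => /F0.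
Qed.

Section Std.
Variables (nu : seq nat) (T : tableau) (d : nat).
Hypotheses (pnu : partition_of nu d) (sT : is_std nu T).

Lemma std_size r : size (nth [::] T r) = nth 0 nu r.
Proof. by case: sT => <- _ _ _; rewrite nth_shape. Qed.

Lemma std_row_sorted r : sorted ltn (nth [::] T r).
Proof.
apply/(sortedP 0) => c; rewrite std_size => lt; case: sT => _ _ H _; exact: H.
Qed.

Lemma lt_rowle i r c : (c < rowle T i r) = in_diagram nu r c && (entry T r c <= i).
Proof. by rewrite /rowle count_leq_sorted ?std_row_sorted // std_size. Qed.

Lemma rowle_noninc i r : rowle T i r.+1 <= rowle T i r.
Proof.
rewrite leqNgt; apply/negP => lt; have := lt_rowle i r.+1 (rowle T i r).
rewrite lt => /esym/andP[dg le]; have := lt_rowle i r (rowle T i r).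
rewrite ltnn => /esym/negP; apply; apply/andP; split.
  by apply: leq_trans dg _; apply: partition_noninc pnu _.
by apply: leq_trans le; apply: ltnW; case: sT => _ _ _ H; apply: H.
Qed.

Lemma sumn_shape : sumn nu = d.
Proof. by case: pnu => _ []. Qed.

Lemma std_entries r t : t \in nth [::] T r -> 0 < t <= d.
Proof.
move=> tr; have rT : r < size T.
  by rewrite ltnNge; apply/negP => ge; rewrite nth_default in tr.
have : t \in flatten T by apply/flattenP; exists (nth [::] T r); rewrite ?mem_nth.
case: sT => _ /perm_mem -> _ _; rewrite mem_iota sumn_shape; lia.
Qed.

Lemma rowle0 r : rowle T 0 r = 0.
Proof.
apply/eqP; rewrite -leqn0 leqNgt -has_count; apply/hasP => -[t /std_entries].
by case: t.
Qed.

Lemma rowle_full i r : d <= i -> rowle T i r = nth 0 nu r.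
Proof.
move=> di; rewrite -std_size; apply/eqP; rewrite -all_count; apply/allP => t.
by move/std_entries => /andP[_ /leq_trans]; apply.
Qed.

Lemma rowle_max i r : rowle T i r <= nth 0 nu r.
Proof. by rewrite -std_size count_size. Qed.

Lemma size_std : size T = size nu.
Proof. by case: sT => <-; rewrite size_map. Qed.

Lemma sum_count_rows n (a : pred nat) : size T <= n ->
  \sum_(r < n) count a (nth [::] T r) = count a (iota 1 d).
Proof.
move=> sn; case: sT => _ /permP; rewrite sumn_shape => <- _ _.
rewrite count_flatten sumnE big_map (big_nth [::]) big_mkord.
by apply/esym/(sum_widen (F := fun r => count a (nth [::] T r)) sn) => r ?; rewrite nth_default.
Qed.

Lemma rowle_sum n i : size T <= n -> i <= d -> \sum_(r < n) rowle T i r = i.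
Proof.
move=> sn id; rewrite sum_count_rows // -(subnKC id) iotaD count_cat.
rewrite (@eq_in_count _ _ xpredT) ?count_predT ?size_iota; last first.
  by move=> t; rewrite mem_iota; lia.
rewrite (@eq_in_count _ _ pred0) ?count_pred0 ?addn0 // => t.
by rewrite mem_iota /=; lia.
Qed.

Lemma rowleS_mem i r : rowle T i.+1 r = rowle T i r + count_mem i.+1 (nth [::] T r).
Proof.
rewrite /rowle; elim: (nth [::] T r) => //= t s ->.
have -> : (t <= i.+1) = (t <= i) + (t == i.+1) :> nat by lia.
lia.
Qed.

Lemma rowle_step i : i < d -> exists2 r0, r0 < size T &
  forall r, rowle T i.+1 r = rowle T i r + (r == r0).
Proof.
move=> id; have [] := @sum_nat1 (size T) (fun r => count_mem i.+1 (nth [::] T r)).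
  rewrite sum_count_rows // count_uniq_mem ?iota_uniq // mem_iota.
  by have -> : 1 <= i.+1 < 1 + d by lia.
move=> r0 r0s H; exists r0 => // r; rewrite rowleS_mem; congr (_ + _).
case: (ltnP r (size T)) => rT; first exact: H.
by rewrite nth_default //= gtn_eqF // (leq_trans r0s).
Qed.

End Std.

Lemma std_inj nu nu' T T' d : partition_of nu d -> partition_of nu' d ->
    is_std nu T -> is_std nu' T' ->
  (forall i r, i <= d -> rowle T i r = rowle T' i r) -> T = T'.
Proof.
move=> p p' s s' E.
have nuE : nu = nu'.
  by apply: (eq_partition p p') => r; rewrite -(rowle_full p s r (leqnn d)) E // (rowle_full p' s').
rewrite -{}nuE in s' *; apply: (@eq_from_nth _ [::]); first by rewrite (size_std s) (size_std s').
move=> r _; apply: (@eq_from_nth _ 0); first by rewrite (std_size s) (std_size s').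
move=> c; rewrite (std_size s) => cr.
have H i : i <= d -> (entry T r c <= i) = (entry T' r c <= i).
  move=> id; have := lt_rowle s i r c; rewrite E // (lt_rowle s') /in_diagram cr.
  by [].
have b1 : entry T r c <= d.
  by have /(std_entries p s)/andP[] := @mem_nth _ 0 (nth [::] T r) c ltac:(by rewrite (std_size s)).
have b2 : entry T' r c <= d.
  by have /(std_entries p s')/andP[] := @mem_nth _ 0 (nth [::] T' r) c ltac:(by rewrite (std_size s')).
have := H _ b1; have := H _ b2; rewrite !leqnn /entry; lia.
Qed.

Lemma std_of_rowle nu T d : partition_of nu d -> shape T = nu ->
    (forall r, sorted ltn (nth [::] T r)) -> perm_eq (flatten T) (iota 1 d) ->
    (forall i r, rowle T i r.+1 <= rowle T i r) -> is_std nu T.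
Proof.
move=> p sh so pe H; have sN : sumn nu = d by case: p => _ [].
have sz r : size (nth [::] T r) = nth 0 nu r by rewrite -sh nth_shape.
have uq : uniq (flatten T) by rewrite (perm_uniq pe) iota_uniq.
split; rewrite ?sN // => r c dg.
  by apply: (sortedP 0 (so r)); rewrite sz.
rewrite ltn_neqAle; apply/andP; split; last first.
  have: c < rowle T (entry T r.+1 c) r.
    by apply: leq_trans (H _ _); rewrite /rowle count_leq_sorted // sz leqnn andbT; exact: dg.
  by rewrite /rowle count_leq_sorted // => /andP[].
apply/eqP => E.
have c1 : c < size (nth [::] T r) by rewrite sz (leq_trans dg) // (partition_noninc p).
have c2 : c < size (nth [::] T r.+1) by rewrite sz.
have rT : r.+1 < size T by rewrite ltnNge; apply/negP => ge; rewrite nth_default in c2.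
have := uq; rewrite -(cat_take_drop r.+1 T) flatten_cat cat_uniq.
case/and3P => _ /hasP[]; exists (entry T r c) => /=.
  rewrite {1}E; apply/flattenP; exists (nth [::] T r.+1); last exact: mem_nth.
  by rewrite (drop_nth [::] rT) mem_head.
apply/flattenP; exists (nth [::] T r); last exact: mem_nth.
by rewrite -(nth_take [::] (ltnSn r)) mem_nth // size_takel // ltnW.
Qed.

Section OfChain.
Variables (nu : seq nat) (d : nat) (g : nat -> nat -> nat).
Hypotheses (pnu : partition_of nu d) (g0 : forall r, g 0 r = 0)
  (gd : forall r, g d r = nth 0 nu r)
  (gS : forall i, i < d -> exists r0, forall r, g i.+1 r = g i r + (r == r0))
  (gn : forall i r, i <= d -> g i r.+1 <= g i r).

Definition tableau_of_chain : tableau :=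
  mkseq (fun r => [seq i <- iota 1 d | g i.-1 r < g i r]) (size nu).

Lemma chain_mono i j r : i <= j <= d -> g i r <= g j r.
Proof.
case/andP => /subnK <-; elim: (j - i) => // m IH lt.
have [r0 E] := gS (i := m + i) ltac:(lia).
by rewrite addSn E; apply: leq_trans (leq_addr _ _); apply: IH; lia.
Qed.

Lemma nth_tableau_of_chain r :
  nth [::] tableau_of_chain r = [seq i <- iota 1 d | g i.-1 r < g i r].
Proof.
case: (ltnP r (size nu)) => rs; first by rewrite nth_mkseq.
rewrite nth_default ?size_mkseq //; apply/esym/eqP; rewrite -[_ == _]negbK -has_filter.
apply/hasPn => i; rewrite mem_iota => ir; rewrite -leqNgt.
have := @chain_mono i d r ltac:(lia); rewrite gd nth_default //; lia.
Qed.

Lemma rowle_tableau_of_chain i r : i <= d -> rowle tableau_of_chain i r = g i r.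
Proof.
move=> id; rewrite /rowle nth_tableau_of_chain count_filter -(subnKC id) iotaD count_cat.
rewrite [X in _ + X](@eq_in_count _ _ pred0) ?count_pred0 ?addn0; last first.
  by move=> t; rewrite mem_iota /=; lia.
rewrite (@eq_in_count _ _ (fun j => g j.-1 r < g j r)); last first.
  by move=> t; rewrite mem_iota /= => tr; have -> : t <= i by lia.
elim: i id => [|i IH] id; first by rewrite g0.
have [r0 E] := gS id.
rewrite -{1}[i.+1]addn1 iotaD count_cat IH 1?ltnW //= addn0 add1n E /=.
by case: (r == r0) => /=; rewrite ?addn0 ?ltnn ?addn1 ?ltnSn ?addn0 ?addn1.
Qed.

Lemma rowle_tableau_of_chain_ge i r : d <= i -> rowle tableau_of_chain i r = g d r.
Proof.
move=> di; rewrite -rowle_tableau_of_chain // /rowle nth_tableau_of_chain.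
apply: eq_in_count => t; rewrite mem_filter mem_iota; lia.
Qed.

Lemma std_tableau_of_chain : is_std nu tableau_of_chain.
Proof.
apply: (std_of_rowle pnu).
- apply: (@eq_from_nth _ 0); first by rewrite size_map size_mkseq.
  move=> r; rewrite nth_shape => rs; rewrite -gd -rowle_tableau_of_chain // /rowle.
  apply/esym/eqP; rewrite -all_count; apply/allP => t; rewrite nth_tableau_of_chain mem_filter mem_iota; lia.
- move=> r; rewrite nth_tableau_of_chain sorted_filter ?iota_ltn_sorted //.
  exact: ltn_trans.
- apply/allP => t _ /=; rewrite count_flatten sumnE big_map (big_nth [::]) size_mkseq big_mkord.
  under eq_bigr => i _ do rewrite nth_tableau_of_chain count_filter.
  rewrite count_uniq_mem ?iota_uniq // mem_iota.
  case: (boolP (1 <= t < 1 + d)) => td; last first.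
    apply/eqP; rewrite big1 // => i _; rewrite (@eq_in_count _ _ pred0) ?count_pred0 // => j.
    by rewrite mem_iota /= => jd; have -> : (j == t) = false by lia.
  have [r0 E] := gS (i := t.-1) ltac:(lia); rewrite prednK in E; last lia.
  have r0s : r0 < size nu.
    rewrite (partition_pos _ pnu) -gd; apply: leq_trans (@chain_mono t d r0 _); last by lia.
    by rewrite E eqxx addn1.
  rewrite (bigD1 (Ordinal r0s)) //= big1 => [|i ne]; last first.
    rewrite (@eq_in_count _ _ pred0) ?count_pred0 // => j _ /=.
    case: (eqVneq j t) => //= ->; rewrite E.
    have -> : (nat_of_ord i == r0) = false by apply: contraNF ne => /eqP r0E; apply/eqP/val_inj.
    by rewrite addn0 ltnn.
  rewrite addn0 (@eq_in_count _ _ (pred1 t)) => [|j _ /=].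
    by rewrite count_uniq_mem ?iota_uniq // mem_iota td.
  by case: (eqVneq j t) => //= ->; rewrite E eqxx addn1 ltnSn.
- move=> i r; case: (leqP i d) => id; first by rewrite !rowle_tableau_of_chain ?gn.
  by have di := ltnW id; rewrite !rowle_tableau_of_chain_ge // gn.
Qed.

End OfChain.

End NatTableaux.

Lemma sum_minnSr n (f : nat -> nat) a :
  (\sum_(r < n) minn (f r) a.+1 = \sum_(r < n) minn (f r) a + \sum_(r < n) (a < f r))%N.
Proof. by rewrite -big_split /=; apply: eq_bigr => i _; rewrite minnSr. Qed.

Section Spaltenstein.
Variables (k : closedFieldType) (N : nat).
Notation gl := 'M[k]_N.
Notation kN := 'cV[k]_N.
Implicit Types (x : gl) (u : kN) (H U A : {vspace kN}) (f g : nat -> nat).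

Lemma qker_capv x A a H U : (H <= U)%VS -> qker x A a H = (qker x A a U :&: H)%VS.
Proof.
move=> HU; apply/vspaceP => u; rewrite memv_cap !mem_qker.
case: (boolP (u \in H)) => uH; rewrite ?andbF // (subvP HU) // andbT //.
Qed.

Definition has_type x A U f :=
  stab x U /\ forall a, \dim (qker x A a U) = (\dim A + \sum_(r < N) minn (f r) a)%N.

Lemma type_mono x H U f g : (H <= U)%VS ->
    (forall r, f r.+1 <= f r)%N -> (forall r, g r.+1 <= g r)%N ->
    has_type x 0 H f -> has_type x 0 U g ->
  forall r, (r < N)%N -> (f r <= g r)%N.
Proof.
move=> HU fd gd [sH kH] [sU kU] r rN; rewrite leqNgt; apply/negP => lt.
have le a : (\sum_(r < N) (a < f r) <= \sum_(r < N) (a < g r))%N.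
  have le1 : (qker x 0 a.+1 H + qker x 0 a U <= qker x 0 a.+1 U)%VS.
    rewrite subv_add (qker_capv _ _ _ HU) capvSl /=; apply: qker_mono => //.
    by move=> u; rewrite memv0 => /eqP ->; rewrite mulmx0 mem0v.
  have := dimvS le1; have := dimv_sum_cap (qker x 0 a.+1 H) (qker x 0 a U).
  have -> : (qker x 0 a.+1 H :&: qker x 0 a U)%VS = qker x 0 a H.
    apply/vspaceP => u; rewrite memv_cap !mem_qker !memv0.
    case: (boolP (u \in H)) => //= uH; rewrite (subvP HU) //= exprS_mulmx.
    by case: (x ^+ a *m u =P 0) => [-> |]; rewrite ?mulmx0 ?eqxx ?andbF.
  rewrite !kH !kU (sum_minnSr _ f) (sum_minnSr _ g); lia.
have P1 := @sum_prefix N (fun i => g r < f i)%N (fun i => fun h => leq_trans h (fd i)) r rN.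
have P2 := @sum_prefix N (fun i => g r < g i)%N (fun i => fun h => leq_trans h (gd i)) r rN.
have := le (g r); rewrite lt in P1; rewrite ltnn in P2.
by move/(leq_trans P1); rewrite P2.
Qed.

Lemma jordan_has_type x U nu : jordan_type x U nu -> has_type x 0 U (nth 0%N nu).
Proof. by move=> /jordan_kappa[sx kx]; split=> // a; rewrite kx dimv0. Qed.

Lemma has_type_jordan x U nu : partition_of nu (\dim U) ->
  has_type x 0 U (nth 0%N nu) -> jordan_type x U nu.
Proof.
by move=> p [sx kx]; apply: kappa_jordan => // a; rewrite kx dimv0.
Qed.

Lemma eq_has_type x A U f g : (forall r, (r < N)%N -> f r = g r) ->
  has_type x A U f -> has_type x A U g.
Proof.
by move=> E [sx kx]; split=> // a; rewrite kx; congr (_ + _)%N; apply: eq_bigr => i _; rewrite E.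
Qed.

Lemma spaltensteinP x d (F : nat -> {vspace kN}) T :
    (forall i, (i <= d)%N -> \dim (F i) = i) ->
    (forall i, (i < d)%N -> (F i <= F i.+1)%VS) ->
  spaltenstein x d F T <->
  [/\ is_std (shape T) T, partition_of (shape T) d &
      forall i, (i <= d)%N -> has_type x 0 (F i) (rowle T i)].
Proof.
move=> dF FS.
have dN : (d <= N)%N by rewrite -{1}(dF d (leqnn d)) dim_le.
split=> [[nu [nuJ sT box]]|[sT pT tF]].
  have sh : shape T = nu d by case: sT.
  have pnu i : (i <= d)%N -> partition_of (nu i) i.
    by move=> id; have := (nuJ i id).1; rewrite dF.
  rewrite sh; split=> //; first exact: pnu.
  suff E i : (i <= d)%N -> forall r, nth 0%N (nu i) r = rowle T i r.
    by move=> i id; apply: eq_has_type (jordan_has_type (nuJ i id)) => r _; rewrite E.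
  have key j : (j <= d)%N -> forall r c,
      in_diagram (nu j) r c = in_diagram (nu d) r c && (entry T r c <= j)%N.
    elim: j => [|j IH] jd r c.
      have -> : nu 0%N = [::] by apply/nilP; have := partition_size (pnu 0%N jd); case: (nu 0%N).
      rewrite /in_diagram nth_nil ltn0; apply/esym/negP => /andP[dg].
      have cs : (c < size (nth [::] T r))%N by rewrite (std_size sT).
      have : (0 < entry T r c <= d)%N := std_entries (pnu d (leqnn d)) sT (mem_nth 0%N cs).
      lia.
    have sub : in_diagram (nu j) r c -> in_diagram (nu j.+1) r c.
      rewrite /in_diagram => /leq_trans; apply; case: (ltnP r N) => rN; last first.
        by rewrite nth_default //; have := partition_size (pnu j (ltnW jd)); lia.
      apply: (type_mono (FS j jd) _ _ (jordan_has_type (nuJ j (ltnW jd))) (jordan_has_type (nuJ j.+1 jd))) => //.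
        exact: (partition_noninc (pnu j (ltnW jd))).
      exact: (partition_noninc (pnu j.+1 jd)).
    have := box j.+1 r c ltac:(by rewrite jd); rewrite /= => B.
    rewrite (leq_eqVlt _ j.+1) ltnS andb_orr -(IH (ltnW jd)) B.
    by case: (in_diagram (nu j) r c) sub => [->|_]; rewrite ?andbF ?orbT ?andbT ?orbF.
  move=> id r; have H c : (c < nth 0%N (nu i) r)%N = (c < rowle T i r)%N.
    by rewrite (lt_rowle sT) -key.
  by have := H (nth 0%N (nu i) r); have := H (rowle T i r); rewrite !ltnn; lia.
pose nu i := filter (ltn 0%N) (mkseq (rowle T i) N).
have sz : (size T <= N)%N by have := partition_size pT; rewrite size_map => /leq_trans; apply.
have R0 i r : (N <= r)%N -> rowle T i r = 0%N.
  by move=> Nr; rewrite /rowle nth_default // (leq_trans sz).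
have nth_filter (s : seq nat) r : sorted geq s -> nth 0%N (filter (ltn 0%N) s) r = nth 0%N s r.
  elim: s r => //= a s IH r pa; case: (posnP a) => [a0|ap]; last first.
    by case: r => //= r; apply: IH; apply: path_sorted pa.
  have s0 : all (pred1 0%N) s.
    apply/allP => t ts; have /allP/(_ t ts) := order_path_min (rev_trans leq_trans) pa.
    by rewrite a0 /= leqn0.
  have -> : filter (ltn 0%N) s = [::].
    by apply/eqP; rewrite -[_ == _]negbK -has_filter; apply/hasPn => t /(allP s0)/eqP ->.
  rewrite nth_nil; case: r => [|r] /=; rewrite ?a0 //.
  case: (ltnP r (size s)) => rs; last by rewrite nth_default.
  by have /eqP := allP s0 _ (mem_nth 0%N rs).
have so i : sorted geq (mkseq (rowle T i) N).
  apply/(sortedP 0%N) => r; rewrite size_mkseq => rN; rewrite !nth_mkseq //; last exact: ltnW.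
  exact: rowle_noninc pT sT i r.
have nuE i r : nth 0%N (nu i) r = rowle T i r.
  rewrite nth_filter //; case: (ltnP r N) => rN; first by rewrite nth_mkseq.
  by rewrite nth_default ?size_mkseq // R0.
have pnu i : (i <= d)%N -> partition_of (nu i) i.
  move=> id; split; first by apply: sorted_filter (so i) => ? ? ? /=; lia.
  split; first by apply/allP => t; rewrite mem_filter => /andP[].
  rewrite -(sum_nth_le (n := N)); last by rewrite size_filter (leq_trans (count_size _ _)) ?size_mkseq.
  by under eq_bigr do rewrite nuE; apply: rowle_sum pT sT _ _ sz id.
have nud : nu d = shape T.
  by apply: (eq_partition (pnu d (leqnn d)) pT) => r; rewrite nuE (rowle_full pT sT).
exists nu; split; first 2 last.
- move=> i r c /andP[i0 id]; rewrite nud; case: i i0 id => // i _ id /=.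
  rewrite /in_diagram !nuE !(lt_rowle sT) /in_diagram; lia.
- move=> i id; apply: has_type_jordan; first by rewrite dF //; apply: pnu.
  by apply: eq_has_type (tF i id) => r _; rewrite nuE.
- by rewrite nud.
Qed.

End Spaltenstein.

Section NatStacking.
Local Open Scope nat_scope.

Section PartialSums.
Variables (n : nat) (F : 'I_n -> nat).

Definition psum (j : nat) : nat := \sum_(l < n | l < j) F l.

Lemma psum0 : psum 0 = 0.
Proof. by rewrite /psum big_pred0 // => l. Qed.

Lemma psumS (j : 'I_n) : psum j.+1 = psum j + F j.
Proof.
rewrite /psum (bigD1 j) //= addnC; congr (_ + _); apply: eq_bigl => l.
by rewrite ltnS andbC -ltn_neqAle.
Qed.

Lemma psum_all : psum n = \sum_l F l.
Proof. by apply: eq_bigl => l; rewrite ltn_ord. Qed.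

Lemma leq_psum i j : i <= j -> psum i <= psum j.
Proof.
move=> ij; rewrite /psum [X in _ <= X](bigID (fun l : 'I_n => l < i)) /=.
apply: leq_trans (leq_addr _ _); rewrite big_mkcond [X in _ <= X]big_mkcond.
apply: leq_sum => l _; case: ifP => // li; rewrite (leq_trans li ij) //.
Qed.

Lemma psum_block i : i < psum n -> exists j : 'I_n, psum j <= i < psum j.+1.
Proof.
suff H m : m <= n -> i < psum m -> exists j : 'I_n, psum j <= i < psum j.+1 by exact: H.
elim: m => [|m IH] mn; first by rewrite psum0.
case: (ltnP i (psum m)) => [/(IH (ltnW mn))|le lt]; first by [].
by exists (Ordinal mn); rewrite le.
Qed.

End PartialSums.

Section Stk.
Variables (n : nat) (lam : n.-tuple nat) (mu : n.-tuple (seq nat)).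
Hypothesis pmu : forall i, partition_of (tnth mu i) (tnth lam i).

Notation Lam := (psum (tnth lam)).
Notation d := (\sum_(l < n) tnth lam l).

Lemma row_sumE j r : row_sum mu j r = psum (fun l => nth 0 (tnth mu l) r) j.
Proof. by []. Qed.

Lemma nth_muSigma r : nth 0 (muSigma mu) r = \sum_(l < n) nth 0 (tnth mu l) r.
Proof.
case: (ltnP r (\max_(i < n) size (tnth mu i))) => lt; first by rewrite nth_mkseq.
rewrite nth_default ?size_mkseq //; apply/esym/eqP; rewrite sum_nat_eq0.
apply/forallP => l; rewrite /= nth_default //; apply: leq_trans lt.
exact: (@leq_bigmax _ (fun i => size (tnth mu i))).
Qed.

Lemma partition_muSigma : partition_of (muSigma mu) d.
Proof.
have H r : nth 0 (muSigma mu) r.+1 <= nth 0 (muSigma mu) r.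
  by rewrite !nth_muSigma; apply: leq_sum => l _; apply: partition_noninc (pmu l) _.
split; first by apply/(sortedP 0) => r _; apply: H.
split.
  apply/(all_nthP 0) => r; rewrite size_mkseq => lt; rewrite nth_muSigma.
  rewrite lt0n; apply: contraL lt => /eqP/eqP; rewrite sum_nat_eq0 => /forallP Z.
  rewrite -leqNgt; apply/bigmax_leqP => l _; have := Z l; rewrite /= -leqn0 leqNgt.
  by rewrite -(partition_pos _ (pmu l)) -leqNgt.
have le l : size (tnth mu l) <= size (muSigma mu).
  by rewrite size_mkseq; apply: (@leq_bigmax _ (fun i => size (tnth mu i))).
rewrite -(sum_nth_le (leqnn _)); under eq_bigr do rewrite nth_muSigma.
rewrite exchange_big; apply: eq_bigr => l _ /=.
by rewrite (sum_nth_le (le l)); case: (pmu l) => _ [].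
Qed.

Variable sg : n.-tuple tableau.
Hypothesis ssg : forall i, is_std (tnth mu i) (tnth sg i).

Definition stk_chain i r := \sum_(l < n) rowle (tnth sg l) (i - Lam l) r.

Lemma Lam_le (l : 'I_n) : Lam l + tnth lam l <= d.
Proof. by rewrite -psumS -psum_all leq_psum. Qed.

Lemma stk_chain0 r : stk_chain 0 r = 0.
Proof. by rewrite /stk_chain big1 // => l _; rewrite sub0n (rowle0 (pmu l)). Qed.

Lemma stk_chain_full r : stk_chain d r = nth 0 (muSigma mu) r.
Proof.
rewrite nth_muSigma; apply: eq_bigr => l _; apply: (rowle_full (pmu l)) => //.
by have := Lam_le l; lia.
Qed.

Lemma stk_chain_noninc i r : stk_chain i r.+1 <= stk_chain i r.
Proof. by apply: leq_sum => l _; apply: (rowle_noninc (pmu l)). Qed.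

(* Below block j everything is full, above it everything is empty. *)
Lemma stk_chain_block (j : 'I_n) i r : Lam j <= i <= Lam j.+1 ->
  stk_chain i r = psum (fun l => nth 0 (tnth mu l) r) j + rowle (tnth sg j) (i - Lam j) r.
Proof.
move=> ij; rewrite /stk_chain (bigID (fun l : 'I_n => l < j)) /=.
congr (_ + _).
  apply: eq_bigr => l lj; apply: (rowle_full (pmu l)) => //.
  by have := @leq_psum _ (tnth lam) l.+1 j lj; rewrite psumS; lia.
rewrite (bigD1 j) ?ltnn //= big1 ?addn0 // => l /andP[lj nlj].
have jl : j < l by rewrite ltn_neqAle eq_sym nlj leqNgt lj.
have := @leq_psum _ (tnth lam) j.+1 l jl => H.
have -> : i - Lam l = 0 by lia.
  by rewrite (rowle0 (pmu l) (ssg l)).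
Qed.

Lemma stk_chain_step i : i < d ->
  exists r0, forall r, stk_chain i.+1 r = stk_chain i r + (r == r0).
Proof.
rewrite -psum_all => /psum_block[j /andP[ji ij]].
have [] := @rowle_step _ _ _ (pmu j) (ssg j) (i - Lam j).
  by move: ij; rewrite psumS; lia.
move=> r0 _ E; exists r0 => r.
rewrite !(@stk_chain_block j); try lia.
by rewrite -addnA -E; congr (_ + rowle _ _ _); lia.
Qed.

Lemma stk_blockE (j : 'I_n) r c :
  row_sum mu j r <= c < row_sum mu j.+1 r -> stk_block mu r c = j.
Proof.
case/andP => le lt; apply/eqP; rewrite eqn_leq; apply/andP; split.
  apply/bigmax_leqP => l lc; rewrite leqNgt; apply/negP => jl.
  by have := leq_trans lt (leq_trans (leq_psum _ jl) lc); rewrite ltnn.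
exact: (@leq_bigmax_cond _ _ (fun l : 'I_n => nat_of_ord l)).
Qed.

Lemma stkE : stk lam mu sg = tableau_of_chain (muSigma mu) d stk_chain.
Proof.
have p := partition_muSigma.
have cS := stk_chain_step; have c0 := stk_chain0; have cF := stk_chain_full.
have cn i r : i <= d -> stk_chain i r.+1 <= stk_chain i r by move=> _; apply: stk_chain_noninc.
have st := std_tableau_of_chain p c0 cF cS cn.
set T := tableau_of_chain _ _ _ in st *.
apply: (@eq_from_nth _ [::]); first by rewrite !size_mkseq.
move=> r; rewrite size_mkseq => rs; rewrite nth_mkseq //.
apply: (@eq_from_nth _ 0); first by rewrite size_mkseq (std_size st).
move=> c; rewrite size_mkseq => cr; rewrite nth_mkseq //.
suff H i : i <= d -> (stk_entry lam mu sg r c <= i) = (entry T r c <= i).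
  have b : entry T r c <= d.
    by have /(std_entries p st)/andP[] := @mem_nth _ 0 (nth [::] T r) c ltac:(by rewrite (std_size st)).
  have h1 := H _ b; rewrite leqnn in h1; have h2 := H _ (leq_trans h1 b).
  by rewrite leqnn in h2; apply/eqP; rewrite eqn_leq h1 -h2.
move=> id; have := lt_rowle st i r c; rewrite /in_diagram cr /= => <-.
rewrite (rowle_tableau_of_chain c0 cF cS) //.
have [j jc] : exists j : 'I_n, row_sum mu j r <= c < row_sum mu j.+1 r.
  by apply: psum_block; rewrite psum_all -nth_muSigma.
have bE := stk_blockE jc; rewrite /stk_entry bE -tnth_nth -/(Lam j).
move: jc; rewrite !row_sumE psumS; set s := psum _ j => jc.
have cj : c - s < nth 0 (tnth mu j) r by lia.
have jpos : 0 < entry (tnth sg j) r (c - s) <= tnth lam j.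
  by apply: (std_entries (pmu j) (ssg j)); apply: mem_nth; rewrite (std_size (ssg j)).
case: (ltnP i (Lam j)) => iL.
  have -> : entry (tnth sg j) r (c - s) + Lam j <= i = false by lia.
  apply/esym/negbTE; rewrite -leqNgt; apply: leq_trans (proj1 (andP jc)).
  rewrite /stk_chain /s /psum big_mkcond [X in _ <= X]big_mkcond; apply: leq_sum => l _.
  case: (ltnP l j) => lj; first exact: (rowle_max (ssg l)).
  have := @leq_psum _ (tnth lam) j l lj => H.
  have -> : i - Lam l = 0 by lia.
  by rewrite (rowle0 (pmu l) (ssg l)).
case: (leqP i (Lam j.+1)) => iL'.
  rewrite (@stk_chain_block j) ?iL // -/s.
  rewrite addnC -leq_subRL // -ltn_subLR ?(proj1 (andP jc)) //.
  by rewrite (lt_rowle (ssg j)) /in_diagram cj.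
move: iL'; rewrite psumS => iL'.
have -> : entry (tnth sg j) r (c - s) + Lam j <= i by lia.
apply/esym; have lt : c < s + nth 0 (tnth mu j) r by lia.
apply: leq_trans lt _; rewrite /s -psumS /psum /stk_chain big_mkcond; apply: leq_sum => l _.
case: ifP => // lj; rewrite (rowle_full (pmu l)) //.
by have := @leq_psum _ (tnth lam) l.+1 j.+1 lj; rewrite !psumS; lia.
Qed.

Lemma stk_std : is_std (muSigma mu) (stk lam mu sg).
Proof.
rewrite stkE; apply: std_tableau_of_chain.
- exact: partition_muSigma.
- exact: stk_chain0.
- exact: stk_chain_full.
- exact: stk_chain_step.
- by move=> i r _; apply: stk_chain_noninc.
Qed.

Lemma rowle_stk i r : i <= d -> rowle (stk lam mu sg) i r = stk_chain i r.
Proof.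
rewrite stkE; apply: rowle_tableau_of_chain.
- exact: stk_chain0.
- exact: stk_chain_full.
- exact: stk_chain_step.
Qed.

End Stk.

End NatStacking.

Lemma minn_split n (f g : nat -> nat) a :
    (forall r, f r.+1 <= f r)%N -> (forall r, g r.+1 <= g r)%N ->
  exists b c, (b + c = a)%N /\
    forall r, (r < n)%N -> (minn (f r + g r) a = minn (f r) b + minn (g r) c)%N.
Proof.
move=> fd gd; have fm := nonincreasing_le fd; have gm := nonincreasing_le gd.
have P := @sum_prefix n (fun r => a <= f r + g r)%N
  (fun r h => leq_trans h (leq_add (fd r) (gd r))).
set m := (\sum_(i < n) _)%N in P.
case: (posnP m) => [m0|m0].
  case: (posnP n) => [n0|n0]; first by exists a, 0%N; split; [lia | rewrite n0].
  have := P 0%N n0; rewrite m0 ltnn => /esym/negbT; rewrite -ltnNge => lt0.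
  exists (f 0%N), (a - f 0%N)%N; split; first lia.
  by move=> r _; have := fm 0%N r (leq0n r); have := gm 0%N r (leq0n r); lia.
have mn : (m <= n)%N.
  by rewrite -[X in (_ <= X)%N]card_ord -sum1_card; apply: leq_sum => i _; apply: leq_b1.
have h1 : (a <= f m.-1 + g m.-1)%N by rewrite -P; lia.
case: (ltnP m n) => mn'.
  have h2 : (f m + g m < a)%N by rewrite ltnNge -P // ltnn.
  exists (maxn (f m) (a - g m.-1)), (a - maxn (f m) (a - g m.-1))%N.
  have := fd m.-1; have := gd m.-1; rewrite prednK // => gd1 fd1.
  split; first lia.
  move=> r rn; case: (ltnP r m) => rm.
    by have := fm r m.-1 ltac:(lia); have := gm r m.-1 ltac:(lia); lia.
  by have := fm m r rm; have := gm m r rm; lia.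
exists (a - g m.-1)%N, (a - (a - g m.-1))%N; split; first lia.
by move=> r rn; have := fm r m.-1 ltac:(lia); have := gm r m.-1 ltac:(lia); lia.
Qed.

Lemma minn_split_left n (f g : nat -> nat) b :
    (forall r, f r.+1 <= f r)%N -> (forall r, g r.+1 <= g r)%N ->
  exists c, forall r, (r < n)%N ->
    (minn (f r + g r) (b + c) = minn (f r) b + minn (g r) c)%N.
Proof.
move=> fd gd; have fm := nonincreasing_le fd; have gm := nonincreasing_le gd.
have P := @sum_prefix n (fun r => b <= f r)%N (fun r h => leq_trans h (fd r)).
set m := (\sum_(i < n) _)%N in P.
exists (g m.-1) => r rn; have := P r rn; case: (ltnP r m) => rm /esym.
  by move=> h; have := gm r m.-1 ltac:(lia); lia.
move/negbT; rewrite -ltnNge => h; have := gm m.-1 r ltac:(lia); lia.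
Qed.

Section Extension.
Variables (k : closedFieldType) (N : nat).
Notation gl := 'M[k]_N.
Notation kN := 'cV[k]_N.
Implicit Types (e : gl) (u v : kN) (H U A B X : {vspace kN}) (f g al be : nat -> nat).

Lemma stab0 e : stab e 0%VS.
Proof. by move=> u; rewrite memv0 => /eqP ->; rewrite mulmx0 mem0v. Qed.

Lemma ext_dim e A B b c : stab e B -> (A <= B)%VS ->
  (\dim (qker e 0 b A) + \dim (qker e A c B) <= \dim (qker e 0 (b + c) B) + \dim A)%N.
Proof.
move=> sB AB; have := dim_qker e (b + c) (qker e A c B); have := dim_qker e b A.
have h1 : (mv (e ^+ (b + c)) (qker e A c B) <= mv (e ^+ b) A)%VS.
  apply: mv_sub => u; rewrite mem_qker => /andP[_ uA].
  by rewrite exprD_mulmx mem_mv.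
have h2 : (qker e 0 (b + c) (qker e A c B) <= qker e 0 (b + c) B)%VS.
  by apply/subvP => u; rewrite !mem_qker => /andP[/andP[-> _]].
have := dimvS h1; have := dimvS h2; lia.
Qed.

Lemma ext_eq e A B b c : stab e B -> (A <= B)%VS ->
    (\dim (qker e 0 b A) + \dim (qker e A c B) = \dim (qker e 0 (b + c) B) + \dim A)%N ->
  (qker e 0 (b + c) B <= qker e A c B)%VS /\ (mv (e ^+ b) A <= mv (e ^+ (b + c)) B)%VS.
Proof.
move=> sB AB E; have := dim_qker e (b + c) (qker e A c B); have := dim_qker e b A.
have h1 : (mv (e ^+ (b + c)) (qker e A c B) <= mv (e ^+ b) A)%VS.
  apply: mv_sub => u; rewrite mem_qker => /andP[_ uA].
  by rewrite exprD_mulmx mem_mv.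
have h2 : (qker e 0 (b + c) (qker e A c B) <= qker e 0 (b + c) B)%VS.
  by apply/subvP => u; rewrite !mem_qker => /andP[/andP[-> _]].
have d1 := dimvS h1; have d2 := dimvS h2 => E1 E2; split.
  have /eqP <- : qker e 0 (b + c) (qker e A c B) == qker e 0 (b + c) B.
    by rewrite eqEdim h2; lia.
  exact: qker_sub.
have /eqP <- : mv (e ^+ (b + c)) (qker e A c B) == mv (e ^+ b) A.
  by rewrite eqEdim h1; lia.
exact/mvS/qker_sub.
Qed.

Lemma hyper_dec H U v u : (H <= U)%VS -> \dim U = (\dim H).+1 -> v \in U -> v \notin H ->
  u \in U -> exists c : k, u - c *: v \in H.
Proof.
move=> HU dU vU vH uU; have E : (H + <[v]>)%VS = U.
  apply/eqP; rewrite eqEdim subv_add HU -memvE vU /= dU.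
  rewrite ltnNge; apply/negP => le; move/negP: vH; apply.
  have /eqP -> : H == (H + <[v]>)%VS by rewrite eqEdim addvSl.
  exact: (subvP (addvSr H <[v]>%VS) _ (memv_line v)).
move: uU; rewrite -E => /memv_addP[h hH [_ /vlineP[c ->] ->]].
by exists c; rewrite addrK.
Qed.

Lemma cap_hyper H U X : (H <= U)%VS -> \dim U = (\dim H).+1 -> (X <= U)%VS ->
  ~~ (X <= H)%VS -> \dim X = (\dim (X :&: H)).+1.
Proof.
move=> HU dU XU XH; have E : (X + H)%VS = U.
  apply/eqP; rewrite eqEdim subv_add XU HU /= dU ltnNge; apply/negP => le.
  move/negP: XH; apply; have /eqP -> : H == (X + H)%VS by rewrite eqEdim addvSr.
  exact: addvSl.
by have := dimv_sum_cap X H; rewrite E dU; lia.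
Qed.

Lemma nilp_hyper e H U : e ^+ N = 0 -> stab e H -> stab e U -> (H <= U)%VS ->
  \dim U = (\dim H).+1 -> forall u, u \in U -> e *m u \in H.
Proof.
move=> eN sH sU HU dU.
have /subvPn[v vU vH] : ~~ (U <= H)%VS by apply/negP => /dimvS; rewrite dU ltnn.
have [al evH] := hyper_dec HU dU vU vH (sU v vU).
have pw m : e ^+ m *m v - al ^+ m *: v \in H.
  elim: m => [|m IH]; first by rewrite expr0_mulmx expr0 scale1r subrr mem0v.
  have -> : e ^+ m.+1 *m v - al ^+ m.+1 *: v =
      e *m (e ^+ m *m v - al ^+ m *: v) + al ^+ m *: (e *m v - al *: v).
    by rewrite exprS_mulmx mulmxBr -scalemxAr scalerBr scalerA -exprSr addrA subrK.
  by rewrite memvD ?sH // memvZ.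
have al0 : al = 0.
  apply/eqP; rewrite -[_ == _]negbK; apply/negP => alN; move/negP: vH; apply.
  have := pw N; rewrite eN mul0mx sub0r memvN => /(memvZ (al ^+ N)^-1).
  by rewrite scalerA mulVf ?expf_neq0 // scale1r.
move=> u /(hyper_dec HU dU vU vH)[c ucH].
rewrite -[u](subrK (c *: v)) mulmxDr; apply: memvD; first exact: sH.
by rewrite -scalemxAr memvZ //; move: evH; rewrite al0 scale0r subr0.
Qed.

Lemma sum_minn_bump f g r0 c : (r0 < N)%N -> (forall r, g r = f r + (r == r0))%N ->
  (\sum_(r < N) minn (g r) c = \sum_(r < N) minn (f r) c + (g r0 <= c))%N.
Proof.
move=> r0N E; rewrite (bigD1 (Ordinal r0N)) //= [in RHS](bigD1 (Ordinal r0N)) //=.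
rewrite (eq_bigr (fun i : 'I_N => minn (f i) c)) => [|i ne].
  rewrite addnAC; congr (_ + _)%N; rewrite E eqxx; lia.
have -> : g i = f i; last by [].
rewrite E; case: (_ =P r0) => [/= ir|]; last by rewrite addn0.
by move/negP: ne; case; apply/eqP/val_inj.
Qed.

Lemma hyper_type e A H U f g r0 : stab e A -> (H <= U)%VS -> \dim U = (\dim H).+1 ->
    stab e H -> (r0 < N)%N -> (forall r, g r = f r + (r == r0))%N -> has_type e A U g ->
    (qker e A (g r0).-1 U <= H)%VS -> ~~ (qker e A (g r0) U <= H)%VS ->
  has_type e A H f.
Proof.
move=> sA HU dU sH r0N E [sU kU] lo hi; split=> // c.
rewrite (qker_capv _ _ _ HU); have := kU c; rewrite (sum_minn_bump c r0N E).
case: (leqP (g r0) c) => cj.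
  rewrite (cap_hyper HU dU (qker_sub e A c U)); first lia.
  by apply: contra hi; apply: subv_trans; apply: qker_mono.
have /capv_idPl -> : (qker e A c U <= H)%VS; last lia.
by apply: subv_trans lo; apply: qker_mono => //; lia.
Qed.

Lemma hyper_threshold e A H U f g r0 : (H <= U)%VS ->
    (r0 < N)%N -> (forall r, g r = f r + (r == r0))%N ->
    has_type e A U g -> has_type e A H f ->
  (forall c, (c < g r0)%N -> (qker e A c U <= H)%VS) /\
  (forall c, (g r0 <= c)%N -> ~~ (qker e A c U <= H)%VS).
Proof.
move=> HU r0N E [_ kU] [_ kH].
have dd c : (\dim (qker e A c U) = \dim (qker e A c U :&: H) + (g r0 <= c))%N.
  by rewrite -qker_capv // kU kH (sum_minn_bump c r0N E); lia.
split=> c cj; last first.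
  by apply/negP => /capv_idPl E1; have := dd c; rewrite E1 cj; lia.
apply/capv_idPl/eqP; rewrite eqEdim capvSl /= dd; lia.
Qed.

Lemma dim_mv_qker e a U : stab e U ->
  (\dim (mv (e ^+ a) (qker e 0 a.+1 U)) + \dim (qker e 0 a U) = \dim (qker e 0 a.+1 U))%N.
Proof.
move=> sU; rewrite -(dim_qker e a (qker e 0 a.+1 U)) addnC; congr (\dim _ + _)%N.
apply/vspaceP => u; rewrite !mem_qker !memv0 exprS_mulmx.
by case: (e ^+ a *m u =P 0) => [->|]; rewrite ?andbF // mulmx0 eqxx !andbT.
Qed.

Lemma hyper_exists e U f g r0 : e ^+ N = 0 -> (forall r, f r.+1 <= f r)%N ->
    (r0 < N)%N -> (forall r, g r = f r + (r == r0))%N -> has_type e 0 U g ->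
  exists H, [/\ (H <= U)%VS, \dim U = (\dim H).+1 & has_type e 0 H f].
Proof.
move=> eN fd r0N E tU; have [sU kU] := tU.
set j := g r0; have j0 : (0 < j)%N by rewrite /j E eqxx addn1.
pose M := (mv e U + qker e 0 j.-1 U)%VS.
have /subvPn[v vq vM] : ~~ (qker e 0 j U <= M)%VS.
  apply/negP => /subvP qM.
  have : (mv (e ^+ j.-1) (qker e 0 j U) <= mv (e ^+ j) (qker e 0 j.+1 U))%VS.
    apply: mv_sub => u uq; have /memv_addP[_ /mvP[w wU ->] [y yq uE]] := qM u uq.
    have ey : e ^+ j.-1 *m y = 0 by move: yq; rewrite mem_qker memv0 => /andP[_ /eqP].
    have -> : e ^+ j.-1 *m u = e ^+ j *m w.
      by rewrite uE mulmxDr ey addr0 -{2}(prednK j0) exprSr_mulmx.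
    apply: mem_mv; rewrite mem_qker wU memv0 exprSr_mulmx /=.
    move: uq; rewrite mem_qker memv0 uE mulmxDr => /andP[_].
    by rewrite -{2}(prednK j0) exprS_mulmx ey mulmx0 addr0.
  move/dimvS; have := dim_mv_qker j sU; have := dim_mv_qker j.-1 sU; rewrite prednK //.
  have := sum_minn_bump j.-1 r0N E; have := sum_minn_bump j r0N E.
  have := sum_minn_bump j.+1 r0N E; rewrite -/j !kU dimv0 !add0n => E1 E2 E3.
  move=> D1 D2; have := sum_minnSr N g j.-1; have := sum_minnSr N g j; rewrite prednK //.
  move=> D3 D4 le.
  have lt : (\sum_(r < N) (j < g r) < \sum_(r < N) (j <= g r))%N.
    rewrite (bigD1 (Ordinal r0N)) //= [X in (_ < X)%N](bigD1 (Ordinal r0N)) //= -/j ltnn.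
    rewrite leqnn add0n add1n ltnS; apply: leq_sum => i _.
    by case: (ltnP j (g i)) => [/ltnW ->|_].
  lia.
have [xi [xiM xiv]] := sep_form vM.
pose H := (U :&: lker (linfun (mulmx xi : kN -> 'cV[k]_1)))%VS.
have memH u : (u \in H) = (u \in U) && ((xi *m u) 0 0 == 0).
  rewrite memv_cap memv_ker lfunE /=; congr (_ && _); apply/eqP/eqP => [->|h].
    by rewrite mxE.
  by apply/matrixP => i i'; rewrite !ord1 h mxE.
have vU : v \in U by apply: (subvP (qker_sub e 0 j U)).
have HU : (H <= U)%VS by exact: capvSl.
have dU : \dim U = (\dim H).+1.
  have <- : (H + <[v]>)%VS = U.
    apply/eqP; rewrite eqEsubv subv_add HU -memvE vU /=; apply/subvP => u uU.
    rewrite -[u](subrK ((xi *m u) 0 0 *: v)) memv_add ?memvZ ?memv_line //.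
    rewrite memH memvB ?memvZ //= mulmxBr -scalemxAr !mxE.
    by have := xiv; rewrite !mxE => ->; rewrite mulr1 subrr.
  rewrite dimv_disjoint_sum ?dim_vline.
    have -> : v != 0 by apply: contraNneq vM => ->; apply: mem0v.
    by rewrite addn1.
  apply/eqP; rewrite -subv0; apply/subvP => u; rewrite memv_cap memH memv0.
  case/andP => /andP[_ /eqP xu] /vlineP[c uE]; move: xu.
  by rewrite uE -scalemxAr mxE xiv mulr1 => ->; rewrite scale0r.
have sH : stab e H.
  move=> u; rewrite !memH => /andP[uU _]; rewrite sU //= xiM //.
  by rewrite -[e *m u]addr0 memv_add ?mem0v // mem_mv.
exists H; split=> //; apply: (hyper_type (stab0 e) HU dU sH r0N E tU); rewrite -/j.
  apply/subvP => u uq; rewrite memH xiM ?eqxx ?andbT.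
    exact: (subvP (qker_sub e 0 j.-1 U)).
  by rewrite -[u]add0r memv_add ?mem0v.
by apply/subvPn; exists v => //; rewrite memH xiv oner_eq0 andbF.
Qed.

(* A hyperplane cutting the generic extension of type [al + be] down to the
   generic type [al + be'] contains A, and it cuts B / A down to type [be']. *)
Lemma generic_hyper e A B H al be be' r0 : e ^+ N = 0 ->
    (forall r, al r.+1 <= al r)%N -> (forall r, be r.+1 <= be r)%N ->
    (forall r, be' r.+1 <= be' r)%N ->
    (r0 < N)%N -> (forall r, be r = be' r + (r == r0))%N ->
    (A <= B)%VS -> has_type e 0 A al -> has_type e A B be ->
    has_type e 0 B (fun r => al r + be r)%N ->
    (H <= B)%VS -> \dim B = (\dim H).+1 -> has_type e 0 H (fun r => al r + be' r)%N ->
  (A <= H)%VS /\ has_type e A H be'.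
Proof.
move=> eN ald bed be'd r0N E AB tA tAB tB HB dB tH.
have [sA kA] := tA; have [sB kAB] := tAB; have [_ kB] := tB; have [sH kH] := tH.
have am := nonincreasing_le ald; have bm := nonincreasing_le bed.
have E' r : (al r + be r = al r + be' r + (r == r0))%N by rewrite E addnA.
have [lo hi] := hyper_threshold HB r0N E' tB tH.
have b0 : (0 < be r0)%N by rewrite E eqxx addn1.
have bS : (be r0.+1 < be r0)%N.
  by rewrite (E r0.+1) (E r0) eqxx (gtn_eqF (ltnSn r0)) addn0 addn1 ltnS be'd.
have eq1 : (\dim (qker e 0 (al r0) A) + \dim (qker e A (be r0) B) =
    \dim (qker e 0 (al r0 + be r0) B) + \dim A)%N.
  rewrite kA kAB kB dimv0 !add0n addnCA addnC; congr (_ + _)%N.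
  rewrite -big_split; apply: eq_bigr => i _ /=.
  case: (leqP i r0) => ir; first by have := am _ _ ir; have := bm _ _ ir; lia.
  by have := am _ _ (ltnW ir); have := bm _ _ ir; lia.
have [E1 E2] := ext_eq sB AB eq1.
have eBH := nilp_hyper eN sH sB HB dB.
have AH : (A <= H)%VS.
  apply/subvP => w wA; have /mvP[x xB xE] := subvP E2 _ (mem_mv (e ^+ al r0) wA).
  rewrite -[w](subrK (e ^+ be r0 *m x)) memvD //; last first.
    by rewrite -(prednK b0) exprS_mulmx eBH // stab_exp.
  apply: (subvP (lo (al r0) _)); first lia.
  rewrite mem_qker memv0 mulmxBr xE exprD_mulmx subrr eqxx andbT.
  by apply: memvB; [exact: (subvP AB) | exact: stab_exp].
split=> //; apply: (hyper_type sA HB dB sH r0N E tAB).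
  apply/subvP => x; rewrite mem_qker => /andP[xB xA].
  have /mvP[y yB yE] := subvP E2 _ (mem_mv (e ^+ al r0) xA).
  rewrite -[x](subrK (e *m y)) memvD ?eBH //.
  apply: (subvP (lo (al r0 + be r0).-1 _)); first lia.
  rewrite mem_qker memv0 mulmxBr -exprSr_mulmx prednK; last lia.
  have -> : ((al r0 + be r0).-1 = al r0 + (be r0).-1)%N by lia.
  by rewrite (exprD_mulmx _ _ (be r0).-1) yE subrr eqxx andbT memvB // sB.
by apply: contra (hi _ (leqnn _)); apply: subv_trans.
Qed.

(* In the dominance order, the Jordan type of an extension is at most the sum of the two types. *)
Lemma ext_type_ge e A B al be a :
    (forall r, al r.+1 <= al r)%N -> (forall r, be r.+1 <= be r)%N -> (A <= B)%VS ->
    (forall b, \sum_(r < N) minn (al r) b <= \dim (qker e 0 b A))%N -> has_type e A B be ->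
  (\sum_(r < N) minn (al r + be r) a <= \dim (qker e 0 a B))%N.
Proof.
move=> ald bed AB kA [sB kAB]; have [b [c [bc E]]] := @minn_split N al be a ald bed.
have := ext_dim b c sB AB; rewrite kAB bc; have := kA b.
have -> : (\sum_(r < N) minn (al r + be r) a =
    \sum_(r < N) minn (al r) b + \sum_(r < N) minn (be r) c)%N.
  by rewrite -big_split; apply: eq_bigr => i _; rewrite E.
lia.
Qed.

Lemma ext_type_sub e A B al be :
    (forall r, al r.+1 <= al r)%N -> (forall r, be r.+1 <= be r)%N -> (A <= B)%VS ->
    stab e A -> (forall b, \sum_(r < N) minn (al r) b <= \dim (qker e 0 b A))%N ->
    has_type e A B be -> has_type e 0 B (fun r => al r + be r)%N ->
  has_type e 0 A al.
Proof.
move=> ald bed AB sA kA [sB kAB] [_ kB]; split=> // b; rewrite dimv0 add0n.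
apply/eqP; rewrite eqn_leq kA andbT.
have [c E] := @minn_split_left N al be b ald bed.
have := ext_dim b c sB AB; rewrite kAB kB dimv0 add0n.
have -> : (\sum_(r < N) minn (al r + be r) (b + c) =
    \sum_(r < N) minn (al r) b + \sum_(r < N) minn (be r) c)%N.
  by rewrite -big_split; apply: eq_bigr => i _; rewrite E.
lia.
Qed.

End Extension.

(** * Full flags and Borel subalgebras *)

Section Flags.
Variables (k : closedFieldType) (N : nat).
Notation gl := 'M[k]_N.
Notation kN := 'cV[k]_N.
Implicit Types (g h x : gl) (u v w : kN) (U A : {vspace kN}) (F : nat -> {vspace kN}).

Lemma unitmx_GL (g h : gl) : g \in unitmx -> h \in unitmx -> g *m h \in unitmx.
Proof. by move=> gu hu; rewrite unitmx_mul gu. Qed.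

Lemma flag_stabP d F x :
  reflect (forall i, (i <= d)%N -> forall u, u \in F i -> x *m u \in F i) (x \in flag_stab d F).
Proof.
apply: (iffP (memv_bigcapP _ _)) => [H i id u uF|H i].
  have id' : (i < d.+1)%N by rewrite ltnS.
  by have /transporterP := H (Ordinal id'); apply.
by apply/transporterP => u; apply: H; rewrite -ltnS.
Qed.

Lemma borelP F x :
  reflect (forall i, (i <= N)%N -> forall u, u \in F i -> x *m u \in F i) (x \in borel F).
Proof. exact: flag_stabP. Qed.

Definition act g F : nat -> {vspace kN} := fun i => mv g (F i).

Lemma eq_borel F F' : (forall i, (i <= N)%N -> F i = F' i) -> borel F = borel F'.
Proof.
move=> E; apply/vspaceP => x; apply/borelP/borelP => H i iN u uF.
  by rewrite -E // H // E.
by rewrite E // H // -E.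
Qed.

Section FullFlag.
Variable F : nat -> {vspace kN}.
Hypothesis fF : full_flag fullv F.

Lemma flag_dim i : (i <= N)%N -> \dim (F i) = i.
Proof. by case: fF => + _ _; rewrite dimN; apply. Qed.

Lemma flagS i : (i < N)%N -> (F i <= F i.+1)%VS.
Proof. by case: fF => _ + _; rewrite dimN; apply. Qed.

Lemma flag_mono i j : (i <= j <= N)%N -> (F i <= F j)%VS.
Proof.
case/andP => /subnK <-; elim: (j - i)%N => [|m IH] lt; first exact: subvv.
by apply: subv_trans (IH _) (flagS _); lia.
Qed.

Lemma flag_top : F N = fullv.
Proof. by case: fF => _ _; rewrite dimN. Qed.

Lemma flag0 : F 0%N = 0%VS.
Proof. by apply/eqP; rewrite -dimv_eq0 flag_dim. Qed.

End FullFlag.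

Lemma full_flag_act g F : g \in unitmx -> full_flag fullv F -> full_flag fullv (act g F).
Proof.
move=> gu fF; split=> [i|i|]; rewrite dimN.
- by move=> iN; rewrite dim_mv // (flag_dim fF).
- by move=> iN; apply/mvS/(flagS fF).
- rewrite /act (flag_top fF); apply/eqP; rewrite eqEdim subvf /= dim_mv //.
Qed.

Lemma actM g h F : act (g *m h) F = act g (act h F).
Proof. by apply: funext => i; apply: mvM. Qed.

Lemma act1 F : act 1%:M F = F.
Proof. by apply: funext => i; apply: mv1. Qed.

Lemma memv_AdV g (b : {vspace gl}) x : g \in unitmx ->
  (x \in AdV g b) = (invmx g *m x *m g \in b).
Proof.
move=> gu.
pose phi := GRing.Linear.clone k gl gl _ (mulmx g \o mulmxr (invmx g)) _.
have E : linfun (Ad g) = linfun phi.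
  by rewrite unlock /linfun_def; congr (Hom (lin1_mx _)); apply: funext => y /=; rewrite /Ad mulmxA.
apply/memv_imgP/idP => [[y yb ->]|xb].
  by rewrite E lfunE /= -!mulmxA mulVmx // mulmx1 mulKmx.
exists (invmx g *m x *m g) => //.
by rewrite E lfunE /= -!mulmxA mulmxV // mulmx1 mulKVmx.
Qed.

Lemma AdV_borel g F : g \in unitmx -> AdV g (borel F) = borel (act g F).
Proof.
move=> gu; apply/vspaceP => x; rewrite memv_AdV //.
apply/borelP/borelP => H i iN u.
  move=> /mvP[w wF ->]; rewrite mem_mvE //.
  by have := H i iN w wF; rewrite -!mulmxA.
move=> uF; have := H i iN (g *m u) (mem_mv g uF).
by rewrite mem_mvE // !mulmxA.
Qed.

Lemma stable_borel F U : full_flag fullv F ->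
  (forall x, x \in borel F -> stab x U) -> U = F (\dim U).
Proof.
move=> fF H.
have exN : exists m, (U <= F m)%VS by exists N; rewrite (flag_top fF) subvf.
case: (ex_minnP exN) => m Um mmin.
have mN : (m <= N)%N by apply: mmin; rewrite (flag_top fF) subvf.
suff UE : U = F m by rewrite UE (flag_dim fF).
case: m Um mmin mN => [|m] Um mmin mN.
  by move: Um; rewrite (flag0 fF) subv0 => /eqP.
have /subvPn[u uU uF] : ~~ (U <= F m)%VS by apply/negP => /mmin; rewrite ltnn.
have [xi [xiF xiu]] := sep_form uF.
apply/eqP; rewrite eqEsubv Um /=; apply/subvP => w wF.
have -> : w = (w *m xi) *m u by rewrite form_scale xiu scale1r.
apply: H uU; apply/borelP => i iN u' u'F; rewrite form_scale.
case: (leqP i m) => im.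
  by rewrite xiF ?scale0r ?mem0v // (subvP (flag_mono fF _) _ u'F) // im ltnW.
by rewrite memvZ // (subvP (flag_mono fF _) _ wF) // im.
Qed.

Lemma borel_inj F F' : full_flag fullv F -> full_flag fullv F' ->
  borel F = borel F' -> forall i, (i <= N)%N -> F i = F' i.
Proof.
move=> fF fF' E i iN; rewrite (@stable_borel F' (F i)) // ?(flag_dim fF) // => x.
by rewrite -E => /borelP/(_ i iN).
Qed.

Lemma flag_list F : full_flag fullv F ->
  exists L : seq kN, forall i, (i <= N)%N -> basis_of (F i) (take i L).
Proof.
move=> fF; have [||L bL] := @adapted_basis k _ (fun a => F (N - a)%N) N.
- by move=> a; apply: (flag_mono fF); lia.
- by rewrite subnn (flag0 fF).
exists L => i iN; have := bL (N - i)%N; rewrite subKn //.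
by rewrite (flag_dim fF).
Qed.

Definition colmx (L : seq kN) : gl := \matrix_(a, b) (L`_b) a 0.

Lemma colmx_delta L (b : 'I_N) : colmx L *m delta_mx b 0 = L`_b.
Proof. by rewrite -colE; apply/colP => a; rewrite !mxE. Qed.

Lemma colmx_unit (L : seq kN) : free L -> size L = N -> colmx L \in unitmx.
Proof.
move=> fL sL; apply: unitmxP => u Lu.
have /freeP fP : free (in_tuple L) by [].
have E : \sum_(i < size L) (u (cast_ord sL i) 0) *: L`_i = 0.
  rewrite -{}[RHS]Lu; apply/colP => a; rewrite summxE mxE.
  rewrite (reindex (cast_ord sL)) /=; last first.
    exists (cast_ord (esym sL)) => i _; by apply: val_inj.
  by apply: eq_bigr => i _; rewrite !mxE mulrC.
apply/colP => i; have := fP (fun j => u (cast_ord sL j) 0) E (cast_ord (esym sL) i).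
by rewrite cast_ordKV mxE.
Qed.

Lemma flag_conj F F' : full_flag fullv F -> full_flag fullv F' ->
  exists2 g, g \in unitmx & forall i, (i <= N)%N -> F' i = act g F i.
Proof.
move=> fF fF'; have [L bL] := flag_list fF; have [L' bL'] := flag_list fF'.
have sz (X : seq kN) (G : nat -> {vspace kN}) : full_flag fullv G -> (forall i, (i <= N)%N -> basis_of (G i) (take i X)) ->
    (N <= size X)%N.
  move=> fG /(_ N (leqnn N)) b; have := flag_dim fG (leqnn N).
  rewrite -(span_basis b); have /eqP -> := basis_free b.
  by rewrite size_take; case: ifP => [/ltnW //|_ E]; apply: eq_leq.
have sL := sz L F fF bL; have sL' := sz L' F' fF' bL'.
have cu (X : seq kN) (G : nat -> {vspace kN}) : (N <= size X)%N -> basis_of (G N) (take N X) -> colmx X \in unitmx.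
  move=> sX /basis_free fX; have -> : colmx X = colmx (take N X).
    by apply/matrixP => a b; rewrite !mxE nth_take.
  by apply: colmx_unit; rewrite ?size_takel.
have uL := cu L F sL (bL N (leqnn N)); have uL' := cu L' F' sL' (bL' N (leqnn N)).
exists (colmx L' *m invmx (colmx L)); first by rewrite unitmx_GL // unitmx_inv.
move=> i iN; rewrite /act -(span_basis (bL i iN)) /mv limg_span -(span_basis (bL' i iN)).
congr (<< _ >>)%VS; apply: (@eq_from_nth _ 0).
  by rewrite size_map !size_takel // (leq_trans iN).
move=> j; rewrite size_takel ?(leq_trans iN) // => ji.
rewrite (nth_map 0) ?size_takel ?(leq_trans iN) // !nth_take // lfunE /=.
have jN : (j < N)%N by apply: leq_trans iN.
by rewrite -[L`_j](colmx_delta L (Ordinal jN)) -mulmxA mulKmx // colmx_delta.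
Qed.

End Flags.

(** * Zariski closure in the flag variety *)

Section FunRing.
Variables (k : closedFieldType) (X : Type).

Record funring (P : (X -> k) -> Prop) : Prop := Funring {
  fr_const : forall c, P (fun=> c);
  fr_add : forall f g, P f -> P g -> P (fun x => f x + g x);
  fr_mul : forall f g, P f -> P g -> P (fun x => f x * g x) }.

Variable P : (X -> k) -> Prop.
Hypothesis rP : funring P.

Lemma fr_sum I (r : seq I) (Q : pred I) (F : I -> X -> k) :
  (forall i, P (F i)) -> P (fun x => \sum_(i <- r | Q i) F i x).
Proof.
move=> PF; elim: r => [|i r IH].
  by under eq_fun do rewrite big_nil; apply: fr_const.
under eq_fun do rewrite big_cons.
by case: (Q i) => //; apply: (fr_add rP).
Qed.

Lemma fr_prod I (r : seq I) (Q : pred I) (F : I -> X -> k) :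
  (forall i, P (F i)) -> P (fun x => \prod_(i <- r | Q i) F i x).
Proof.
move=> PF; elim: r => [|i r IH].
  by under eq_fun do rewrite big_nil; apply: fr_const.
under eq_fun do rewrite big_cons.
by case: (Q i) => //; apply: (fr_mul rP).
Qed.

Lemma fr_exp f n : P f -> P (fun x => f x ^+ n).
Proof.
move=> Pf; elim: n => [|n IH].
  by under eq_fun do rewrite expr0; apply: fr_const.
by under eq_fun do rewrite exprS; apply: (fr_mul rP).
Qed.

Lemma fr_eq f g : f =1 g -> P f -> P g.
Proof. by move/funext => ->. Qed.

Definition fr_mx m n (M : X -> 'M[k]_(m, n)) := forall i j, P (fun x => M x i j).

Lemma fr_mx_const m n (M : 'M[k]_(m, n)) : fr_mx (fun=> M).
Proof. by move=> i j; apply: fr_const. Qed.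

Lemma fr_mx_add m n (M M' : X -> 'M[k]_(m, n)) :
  fr_mx M -> fr_mx M' -> fr_mx (fun x => M x + M' x).
Proof.
by move=> PM PM' i j; apply: (fr_eq (fun x => esym (mxE _ _ i j))); apply: (fr_add rP).
Qed.

Lemma fr_mx_scale m n (a : X -> k) (M : X -> 'M[k]_(m, n)) :
  P a -> fr_mx M -> fr_mx (fun x => a x *: M x).
Proof.
by move=> Pa PM i j; apply: (fr_eq (fun x => esym (mxE _ _ i j))); apply: (fr_mul rP).
Qed.

Lemma fr_mx_mul m n p (M : X -> 'M[k]_(m, n)) (M' : X -> 'M[k]_(n, p)) :
  fr_mx M -> fr_mx M' -> fr_mx (fun x => M x *m M' x).
Proof.
move=> PM PM' i j; apply: (fr_eq (fun x => esym (mxE _ _ i j))).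
by apply: fr_sum => l; apply: (fr_mul rP).
Qed.

Lemma fr_mx_exp m (M : X -> 'M[k]_m) a : fr_mx M -> fr_mx (fun x => M x ^+ a).
Proof.
move=> PM; elim: a => [|a IH] i j.
  by under eq_fun do rewrite expr0; apply: fr_const.
by under eq_fun do rewrite exprS; apply: fr_mx_mul.
Qed.

Lemma fr_mx_sum I (r : seq I) (Q : pred I) m n (M : I -> X -> 'M[k]_(m, n)) :
  (forall i, fr_mx (M i)) -> fr_mx (fun x => \sum_(i <- r | Q i) M i x).
Proof.
move=> PM i j; under eq_fun do rewrite summxE.
by apply: fr_sum => l; apply: PM.
Qed.

Lemma fr_det m (M : X -> 'M[k]_m) : fr_mx M -> P (fun x => \det (M x)).
Proof.
move=> PM; rewrite /determinant; apply: fr_sum => s; apply: (fr_mul rP); first exact: fr_const.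
by apply: fr_prod => i; apply: PM.
Qed.

Lemma fr_adj m (M : X -> 'M[k]_m) : fr_mx M -> fr_mx (fun x => \adj (M x)).
Proof.
move=> PM i j; under eq_fun do rewrite mxE /cofactor.
apply: (fr_mul rP); first exact: fr_const.
by apply: fr_det => a b; under eq_fun do rewrite !mxE; apply: PM.
Qed.

Lemma fr_meval n (p : {mpoly k[n]}) (v : X -> 'I_n -> k) :
  (forall i, P (fun x => v x i)) -> P (fun x => p.@[v x]).
Proof.
move=> Pv; under eq_fun do rewrite mevalE.
apply: fr_sum => m; apply: (fr_mul rP); first exact: fr_const.
by apply: fr_prod => i; apply: fr_exp.
Qed.

End FunRing.

Section PolyClasses.
Variable k : closedFieldType.

Definition polyt (f : k -> k) := exists q : {poly k}, forall t, f t = q.[t].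

Lemma funring_polyt : funring polyt.
Proof.
split=> [c|f g [p pE] [q qE]|f g [p pE] [q qE]].
- by exists c%:P => t; rewrite hornerC.
- by exists (p + q) => t; rewrite hornerD pE qE.
- by exists (p * q) => t; rewrite hornerM pE qE.
Qed.

Lemma polyt_id : polyt (fun t => t).
Proof. by exists 'X => t; rewrite hornerX. Qed.

Lemma poly_zero (q : {poly k}) : (forall t, q.[t] = 0) -> q = 0.
Proof.
move=> H; apply/eqP; rewrite -[_ == _]negbK; apply/negP => /closed_nonrootP[x].
by rewrite /root H eqxx.
Qed.

Lemma polyt_domain f g : polyt f -> polyt g -> (forall t, f t * g t = 0) ->
  (forall t, f t = 0) \/ (forall t, g t = 0).
Proof.
move=> [p pE] [q qE] H; have /eqP : p * q = 0.
  by apply: poly_zero => t; rewrite hornerM -pE -qE.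
by rewrite mulf_eq0 => /orP[]/eqP E; [left|right] => t; rewrite ?pE ?qE E horner0.
Qed.

Lemma polyt_generic f g t0 : polyt f -> polyt g -> f t0 != 0 ->
  (forall t, f t != 0 -> g t = 0) -> forall t, g t = 0.
Proof.
move=> pf pg f0 H; have [] := polyt_domain pf pg => // [t|/(_ t0)/eqP E].
  by have [->|/H ->] := eqVneq (f t) 0; rewrite ?mul0r ?mulr0.
by rewrite E in f0.
Qed.

Definition polyv M (f : ('I_M -> k) -> k) := exists p : {mpoly k[M]}, forall v, f v = p.@[v].

Lemma funring_polyv M : funring (@polyv M).
Proof.
split=> [c|f g [p pE] [q qE]|f g [p pE] [q qE]].
- by exists c%:MP => t; rewrite mevalC.
- by exists (p + q) => t; rewrite mevalD pE qE.
- by exists (p * q) => t; rewrite mevalM pE qE.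
Qed.

Lemma polyv_coord M (i : 'I_M) : polyv (fun v => v i).
Proof. by exists 'X_i => v; rewrite mevalXU. Qed.

Lemma polyv_comp X (P : (X -> k) -> Prop) M (f : ('I_M -> k) -> k) (v : X -> 'I_M -> k) :
  funring P -> polyv f -> (forall i, P (fun x => v x i)) -> P (fun x => f (v x)).
Proof.
move=> rP [p pE] Pv; under eq_fun do rewrite pE.
exact: fr_meval.
Qed.

Lemma polyt_line (a b : k) : polyt (fun t => a + t * (b - a)).
Proof.
apply: (fr_add funring_polyt); first exact: (fr_const funring_polyt).
apply: (fr_mul funring_polyt); first exact: polyt_id.
exact: (fr_const funring_polyt).
Qed.

Lemma polyv_domain M (f g : ('I_M -> k) -> k) : polyv f -> polyv g ->
  (forall v, f v * g v = 0) -> (forall v, f v = 0) \/ (forall v, g v = 0).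
Proof.
move=> pf pg H; apply: contrapT => /not_orP[/existsNP[v fv] /existsNP[w gw]].
pose c t (i : 'I_M) := v i + t * (w i - v i).
have c0 : c 0 = v by apply: funext => i; rewrite /c mul0r addr0.
have c1 : c 1 = w by apply: funext => i; rewrite /c mul1r addrC subrK.
have pc h : polyv h -> polyt (fun t => h (c t)).
  move=> ph; apply: (polyv_comp funring_polyt ph) => i; exact: polyt_line.
have [|/(_ 0)|/(_ 1)] := polyt_domain (pc f pf) (pc g pg); first by move=> t; apply: H.
  by rewrite c0.
by rewrite c1.
Qed.

Variable N : nat.
Notation gl := 'M[k]_N.

Definition polymx (f : gl -> k) :=
  exists p : {mpoly k[N * N]}, forall x, f x = p.@[fun i => mxvec x 0 i].

Lemma funring_polymx : funring polymx.
Proof.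
split=> [c|f g [p pE] [q qE]|f g [p pE] [q qE]].
- by exists c%:MP => t; rewrite mevalC.
- by exists (p + q) => t; rewrite mevalD pE qE.
- by exists (p * q) => t; rewrite mevalM pE qE.
Qed.

Lemma polymx_coord : fr_mx polymx (fun x : gl => x).
Proof. by move=> i j; exists 'X_(mxvec_index i j) => x; rewrite mevalXU mxvecE. Qed.

Lemma polymx_comp X (P : (X -> k) -> Prop) (f : gl -> k) (phi : X -> gl) :
  funring P -> polymx f -> fr_mx P phi -> P (fun x => f (phi x)).
Proof.
move=> rP [p pE] Pv; under eq_fun do rewrite pE.
apply: fr_meval => // i; case: (mxvec_indexP i) => a b.
by under eq_fun do rewrite mxvecE; apply: Pv.
Qed.

Lemma polymx_mull (g : gl) f : polymx f -> polymx (fun x => f (g *m x)).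
Proof.
move=> pf; apply: (polymx_comp funring_polymx pf); apply: (fr_mx_mul funring_polymx).
  exact: (fr_mx_const funring_polymx).
exact: polymx_coord.
Qed.

Lemma polymx_mulr (g : gl) f : polymx f -> polymx (fun x => f (x *m g)).
Proof.
move=> pf; apply: (polymx_comp funring_polymx pf); apply: (fr_mx_mul funring_polymx).
  exact: polymx_coord.
exact: (fr_mx_const funring_polymx).
Qed.

Lemma polymx_det : polymx (fun x => \det x).
Proof. by apply: (fr_det funring_polymx); exact: polymx_coord. Qed.

Lemma polymx_form (f : {linear gl -> k^o}) : polymx f.
Proof.
have rP := funring_polymx.
apply: (fr_eq (f := fun x : gl => \sum_i \sum_j x i j * f (delta_mx i j))) => [x|].
  rewrite [in RHS](matrix_sum_delta x) linear_sum; apply: eq_bigr => i _.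
  by rewrite linear_sum; apply: eq_bigr => j _; rewrite linearZ.
apply: (fr_sum rP) => i; apply: (fr_sum rP) => j; apply: (fr_mul rP); first exact: polymx_coord.
exact: (fr_const rP).
Qed.

End PolyClasses.

Section Closure.
Variables (k : closedFieldType) (N : nat).
Notation gl := 'M[k]_N.
Notation kN := 'cV[k]_N.
Notation cl := (closure_of (@zclosed_flag k N)).
Notation flags := (@flag_variety k N).
Implicit Types (g h x : gl) (S X Z : set {vspace gl}) (F : nat -> {vspace kN}).

Lemma borel_act_eq F g h : full_flag fullv F -> g \in unitmx -> h \in unitmx ->
  borel (act g F) = borel (act h F) ->
  forall x, borel (act (x *m (invmx g *m h)) F) = borel (act x F).
Proof.
move=> fF gu hu /(borel_inj (full_flag_act gu fF) (full_flag_act hu fF)) E x.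
by apply: eq_borel => i iN; have := E i iN; rewrite !actM /act => <-; rewrite mvV.
Qed.

Lemma zclosed_preim F Z : full_flag fullv F -> zclosed_flag Z ->
  exists I : set (gl -> k), (forall f, I f -> polymx f) /\
    forall h, h \in unitmx -> Z (borel (act h F)) <-> forall f, I f -> f h = 0.
Proof.
move=> fF [ZB /(_ (borel F))[]]; first by exists F.
move=> P E; exists [set f | exists2 p, P p & forall x, f x = p.@[fun i => mxvec x 0 i]].
split=> [f [p _ pE]|h hu]; first by exists p.
have : [set h0 | GL h0 /\ Z (AdV h0 (borel F))] h <-> (@GL k N `&` zero_locus P) h by rewrite E.
rewrite /= AdV_borel // => H; split=> [Zh f [p Pp ->]|Hf].
  by case: (proj1 H (conj hu Zh)) => _; apply.
apply: (proj2 (proj2 H _)); split=> // p Pp.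
by apply: (Hf (fun x => p.@[fun i => mxvec x 0 i])); exists p.
Qed.

Definition vanishing F S : set (gl -> k) :=
  [set f | polymx f /\ forall x, x \in unitmx -> S (borel (act x F)) -> f x = 0].

Lemma zclosed_hull F S : full_flag fullv F ->
  zclosed_flag [set b | exists2 h, h \in unitmx &
    b = borel (act h F) /\ forall f, vanishing F S f -> f h = 0].
Proof.
move=> fF; split=> [b [h hu [-> _]]|_ [F1 fF1 ->]].
  by exists (act h F) => //; apply: full_flag_act.
have [g gu gE] := flag_conj fF fF1.
have actE h : borel (act h F1) = borel (act (h *m g) F).
  by apply: eq_borel => i iN; rewrite actM /act gE.
exists [set p | exists2 f, vanishing F S f &
  forall x, f (x *m g) = p.@[fun i => mxvec x 0 i]].
apply/seteqP; split=> h [hu].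
  rewrite AdV_borel // actE => -[h2 h2u [E2 f2]]; split=> // p [f [pf vf] pE].
  rewrite -pE; have hgu : h *m g \in unitmx by rewrite unitmx_GL.
  have := f2 (fun x => f (x *m (invmx h2 *m (h *m g)))); rewrite mulKVmx //; apply.
  split; first exact: polymx_mulr.
  move=> x xu Sx; apply: vf; first by rewrite !unitmx_mul xu unitmx_inv h2u hu gu.
  by rewrite (borel_act_eq fF h2u hgu).
move=> zh; split=> //; rewrite AdV_borel // actE; exists (h *m g); first by rewrite unitmx_GL.
split=> // f vf; have [p pE] := polymx_mulr g vf.1.
by rewrite pE; apply: zh; exists f.
Qed.

Lemma closureP F S h : full_flag fullv F -> h \in unitmx -> S `<=` flags ->
  cl S (borel (act h F)) <-> forall f, vanishing F S f -> f h = 0.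
Proof.
move=> fF hu SB; split=> [clS f vf|H Z Zc SZ].
  have := clS _ (zclosed_hull S fF) _ => -[].
    move=> b Sb; have [F1 fF1 bE] := SB b Sb; have [g gu gE] := flag_conj fF fF1.
    have bE' : b = borel (act g F) by rewrite bE; apply: eq_borel.
    by exists g => //; split=> // f' [_]; apply=> //; rewrite -bE'.
  move=> h2 h2u [E H]; have := H (fun x => f (x *m (invmx h2 *m h))); rewrite mulKVmx //; apply.
  split; first exact: (polymx_mulr _ vf.1).
  move=> x xu Sx; apply: vf.2; first by rewrite !unitmx_mul xu unitmx_inv h2u hu.
  by rewrite (borel_act_eq fF h2u hu).
have [I [Ip IZ]] := zclosed_preim fF Zc.
apply/IZ => // f If; apply: H; split; first exact: Ip.
by move=> x xu /SZ /(IZ x xu); apply.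
Qed.

Lemma sub_closure S : S `<=` cl S.
Proof. by move=> b Sb Z _; apply. Qed.

Lemma closure_sub S Z : zclosed_flag Z -> S `<=` Z -> cl S `<=` Z.
Proof. by move=> Zc SZ b; apply. Qed.

Lemma closureS S X : S `<=` X -> cl S `<=` cl X.
Proof. by move=> SX b clb Z Zc XZ; apply: clb => //; apply: subset_trans XZ. Qed.

Lemma closure_id S : cl (cl S) `<=` cl S.
Proof. by move=> b H Z Zc SZ; apply: H => //; apply: closure_sub. Qed.

Lemma closure_least S X : S `<=` cl X -> cl S `<=` cl X.
Proof. by move=> /closureS H b /H/closure_id. Qed.

Lemma full_flag_exists : exists F, full_flag (fullv : {vspace kN}) F.
Proof.
have bV := vbasisP (fullv : {vspace kN}).
exists (fun i => <<take i (vbasis (fullv : {vspace kN}))>>%VS); split=> [i id|i id|].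
- have /catl_free/eqP -> : free (take i (vbasis (fullv : {vspace kN})) ++
      drop i (vbasis (fullv : {vspace kN}))) by rewrite cat_take_drop (basis_free bV).
  by rewrite size_takel // size_tuple.
- apply: sub_span => u; rewrite -(take_takel _ (leqnSn i)); exact: mem_take.
- by rewrite take_oversize ?size_tuple // (span_basis bV).
Qed.

Lemma zclosed_flags : zclosed_flag flags.
Proof.
split=> // _ [F1 fF1 ->]; exists set0; apply/seteqP; split=> h [hu _]; split=> //.
by rewrite AdV_borel //; exists (act h F1) => //; apply: full_flag_act.
Qed.

Lemma closure_flags S : S `<=` flags -> cl S `<=` flags.
Proof. exact: closure_sub zclosed_flags. Qed.

Lemma closure_closed S : S `<=` flags -> zclosed_flag (cl S).
Proof.
move=> SB; have [F fF] := full_flag_exists.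
suff -> : cl S = [set b | exists2 h, h \in unitmx &
    b = borel (act h F) /\ forall f, vanishing F S f -> f h = 0] by exact: zclosed_hull.
apply/seteqP; split=> [b clb|_ [h hu [-> H]]]; last exact/closureP.
have [F1 fF1 bE] := closure_flags SB clb; have [g gu gE] := flag_conj fF fF1.
have bE' : b = borel (act g F) by rewrite bE; apply: eq_borel.
by exists g => //; split=> //; apply/closureP => //; rewrite -bE'.
Qed.

Lemma dim_mv_gt x (U : {vspace kN}) r : (r < \dim (mv x U))%N <->
  exists (L : 'M[k]_(r.+1, N)) (R : 'M[k]_(N, r.+1)),
    (forall c : 'cV[k]_r.+1, R *m c \in U) /\ \det (L *m x *m R) != 0.
Proof.
split=> [rd|[L [R [RU dR]]]]; last first.
  rewrite ltnNge; apply/negP => le.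
  pose f := linfun (mulmx (x *m R) : 'cV[k]_r.+1 -> kN).
  have lf : (limg f <= mv x U)%VS.
    by apply/subvP => w /memv_imgP[c _ ->]; rewrite lfunE /= -mulmxA mem_mv.
  have kf : (fullv :&: lker f != 0)%VS.
    rewrite -dimv_eq0 -lt0n; have := limg_ker_dim f fullv.
    have -> : \dim {:'cV[k]_r.+1} = r.+1 by rewrite dimvf /= dim_matrix; exact: muln1.
    move=> E; rewrite lt0n; apply/negP => /eqP z; rewrite z add0n in E.
    by have := leq_trans (dimvS lf) le; rewrite E ltnn.
  move: kf; rewrite -vpick0; set c := vpick _.
  have : c \in (fullv :&: lker f)%VS by exact: memv_pick.
  rewrite memv_cap memvf memv_ker lfunE /= => /eqP xRc; apply/negP; rewrite negbK.
  have U1 : L *m x *m R \in unitmx by rewrite unitmxE unitfE.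
  by apply/eqP/(unitmx0 U1); rewrite -!mulmxA [x *m _]mulmxA xRc mulmx0.
set T := mv x U in rd *.
have [th [_ thT]] : exists th : 'I_(\dim T) -> 'rV[k]_N,
    (forall l u, u \in (0%VS : {vspace kN}) -> (th l *m u) 0 0 = 0) /\
    (forall l m : 'I_(\dim T), (th l *m (vbasis T)`_m) 0 0 = (l == m)%:R).
  by apply: dual_forms; rewrite capv0.
have /choice[u uP] : forall j : 'I_r.+1, exists u : kN, u \in U /\ x *m u = (vbasis T)`_j.
  move=> j; have /mvP[u uU uE] : (vbasis T)`_j \in T.
    by apply/vbasis_mem/mem_nth; rewrite size_tuple (leq_trans (ltn_ord j)).
  by exists u.
exists (\matrix_i th (widen_ord rd i)), (\matrix_(a, j) u j a 0); split.
  move=> c; have -> : (\matrix_(a, j) u j a 0) *m c = \sum_j c j 0 *: u j.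
    by apply/colP => a; rewrite mxE summxE; apply: eq_bigr => j _; rewrite !mxE mulrC.
  by apply: memv_suml => j _; apply: memvZ; case: (uP j).
suff -> : (\matrix_i th (widen_ord rd i)) *m x *m (\matrix_(a, j) u j a 0) = 1%:M.
  by rewrite det1 oner_eq0.
apply/matrixP => i j; rewrite -mulmxA mxE [RHS]mxE.
have := thT (widen_ord rd i) (widen_ord rd j); rewrite /= -(proj2 (uP j)).
rewrite -(inj_eq val_inj) /= => <-; rewrite mxE; apply: eq_bigr => a _; rewrite !mxE; congr (_ * _).
by apply: eq_bigr => b _; rewrite !mxE.
Qed.

Lemma closure_rank_le m l r S F : full_flag fullv F -> S `<=` flags -> (l <= N)%N ->
    (forall F', full_flag fullv F' -> S (borel F') -> (\dim (mv m (F' l)) <= r)%N) ->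
  cl S (borel F) -> (\dim (mv m (F l)) <= r)%N.
Proof.
move=> fF SB lN H clF; rewrite leqNgt; apply/negP => /dim_mv_gt[L [R [RU]]].
move/negP; apply; apply/eqP; rewrite -[m]mulmx1.
have rP := @funring_polymx k N.
apply: (proj1 (closureP fF (unitmx1 _ _) SB) _ (fun x => \det (L *m (m *m x) *m R))).
  by rewrite act1.
split=> [|x xu Sx].
  apply: (fr_det rP); apply: (fr_mx_mul rP); last exact: (fr_mx_const rP).
  apply: (fr_mx_mul rP); first exact: (fr_mx_const rP).
  by apply: (fr_mx_mul rP); [exact: (fr_mx_const rP) | exact: polymx_coord].
apply/eqP; rewrite -[_ == _]negbK; apply/negP => dn.
have := H _ (full_flag_act xu fF) Sx; rewrite /act -mvM leqNgt => /negP; apply.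
by apply/dim_mv_gt; exists L, R.
Qed.

Notation irr := (irreducible (@zclosed_flag k N)).

Lemma irreducible_closure S : S `<=` flags -> irr S -> irr (cl S).
Proof.
move=> SB [[b Sb] H]; split; first by exists b; apply: sub_closure.
move=> Z1 Z2 c1 c2 sub; have [] := H Z1 Z2 c1 c2 (subset_trans (@sub_closure S) sub).
  by move=> s; left; apply: closure_sub.
by move=> s; right; apply: closure_sub.
Qed.

Lemma zclosed_setU Z1 Z2 : zclosed_flag Z1 -> zclosed_flag Z2 -> @zclosed_flag k N (Z1 `|` Z2).
Proof.
move=> [s1 c1] [s2 c2]; split=> [b [/s1|/s2] //|b Bb].
have [P1 E1] := c1 b Bb; have [P2 E2] := c2 b Bb.
exists [set p | exists p1 p2, [/\ P1 p1, P2 p2 & p = p1 * p2]].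
apply/seteqP; split=> h [hu].
  move=> Zh; split=> // _ [p1 [p2 [P1p P2p ->]]]; rewrite mevalM.
  case: Zh => Zh.
    have [_ /(_ _ P1p) ->] : (@GL k N `&` zero_locus P1) h by rewrite -E1.
    by rewrite mul0r.
  have [_ /(_ _ P2p) ->] : (@GL k N `&` zero_locus P2) h by rewrite -E2.
  by rewrite mulr0.
move=> zh; split=> //.
case: (pselect (forall p, P1 p -> p.@[fun i => mxvec h 0 i] = 0)) => H1.
  by left; have [] : [set h0 | GL h0 /\ Z1 (AdV h0 b)] h by rewrite E1.
right; have [] // : [set h0 | GL h0 /\ Z2 (AdV h0 b)] h.
rewrite E2; split=> // p2 P2p; have /existsNP[p1 /not_implyP[P1p /eqP p1n]] := H1.
have := zh (p1 * p2); rewrite /= mevalM => /(_ _)/eqP.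
rewrite mulf_eq0 (negPf p1n) /= => H; apply/eqP/H; by exists p1, p2.
Qed.

Lemma irreducible_dense S X : S `<=` X -> X `<=` cl S -> X `<=` flags -> irr X -> irr S.
Proof.
move=> SX XS XB [[b Xb] H]; split.
  apply: contrapT => S0; have := XS b Xb set0; apply.
    split=> // _ [F1 fF1 ->]; exists [set 1]; apply/seteqP; split=> h [] // hu /(_ 1 erefl).
    by rewrite meval1 => /eqP; rewrite oner_eq0.
  by move=> c Sc; apply: S0; exists c.
move=> Z1 Z2 c1 c2 sub.
have XU : X `<=` Z1 `|` Z2.
  by move=> c /XS; apply; [exact: zclosed_setU|].
by have [s|s] := H _ _ c1 c2 XU; [left|right]; apply: subset_trans s.
Qed.

Lemma irreducible_open F m l X : full_flag fullv F -> X `<=` flags -> (l <= N)%N ->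
    irr X -> X (borel F) ->
  X `<=` cl [set b | X b /\ forall F', full_flag fullv F' -> b = borel F' ->
                      (\dim (mv m (F l)) <= \dim (mv m (F' l)))%N].
Proof.
move=> fF XB lN [_ H] XF; set U := (X in cl X).
pose V := [set b | X b /\ exists F', [/\ full_flag fullv F', b = borel F' &
  (\dim (mv m (F' l)) < \dim (mv m (F l)))%N]].
have UB : U `<=` flags by move=> b [/XB].
have VB : V `<=` flags by move=> b [/XB].
have [] // := H (cl U) (cl V) (closure_closed UB) (closure_closed VB).
  move=> b Xb; case: (pselect (V b)) => Vb; first by right; apply: sub_closure.
  left; apply: sub_closure; split=> // F' fF' bE; rewrite leqNgt; apply/negP => lt.
  by apply: Vb; split=> //; exists F'.
move=> /(_ _ XF) clV; exfalso.
have d0 : (0 < \dim (mv m (F l)))%N.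
  rewrite lt0n; apply/negP => /eqP d0.
  suff V0 : V = set0.
    have := clV set0; apply; last by rewrite V0.
    split=> // _ [F1 fF1 ->]; exists [set 1]; apply/seteqP; split=> h [] // hu /(_ 1 erefl).
    by rewrite meval1 => /eqP; rewrite oner_eq0.
  by apply/seteqP; split=> // b [_ [F' [_ _]]]; rewrite d0.
have := @closure_rank_le m l (\dim (mv m (F l))).-1 V F fF VB lN _ clV.
rewrite -ltnS prednK // ltnn => /(_ _) K; have : false; last by []; apply: K.
move=> F' fF' [_ [F'' [fF'' E lt]]]; rewrite -ltnS prednK //.
by rewrite (borel_inj fF' fF'' E).
Qed.

Definition rank_ge (ms : seq (gl * nat)) F (X : set {vspace gl}) : set {vspace gl} :=
  [set b | X b /\ forall F', full_flag fullv F' -> b = borel F' ->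
    forall m, m \in ms -> (\dim (mv m.1 (F m.2)) <= \dim (mv m.1 (F' m.2)))%N].

Lemma irreducible_opens F (ms : seq (gl * nat)) X : full_flag fullv F -> X `<=` flags ->
    all (fun m => m.2 <= N)%N ms -> irr X -> X (borel F) ->
  X `<=` cl (rank_ge ms F X).
Proof.
move=> fF XB; elim: ms X XB => [|m ms IH] X XB /=.
  by move=> _ _ _ b Xb; apply: sub_closure; split.
case/andP => mN msN iX XF; have := @irreducible_open F m.1 m.2 X fF XB mN iX XF.
set Y := (X in cl X) => XY.
have YX : Y `<=` X by move=> b [].
have YB : Y `<=` flags by apply: subset_trans XB.
have YF : Y (borel F).
  by split=> // F' fF' E; rewrite (borel_inj fF fF' E).
have iY := irreducible_dense YX XY XB iX.
apply: subset_trans XY (closure_least _) => b Yb.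
have := IH Y YB msN iY YF b Yb; apply: closureS => c [[Xc Yc] H]; split=> // F' fF' E p.
by rewrite inE => /orP[/eqP ->|]; [apply: Yc | apply: H].
Qed.

(* Among the flags of X, one of largest total rank has the ranks of a dense open part of X. *)
Lemma irreducible_generic (ms : seq (gl * nat)) X : X `<=` flags ->
    all (fun m => m.2 <= N)%N ms -> irr X ->
  exists F, [/\ full_flag fullv F, X (borel F) &
    X `<=` cl [set b | X b /\ forall F', full_flag fullv F' -> b = borel F' ->
      forall m, m \in ms -> \dim (mv m.1 (F' m.2)) = \dim (mv m.1 (F m.2))]].
Proof.
move=> XB msN iX; pose tot F := (\sum_(m <- ms) \dim (mv m.1 (F m.2)))%N.
have bound F : (tot F <= size ms * N)%N.
  rewrite /tot -sum1_size big_distrl /=; apply: leq_sum => m _; rewrite mul1n; exact: dim_le.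
pose Q n := `[< exists F, [/\ full_flag fullv F, X (borel F) & tot F = n] >].
have exQ : exists n, Q n.
  have [[b Xb] _] := iX; have [F fF bE] := XB b Xb.
  by exists (tot F); apply/asboolP; exists F; rewrite -bE.
have ubQ n : Q n -> (n <= size ms * N)%N.
  by move=> /asboolP[F [_ _ <-]].
case: (ex_maxnP exQ ubQ) => n /asboolP[F [fF XF tF]] nmax.
exists F; split=> //; apply: subset_trans (irreducible_opens fF XB msN iX XF) (closureS _).
move=> b [Xb ge]; split=> // F' fF' bE.
have := nmax (tot F') _; rewrite -tF => /(_ _) le.
have {}le : (tot F' <= tot F)%N by apply: le; apply/asboolP; exists F'; rewrite -bE.
move: le (ge F' fF' bE); rewrite /tot; elim: (ms) => [|m s IH]; first by [].
rewrite !big_cons => le ge' p; have h := ge' m (mem_head _ _).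
have h2 : (\sum_(j <- s) \dim (mv j.1 (F j.2)) <= \sum_(j <- s) \dim (mv j.1 (F' j.2)))%N.
  by rewrite !big_seq; apply: leq_sum => j js; apply: ge'; rewrite inE js orbT.
rewrite inE => /orP[/eqP ->|ps].
  apply/eqP; rewrite eqn_leq h andbT -(leq_add2r (\sum_(j <- s) \dim (mv j.1 (F' j.2)))).
  by apply: leq_trans le _; rewrite leq_add2l.
apply: IH => //; last by move=> q qs; apply: ge'; rewrite inE qs orbT.
rewrite -(leq_add2l (\dim (mv m.1 (F m.2)))).
by apply: leq_trans le; rewrite leq_add2r.
Qed.

End Closure.

(** * Irreducibility of strata *)

Section Form.
Variables (k : closedFieldType) (N : nat) (xi : 'rV[k]_N).

Lemma formB (u v : 'cV[k]_N) : (xi *m (u - v)) 0 0 = (xi *m u) 0 0 - (xi *m v) 0 0.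
Proof. by rewrite mulmxBr mxE [X in _ + X]mxE. Qed.

Lemma formZ c (u : 'cV[k]_N) : (xi *m (c *: u)) 0 0 = c * (xi *m u) 0 0.
Proof. by rewrite -scalemxAr mxE. Qed.

Lemma formBl xi' (u : 'cV[k]_N) : ((xi - xi') *m u) 0 0 = (xi *m u) 0 0 - (xi' *m u) 0 0.
Proof. by rewrite mulmxBl mxE [X in _ + X]mxE. Qed.

End Form.

Section FMat.
Variables (k : closedFieldType) (N : nat) (e : 'M[k]_N).
Notation gl := 'M[k]_N.
Notation kN := 'cV[k]_N.
Implicit Types (u v w : kN) (th : 'rV[k]_N) (U A : {vspace kN}).

(* The homomorphism u |-> sum_a th(e^(j-1-a) u) e^a v of k[e]-modules. *)
Definition fmat v th (j : nat) : gl := \sum_(a < j) e ^+ a *m v *m th *m e ^+ (j.-1 - a).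

Lemma fmatE v th j u :
  fmat v th j *m u = \sum_(a < j) (th *m (e ^+ (j.-1 - a) *m u)) 0 0 *: (e ^+ a *m v).
Proof.
rewrite mulmx_suml; apply: eq_bigr => a _.
by rewrite -[_ *m e ^+ _ *m u]mulmxA form_scale.
Qed.

Lemma fmatZ v th j t : fmat v (t *: th) j = t *: fmat v th j.
Proof.
by rewrite /fmat scaler_sumr; apply: eq_bigr => a _; rewrite -scalemxAr -scalemxAl.
Qed.

Lemma fmat_sum v s (th : 'I_s -> 'rV[k]_N) j :
  fmat v (\sum_l th l) j = \sum_l fmat v (th l) j.
Proof.
rewrite /fmat exchange_big; apply: eq_bigr => a _.
by rewrite mulmx_sumr mulmx_suml.
Qed.

Section Facts.
Variables (U A : {vspace kN}) (v : kN) (th : 'rV[k]_N) (j : nat).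
Hypotheses (sU : stab e U) (sA : stab e A) (vU : v \in U) (vj : e ^+ j *m v \in A).
Hypotheses (thA : forall a, a \in A -> (th *m a) 0 0 = 0)
  (thU : forall u, u \in U -> (th *m (e ^+ j *m u)) 0 0 = 0) (j0 : (0 < j)%N).

Lemma fmat_in u : fmat v th j *m u \in U.
Proof. by rewrite fmatE; apply: memv_suml => a _; apply: memvZ; apply: stab_exp. Qed.

Lemma fmat_A u : u \in A -> fmat v th j *m u = 0.
Proof. by move=> uA; rewrite fmatE big1 // => a _; rewrite thA ?scale0r // stab_exp. Qed.

Lemma fmat_comm u : u \in U -> fmat v th j *m (e *m u) - e *m (fmat v th j *m u) \in A.
Proof.
move=> uU; rewrite !fmatE mulmx_sumr -[j in X in X - _](prednK j0) -[j in X in _ - X](prednK j0).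
rewrite big_ord_recl [X in _ - X]big_ord_recr /= !expr0_mulmx subn0.
rewrite -exprSr_mulmx prednK // thU // scale0r add0r subnn expr0_mulmx.
rewrite opprD addrA [X in X - _](_ : _ = 0) ?add0r.
  by rewrite memvN -scalemxAr memvZ // -exprS_mulmx prednK.
apply/eqP; rewrite subr_eq0; apply/eqP; apply: eq_bigr => a _.
rewrite -scalemxAr -exprS_mulmx -exprSr_mulmx /bump /= add1n; congr ((th *m (e ^+ _ *m _)) 0 0 *: _).
by have := ltn_ord a; lia.
Qed.

Lemma fmat_form (phi : 'rV[k]_N) u : (forall x, x \in U -> (phi *m (e *m x)) 0 0 = 0) ->
  (phi *m (fmat v th j *m u)) 0 0 = (th *m (e ^+ j.-1 *m u)) 0 0 * (phi *m v) 0 0.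
Proof.
move=> phiU; rewrite fmatE mulmx_sumr summxE -(prednK j0) big_ord_recl /= subn0.
rewrite expr0_mulmx -scalemxAr mxE big1 ?addr0 // => a _.
by rewrite -scalemxAr mxE /bump /= add1n exprS_mulmx phiU ?mulr0 // stab_exp.
Qed.

Lemma fmat_unit : (th *m (e ^+ j.-1 *m v)) 0 0 = 0 -> 1 + fmat v th j \in unitmx.
Proof.
move=> thv; apply: unitmxP => u; rewrite mulmxDl mul1mx => /eqP; rewrite addr_eq0 => /eqP uE.
have vi i : (j <= i)%N -> e ^+ i *m v \in A.
  by move=> ji; rewrite -(subnK ji) exprD_mulmx stab_exp.
have thv' i : (j.-1 <= i)%N -> (th *m (e ^+ i *m v)) 0 0 = 0.
  rewrite leq_eqVlt => /orP[/eqP <- //|lt]; rewrite thA // vi //; lia.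
have Z m : (m < j)%N -> (th *m (e ^+ (j.-1 - m) *m u)) 0 0 = 0.
  elim/ltn_ind: m => m IH mj; rewrite uE fmatE mulmxN mulmxN mxE mulmx_sumr mulmx_sumr summxE.
  rewrite big1 ?oppr0 // => a _; rewrite -!scalemxAr mxE.
  case: (ltnP a m) => am; first by rewrite IH ?mul0r // (ltn_trans am).
  by rewrite -exprD_mulmx thv' ?mulr0 //; lia.
by rewrite uE fmatE big1 ?oppr0 // => a _; rewrite Z ?scale0r.
Qed.

End Facts.
End FMat.

Section Tower.
Variables (k : closedFieldType) (N : nat) (e : 'M[k]_N).
Notation gl := 'M[k]_N.
Notation kN := 'cV[k]_N.
Implicit Types (u v w : kN) (U : {vspace kN}) (z h y : gl).
Variables (A F0 : nat -> {vspace kN}).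
Hypothesis eN : e ^+ N = 0.

Definition instrat (F : nat -> {vspace kN}) :=
  full_flag fullv F /\ forall l, (0 < l <= N)%N ->
    [/\ (A l <= F l.-1)%VS, stab e (F l) &
        forall b, \dim (qker e (A l) b (F l)) = \dim (qker e (A l) b (F0 l))].

Hypothesis sF0 : instrat F0.
Hypothesis sA : forall l, (0 < l <= N)%N -> stab e (A l).
Hypothesis Atop : forall i, (0 < i <= N)%N -> A (\dim (A i)).+1 = A i.
Hypothesis Aeq : forall l i, (0 < l <= i)%N -> (i <= N)%N -> (\dim (A i) < l)%N -> A l = A i.

Lemma ff0 : full_flag fullv F0. Proof. by case: sF0. Qed.

Lemma eq_instrat F G : full_flag fullv F -> (forall l, (l <= N)%N -> F l = G l) ->
  instrat G -> instrat F.
Proof.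
move=> fF E [_ sG]; split=> // l lN; have [l0 l1] := andP lN.
by rewrite (E l l1) (E l.-1 (leq_trans (leq_pred l) l1)); apply: sG.
Qed.

Lemma A_le F l : instrat F -> (0 < l <= N)%N -> (A l <= F l)%VS.
Proof.
move=> [fF sF] lN; have [AF _ _] := sF l lN; apply: subv_trans AF (flag_mono fF _); lia.
Qed.

Lemma dimA_lt i : (0 < i <= N)%N -> (\dim (A i) < i)%N.
Proof.
move=> iN; have [/dimvS AF _ _] := sF0.2 i iN; move: AF; rewrite (flag_dim ff0); lia.
Qed.

Lemma flag_dimA F i : instrat F -> (0 < i <= N)%N -> F (\dim (A i)) = A i.
Proof.
move=> [fF sF] iN; have lt := dimA_lt iN.
have [AF _ _] := sF (\dim (A i)).+1 ltac:(lia); rewrite Atop //= in AF.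
by apply/esym/eqP; rewrite eqEdim AF (flag_dim fF) //; lia.
Qed.

Lemma flag_le_A F l i : instrat F -> (0 < i <= N)%N -> (l <= \dim (A i))%N -> (F l <= A i)%VS.
Proof.
move=> sF iN le; rewrite -(flag_dimA sF iN); apply: (flag_mono sF.1).
by have := dimA_lt iN; lia.
Qed.

Lemma instrat_stab F l : instrat F -> (l <= N)%N -> stab e (F l).
Proof.
move=> sF; case: l => [_|l lN]; last by have [] := sF.2 l.+1 lN.
by rewrite (flag0 sF.1); apply: stab0.
Qed.

Lemma dim_qker_pred F i b : instrat F -> (0 < i <= N)%N ->
  \dim (qker e (A i) b (F i.-1)) = \dim (qker e (A i) b (F0 i.-1)).
Proof.
move=> sF iN; case: (ltnP (\dim (A i)) i.-1) => lt.
  rewrite -(@Aeq i.-1 i) //; try lia.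
  by have [_ _ ->] := sF.2 i.-1 ltac:(lia).
have d : i.-1 = \dim (A i) by have := dimA_lt iN; lia.
by rewrite d (flag_dimA sF) // (flag_dimA sF0).
Qed.

Lemma qker_hyper_iff F i b : instrat F -> (0 < i <= N)%N -> F i = F0 i ->
  (qker e (A i) b (F0 i) <= F i.-1)%VS = (qker e (A i) b (F0 i) <= F0 i.-1)%VS.
Proof.
move=> sF iN E; have H G : instrat G -> G i = F0 i -> (qker e (A i) b (F0 i) <= G i.-1)%VS =
    (\dim (qker e (A i) b (F0 i)) <= \dim (qker e (A i) b (G i.-1)))%N.
  move=> sG GE; have GS : (G i.-1 <= F0 i)%VS.
    by rewrite -GE; apply: (flag_mono sG.1); lia.
  rewrite (qker_capv _ _ _ GS); apply/capv_idPl/idP => [->//|le].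
  by apply/eqP; rewrite eqEdim capvSl.
by rewrite (H F) // (H F0) // dim_qker_pred.
Qed.

Record level (i j : nat) (v : kN) (s : nat) (th : nat -> 'rV[k]_N) : Prop := Level {
  lv_j : (0 < j)%N;
  lv_v : v \in qker e (A i) j (F0 i);
  lv_vH : v \notin F0 i.-1;
  lv_lo : (qker e (A i) j.-1 (F0 i) <= F0 i.-1)%VS;
  lv_A : forall l : 'I_s, forall a, a \in A i -> (th l *m a) 0 0 = 0;
  lv_U : forall l : 'I_s, forall u, u \in F0 i -> (th l *m (e ^+ j *m u)) 0 0 = 0;
  lv_thv : forall l : 'I_s, (th l *m (e ^+ j.-1 *m v)) 0 0 = 0;
  lv_span : forall rho : 'rV[k]_N,
    (forall u, u \in F0 i -> (rho *m (e *m u)) 0 0 = 0) -> (rho *m v) 0 0 = 0 ->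
    (forall u, u \in qker e (A i) j.-1 (F0 i) -> (rho *m u) 0 0 = 0) ->
    exists c : nat -> k, forall u, u \in F0 i ->
      (rho *m u) 0 0 = ((\sum_(l < s) c l *: th l) *m (e ^+ j.-1 *m u)) 0 0;
  lv_free : forall c : nat -> k,
    (forall u, u \in F0 i -> ((\sum_(l < s) c l *: th l) *m (e ^+ j.-1 *m u)) 0 0 = 0) ->
    forall l, (l < s)%N -> c l = 0;
  lv_dim : A i = 0%VS ->
    (s.+1 + \dim (qker e (A i) j.-1 (F0 i)) = \dim (qker e (A i) j (F0 i)))%N }.

Lemma vj_notin i j (v : kN) : (0 < i <= N)%N -> (0 < j)%N -> v \in qker e (A i) j (F0 i) ->
    v \notin F0 i.-1 -> (qker e (A i) j.-1 (F0 i) <= F0 i.-1)%VS ->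
  e ^+ j.-1 *m v \notin (mv (e ^+ j) (F0 i) + A i)%VS.
Proof.
move=> iN j0 vq vH lo; apply: contra vH => /memv_addP[_ /mvP[x xU ->] [a aA E]].
have HU : (F0 i.-1 <= F0 i)%VS by apply: (flag_mono ff0); lia.
have ex : e *m x \in F0 i.-1.
  apply: (nilp_hyper eN (instrat_stab sF0 _) (instrat_stab sF0 _) HU _ xU); try lia.
  by rewrite !(flag_dim ff0); lia.
rewrite -[v](subrK (e *m x)) memvD //; apply: (subvP lo).
move: vq; rewrite !mem_qker => /andP[vU _]; rewrite memvB //=; last first.
  exact: (subvP HU).
by rewrite mulmxBr E -exprSr_mulmx prednK // addrAC subrr add0r.
Qed.

Lemma level_exists i : (0 < i <= N)%N -> exists j v s th, level i j v s th.
Proof.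
move=> iN; have HU : (F0 i.-1 <= F0 i)%VS by apply: (flag_mono ff0); lia.
have sU : stab e (F0 i) by apply: instrat_stab => //; lia.
have dU : \dim (F0 i) = (\dim (F0 i.-1)).+1 by rewrite !(flag_dim ff0); lia.
have [AH _ _] := sF0.2 i iN.
have exj : exists j, ~~ (qker e (A i) j (F0 i) <= F0 i.-1)%VS.
  exists N; apply/negP => /dimvS; have -> : qker e (A i) N (F0 i) = F0 i; last by rewrite dU ltnn.
  by apply/vspaceP => u; rewrite mem_qker eN mul0mx mem0v andbT.
case: (ex_minnP exj) => j /subvPn[v vq vH] jmin.
have j0 : (0 < j)%N.
  case: j vq {jmin} => // ; rewrite mem_qker expr0_mulmx => /andP[_ vA].
  by rewrite (subvP AH) in vH.
have lo : (qker e (A i) j.-1 (F0 i) <= F0 i.-1)%VS.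
  by apply/negP => /negP/jmin; lia.
have vn := vj_notin iN j0 vq vH lo.
pose Q := mv (e ^+ j.-1) (F0 i).
pose Q1 := (mv (e ^+ j) (F0 i) + A i + <[e ^+ j.-1 *m v]>)%VS.
pose TT := (Q :\: Q1)%VS.
have [th [thQ thT]] := @dual_forms _ _ TT Q1 (capv_diff Q Q1).
pose th' l := odflt 0 (omap th (insub l : option 'I_(\dim TT))).
have thE (l : 'I_(\dim TT)) : th' l = th l by rewrite /th' valK.
have /choice[x xP] : forall l : 'I_(\dim TT), exists x, x \in F0 i /\ (vbasis TT)`_l = e ^+ j.-1 *m x.
  move=> l; have /mvP[x xU xE] : (vbasis TT)`_l \in Q.
    by apply: (subvP (diffvSl Q Q1)); apply/vbasis_mem/mem_nth; rewrite size_tuple.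
  by exists x.
exists j, v, (\dim TT), th'; split=> //.
- move=> l a aA; rewrite thE thQ //; apply: (subvP (addvSl _ _)); exact: (subvP (addvSr _ _)).
- move=> l u uU; rewrite thE thQ //; apply: (subvP (addvSl _ _)).
  by apply: (subvP (addvSl _ _)); apply: mem_mv.
- by move=> l; rewrite thE thQ //; apply: (subvP (addvSr _ _)); apply: memv_line.
- move=> rho rhoU rhov rholo; exists (fun l => if insub l is Some o then (rho *m x o) 0 0 else 0).
  move=> u uU; have : e ^+ j.-1 *m u \in (TT + (Q :&: Q1))%VS by rewrite addv_diff_cap mem_mv.
  case/memv_addP => tau tauT [q qQ E].
  have qQ1 : q \in Q1 by move: qQ; rewrite memv_cap => /andP[].
  pose al l := coord (vbasis TT) l tau.
  have tauE : tau = \sum_l al l *: (e ^+ j.-1 *m x l).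
    by rewrite {1}(coord_vbasis tauT); apply: eq_bigr => l _; rewrite -(proj2 (xP l)).
  have thu l : (th l *m (e ^+ j.-1 *m u)) 0 0 = al l.
    rewrite E mulmxDr mxE (thQ l q) // addr0 {1}(coord_vbasis tauT) mulmx_sumr summxE.
    rewrite (bigD1 l) //= -scalemxAr mxE thT eqxx mulr1 big1 ?addr0 // => m ml.
    by rewrite -scalemxAr mxE thT eq_sym (negPf ml) mulr0.
  pose u1 := u - \sum_l al l *: x l.
  have u1U : u1 \in F0 i.
    by rewrite memvB //; apply: memv_suml => l _; apply: memvZ; case: (xP l).
  have eu1 : e ^+ j.-1 *m u1 = q.
    rewrite mulmxBr E tauE mulmx_sumr addrAC [X in X + _](_ : _ = 0) ?add0r //.
    by apply/eqP; rewrite subr_eq0; apply/eqP/eq_bigr => l _; rewrite scalemxAr.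
  have uE1 : u = u1 + \sum_l al l *: x l by rewrite subrK.
  clearbody u1.
  have rhou1 : (rho *m u1) 0 0 = 0.
    move: qQ1; rewrite -eu1 => /memv_addP[_ /memv_addP[_ /mvP[y yU ->] [a aA ->]] [_ /vlineP[c ->] E1]].
    have : u1 - e *m y - c *: v \in qker e (A i) j.-1 (F0 i).
      rewrite mem_qker !memvB ?sU ?memvZ //=; last by move: vq; rewrite mem_qker => /andP[].
      rewrite !mulmxBr E1 -exprSr_mulmx prednK // -scalemxAr addrAC addrK addrAC subrr add0r //.
    by move/rholo; rewrite !formB formZ rhoU // rhov mulr0 !subr0.
  rewrite {1}uE1 mulmxDr mxE rhou1 add0r mulmx_sumr summxE.
  rewrite mulmx_suml summxE; apply: eq_bigr => l _.
  by rewrite -scalemxAr mxE valK thE -scalemxAl [RHS]mxE thu mulrC.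
- move=> c H l ls; have := H (x (Ordinal ls)) (proj1 (xP _)).
  rewrite -(proj2 (xP _)) mulmx_suml summxE (bigD1 (Ordinal ls)) //= -scalemxAl mxE.
  rewrite (thE (Ordinal ls)) (thT (Ordinal ls) (Ordinal ls)) eqxx mulr1 big1 ?addr0 // => m ml.
  by rewrite -scalemxAl mxE thE (thT m (Ordinal ls)) (negPf ml) mulr0.
- move=> A0; have := dimv_cap_compl Q Q1; rewrite -/TT.
  have -> : (Q :&: Q1)%VS = Q1.
    apply/capv_idPr; rewrite !subv_add A0 sub0v andbT -memvE mem_mv ?andbT.
      by apply: mv_sub => u uU; rewrite -(prednK j0) exprSr_mulmx mem_mv // sU.
    by move: vq; rewrite mem_qker => /andP[].
  have -> : \dim Q1 = (\dim (mv (e ^+ j) (F0 i))).+1.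
    rewrite /Q1 A0 addv0 dimv_disjoint_sum.
      rewrite dim_vline; have -> : e ^+ j.-1 *m v != 0; last by rewrite addn1.
      by apply: contraNneq vn => ->; apply: mem0v.
    apply/eqP; rewrite -subv0; apply/subvP => y; rewrite memv_cap memv0 => /andP[yQ /vlineP[c yE]].
    rewrite A0 addv0 in vn; apply: contraNT vn => y0.
    have c0 : c != 0 by apply: contraNneq y0 => c0; rewrite yE c0 scale0r.
    have := memvZ c^-1 yQ; rewrite yE scalerA mulVf // scale1r //.
  have := dim_qker e j (F0 i); have := dim_qker e j.-1 (F0 i); rewrite A0 -/Q; lia.
Qed.

Definition levelgp i z :=
  [/\ z \in unitmx, (forall l, (i <= l <= N)%N -> stab z (F0 l)),
      (forall a, a \in A i -> z *m a = a) &
      forall u, u \in F0 i -> z *m (e *m u) - e *m (z *m u) \in A i].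

Lemma levelgp_inv i z : (0 < i <= N)%N -> levelgp i z -> levelgp i (invmx z).
Proof.
move=> iN [zu zF zA ze]; have zA' a : a \in A i -> invmx z *m a = a.
  by move=> aA; rewrite -{1}(zA a aA) mulKmx.
have zF' l : (i <= l <= N)%N -> stab (invmx z) (F0 l).
  by move=> il u uF; rewrite -mem_mvE // (mv_stable zu (zF l il)).
split=> //; first by rewrite unitmx_inv.
move=> u uU; have := ze (invmx z *m u) (zF' i ltac:(lia) u uU); rewrite mulKVmx // => H.
have := zA' _ H; rewrite mulmxBr mulKmx // => E.
by rewrite -opprB E memvN.
Qed.

Definition agree i (F : nat -> {vspace kN}) := forall l, (i <= l <= N)%N -> F l = F0 l.

Lemma levelgp_act i z F : (0 < i <= N)%N -> levelgp i z -> instrat F -> agree i F ->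
  instrat (act z F) /\ agree i (act z F).
Proof.
move=> iN [zu zF zA ze] sF FE.
have agr : agree i (act z F).
  by move=> l il; rewrite /act FE // (mv_stable zu (zF l il)).
split=> //; split; first exact: full_flag_act sF.1.
move=> l lN; have [AF eF dF] := sF.2 l lN.
have zAm : mv z (A i) = A i by apply: mv_stable => // a aA; rewrite zA.
case: (leqP l i) => li; last first.
  have same m : (i <= m <= N)%N -> act z F m = F m by move=> im; rewrite agr // FE.
  by rewrite !same //; lia.
case: (leqP l (\dim (A i))) => lA.
  have small m : (m <= l)%N -> act z F m = F m.
    move=> ml; apply: mv_stable => // u uF; rewrite zA //.
    by apply: (subvP (@flag_le_A F m i sF iN _)) uF; lia.
  by rewrite !small //; lia.
have AE : A l = A i by apply: Aeq; lia.
have FU : (F l <= F0 i)%VS by rewrite -(FE i); [apply: (flag_mono sF.1)|]; lia.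
have AzF : (A i <= mv z (F l))%VS by rewrite -zAm mvS // -AE; apply: A_le.
have eb b u : u \in F l -> z *m (e ^+ b *m u) - e ^+ b *m (z *m u) \in A i.
  move=> uF; elim: b => [|b IH]; first by rewrite !expr0_mulmx subrr mem0v.
  have := memvD (ze (e ^+ b *m u) (subvP FU _ (stab_exp b eF uF))) (sA iN IH).
  by rewrite mulmxBr addrA subrK -!exprS_mulmx.
split=> [||b].
- by rewrite AE -zAm mvS // -AE.
- move=> _ /mvP[u uF ->]; have := eb 1%N u uF; rewrite expr1 => H.
  have -> : e *m (z *m u) = z *m (e *m u) - (z *m (e *m u) - e *m (z *m u)).
    by rewrite opprB addrC subrK.
  by rewrite memvB ?mem_mv ?eF // (subvP AzF).
- rewrite -dF AE /act; have -> : qker e (A i) b (mv z (F l)) = mv z (qker e (A i) b (F l)).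
    apply/vspaceP => w; rewrite mem_mvE // !mem_qker mem_mvE //.
    case: (boolP (invmx z *m w \in F l)) => //= wF; have := eb b _ wF; rewrite mulKVmx // => H.
    rewrite -[in RHS](mem_mv_mul (A i) _ zu) zAm -(mulKVmx zu w) mulKmx //.
    apply/idP/idP => h; [have := memvD h H | have := memvB h H].
      by rewrite mulKVmx // addrC subrK.
    by rewrite mulKVmx // opprB addrC subrK.
  exact: dim_mv.
Qed.

Lemma fmat_levelgp i j v (th : 'rV[k]_N) : (0 < i <= N)%N -> (0 < j)%N -> v \in qker e (A i) j (F0 i) ->
    (forall a, a \in A i -> (th *m a) 0 0 = 0) ->
    (forall u, u \in F0 i -> (th *m (e ^+ j *m u)) 0 0 = 0) ->
    1 + fmat e v th j \in unitmx -> levelgp i (1 + fmat e v th j).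
Proof.
move=> iN j0; rewrite mem_qker => /andP[vU vj] thA thU zu.
have sU : stab e (F0 i) by apply: instrat_stab => //; lia.
have fin := fmat_in th j sU vU.
split=> //.
- move=> l il u uF; rewrite mulmxDl mul1mx memvD //.
  by apply: (subvP (flag_mono ff0 il)); apply: fin.
- by move=> a aA; rewrite mulmxDl mul1mx (fmat_A _ _ (sA iN) thA) ?addr0.
- move=> u uU; rewrite !mulmxDl !mul1mx mulmxDr opprD addrACA subrr add0r.
  exact: (fmat_comm vU vj thU j0 uU).
Qed.

Definition Xi i h := [/\ h \in unitmx, instrat (act h F0) & agree i (act h F0)].

Definition Ez (v : kN) (j s : nat) (th : nat -> 'rV[k]_N) (c : nat -> k) : gl :=
  1 + fmat e v (\sum_(l < s) c l *: th l) j.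

Section OneLevel.
Variables (i j : nat) (v : kN) (s : nat) (th : nat -> 'rV[k]_N).
Hypotheses (iN : (0 < i <= N)%N) (lv : level i j v s th).

Lemma Ez_levelgp c : levelgp i (Ez v j s th c).
Proof.
have j0 := lv_j lv; have := lv_v lv; rewrite mem_qker => /andP[vU vj].
have thA a : a \in A i -> ((\sum_(l < s) c l *: th l) *m a) 0 0 = 0.
  move=> aA; rewrite mulmx_suml summxE big1 // => l _.
  by rewrite -scalemxAl mxE (lv_A lv) ?mulr0.
have thU u : u \in F0 i -> ((\sum_(l < s) c l *: th l) *m (e ^+ j *m u)) 0 0 = 0.
  move=> uU; rewrite mulmx_suml summxE big1 // => l _.
  by rewrite -scalemxAl mxE (lv_U lv) ?mulr0.
apply: fmat_levelgp => //; first exact: lv_v lv.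
have sU : stab e (F0 i) by apply: instrat_stab => //; lia.
apply: (fmat_unit (sA iN) vU vj thA j0).
rewrite mulmx_suml summxE big1 // => l _.
by rewrite -scalemxAl mxE (lv_thv lv) ?mulr0.
Qed.

Lemma Xi_good h : Xi i h -> v \notin act h F0 i.-1 ->
  exists c y, Xi i.-1 y /\ h = Ez v j s th c *m y.
Proof.
move=> [hu sF FE] vH; set F := act h F0 in sF FE vH.
have FiE : F i = F0 i by apply: FE; lia.
have HU G : instrat G -> G i = F0 i -> (G i.-1 <= F0 i)%VS.
  by move=> sG <-; apply: (flag_mono sG.1); lia.
have dU G : instrat G -> \dim (F0 i) = (\dim (G i.-1)).+1.
  by move=> sG; rewrite !(flag_dim ff0) ?(flag_dim sG.1); lia.
have sU : stab e (F0 i) by apply: instrat_stab => //; lia.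
have eH G u : instrat G -> G i = F0 i -> u \in F0 i -> e *m u \in G i.-1.
  move=> sG GE uU; apply: (nilp_hyper eN _ sU (HU G sG GE) (dU G sG) uU).
  by apply: instrat_stab => //; lia.
have [phi [phiH phiv]] := sep_form vH.
have [phi0 [phi0H phi0v]] := sep_form (lv_vH lv).
have vU : v \in F0 i by have := lv_v lv; rewrite mem_qker => /andP[].
have [||u uq|c cE] := lv_span lv (rho := phi0 - phi).
- move=> u uU; rewrite formBl.
  by rewrite phi0H ?phiH ?subr0 //; apply: eH.
- by rewrite formBl phi0v phiv subrr.
- have u0 : u \in F0 i.-1 by apply: subvP uq; exact: lv_lo lv.
  have u1 : u \in F i.-1.
    by apply: subvP uq; rewrite (qker_hyper_iff _ sF iN FiE); apply: lv_lo lv.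
  by rewrite formBl phi0H // phiH // subr0.
have zgp := Ez_levelgp c; set z := Ez v j s th c in zgp *.
have [zu zF zA ze] := zgp.
have zH : mv z (F0 i.-1) = F i.-1.
  apply/eqP; rewrite eqEdim dim_mv // !(flag_dim ff0) ?(flag_dim sF.1) ?leqnn ?andbT; try lia.
  apply: mv_sub => u uH; have uU : u \in F0 i by apply: (subvP (HU F0 sF0 erefl)).
  have zuU : z *m u \in F0 i by apply: zF => //; lia.
  have [b bE] := hyper_dec (HU F sF FiE) (dU F sF) vU vH zuU.
  have phiz : (phi *m (z *m u)) 0 0 = 0.
    rewrite mulmxDl mul1mx mulmxDr mxE (fmat_form _ sU vU (lv_j lv)) => [|w wU].
      by rewrite -cE // phiv mulr1 formBl addrC subrK phi0H.
    by apply: phiH; apply: eH.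
  have := phiH _ bE; rewrite formB phiz formZ phiv mulr1 sub0r.
  by move/eqP; rewrite oppr_eq0 => /eqP b0; move: bE; rewrite b0 scale0r subr0.
exists c, (invmx z *m h); split; last by rewrite mulKVmx.
have [sy ay] := levelgp_act iN (levelgp_inv iN zgp) sF FE.
split; [by rewrite unitmx_GL // unitmx_inv | by rewrite actM | rewrite actM => l il].
case: (leqP i l) => il2; first by apply: ay; lia.
have -> : l = i.-1 by lia.
by change (mv (invmx z) (F i.-1) = F0 i.-1); rewrite -zH mvV.
Qed.

Lemma Xi_scale h t : t != 0 -> Xi i h -> Xi i (t *: h).
Proof.
move=> t0 [hu sF FE]; have E : act (t *: h) F0 = act h F0.
  apply: funext => l; apply/vspaceP => w; apply/mvP/mvP => -[u uF ->].
    by exists (t *: u); rewrite ?memvZ // -scalemxAr scalemxAl.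
  by exists (t^-1 *: u); rewrite ?memvZ // -scalemxAr -scalemxAl scalerA mulVf ?scale1r.
by split; rewrite ?E // unitmxZ ?unitfE.
Qed.

Lemma Xi_dense f : polymx f ->
    (forall c y, Xi i.-1 y -> f (Ez v j s th c *m y) = 0) ->
  forall h, Xi i h -> f h = 0.
Proof.
move=> pf Hf; have good h : Xi i h -> v \notin act h F0 i.-1 -> f h = 0.
  by move=> Xh vH; have [c [y [Xy ->]]] := Xi_good Xh vH; apply: Hf.
move=> h Xh; case: (boolP (v \in act h F0 i.-1)) => vH; last exact: good.
have [hu sF FE] := Xh; set F := act h F0 in sF FE vH.
have FiE : F i = F0 i by apply: FE; lia.
have sU : stab e (F0 i) by apply: instrat_stab => //; lia.
have dU : \dim (F0 i) = (\dim (F i.-1)).+1.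
  by rewrite !(flag_dim ff0) ?(flag_dim sF.1); lia.
have HU : (F i.-1 <= F0 i)%VS by rewrite -FiE; apply: (flag_mono sF.1); lia.
have /subvPn[w wq wH] : ~~ (qker e (A i) j (F0 i) <= F i.-1)%VS.
  rewrite (qker_hyper_iff _ sF iN FiE); apply/subvPn; exists v; [exact: lv_v lv | exact: lv_vH lv].
have wU : w \in F0 i by move: wq; rewrite mem_qker => /andP[].
have [phi [phiH phiw]] := sep_form wH.
have vn := vj_notin iN (lv_j lv) (lv_v lv) (lv_vH lv) (lv_lo lv).
have [th1 [th1D th1v]] := sep_form vn.
pose g := fmat e w th1 j.
have rt := funring_polyt k; have rx := @funring_polymx k N.
pose Z t := 1 + t *: g.
have pZ : fr_mx (@polyt k) Z.
  apply: (fr_mx_add rt); first exact: (fr_mx_const rt).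
  by apply: (fr_mx_scale rt); [exact: polyt_id | exact: (fr_mx_const rt)].
pose ga t := \adj (Z t) *m h.
have pga : polyt (fun t => f (ga t)).
  apply: (polymx_comp rt pf); apply: (fr_mx_mul rt); last exact: (fr_mx_const rt).
  exact: (fr_adj rt).
have pd : polyt (fun t => t * \det (Z t)).
  by apply: (fr_mul rt); [exact: polyt_id | exact: (fr_det rt)].
have Z0 : Z 0 = 1 by rewrite /Z scale0r addr0.
have [t0 t0n] : exists t0, t0 * \det (Z t0) != 0.
  apply: contrapT => /forallNP H.
  have H' t : t * \det (Z t) = 0 by apply/eqP; move: (H t) => /negP; rewrite negbK.
  have [] := polyt_domain (polyt_id k) (fr_det rt pZ) H'.
    by move/(_ 1)/eqP; rewrite oner_eq0.
  by move/(_ 0)/eqP; rewrite Z0 det1 oner_eq0.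
suff H t : t * \det (Z t) != 0 -> f (ga t) = 0.
  have := polyt_generic pd pga t0n H 0; rewrite /ga Z0.
  have -> : \adj (1 : gl) = 1 by have := mul_mx_adj (1 : gl); rewrite mul1mx det1.
  by rewrite mul1mx.
rewrite mulf_eq0 negb_or => /andP[tn dn].
have Zu : Z t \in unitmx by rewrite unitmxE unitfE.
have ZE : Z t = 1 + fmat e w (t *: th1) j by rewrite fmatZ.
have Zgp : levelgp i (Z t).
  rewrite ZE; apply: fmat_levelgp => //; first exact: lv_j lv.
  - move=> a aA; rewrite -scalemxAl mxE th1D ?mulr0 //; exact: (subvP (addvSr _ _)).
  - move=> u uU; rewrite -scalemxAl mxE th1D ?mulr0 //; apply: (subvP (addvSl _ _)).
    exact: mem_mv.
  - by rewrite -ZE.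
have gaE : ga t = \det (Z t) *: (invmx (Z t) *m h).
  by rewrite /ga scalemxAl /invmx Zu scalerA mulfV // scale1r.
have [sy ay] := levelgp_act iN (levelgp_inv iN Zgp) sF FE.
have Xy : Xi i (invmx (Z t) *m h).
  by split; rewrite ?actM // unitmx_GL // unitmx_inv.
have Xga : Xi i (ga t) by rewrite gaE; apply: Xi_scale.
apply: good => //; rewrite gaE; apply/negP => /mvP[u uF uE].
have ZvH : Z t *m v \in F i.-1.
  rewrite uE -scalemxAl -scalemxAr memvZ // -mulmxA mulKVmx //; exact: mem_mv.
have vU : v \in F0 i by have := lv_v lv; rewrite mem_qker => /andP[].
have := phiH _ ZvH; rewrite mulmxDl mul1mx mulmxDr mxE phiH // add0r -scalemxAl -scalemxAr mxE.
rewrite (fmat_form _ sU wU (lv_j lv)); first by rewrite th1v phiw !mulr1 => /eqP; rewrite (negPf tn).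
move=> x xU; apply: phiH.
have eF : stab e (F i.-1).
  have iN1 : (i.-1 <= N)%N by have /andP[_] := iN; apply: leq_trans (leq_pred i).
  exact: (instrat_stab sF iN1).
exact: (nilp_hyper eN eF sU HU dU xU).
Qed.

End OneLevel.

Section Levels.
Variables (j s : nat -> nat) (v : nat -> kN) (th : nat -> nat -> 'rV[k]_N).
Hypothesis lv : forall i, (0 < i <= N)%N -> level i (j i) (v i) (s i) (th i).

Fixpoint pi_ (i : nat) (c : nat -> nat -> k) (b : gl) : gl :=
  if i is i'.+1 then Ez (v i) (j i) (s i) (th i) (c i) *m pi_ i' c b else b.

Definition inY i y := exists c b, [/\ b \in unitmx, b \in borel F0 & y = pi_ i c b].

Lemma pi_ext i c c' b : (forall l, (0 < l <= i)%N -> c l = c' l) -> pi_ i c b = pi_ i c' b.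
Proof.
elim: i => //= i IH E; rewrite (E i.+1) ?leqnn // IH // => l /andP[l0 li].
by apply: E; rewrite l0 leqW.
Qed.

Lemma inY_dense i : (i <= N)%N -> forall f, polymx f -> (forall y, inY i y -> f y = 0) ->
  forall h, Xi i h -> f h = 0.
Proof.
elim: i => [|i IH] iN f pf Hf h Xh.
  apply: Hf; exists (fun _ _ => 0), h; case: Xh => hu sF FE; split=> //.
  apply/borelP => l lN u uF; have := mem_mv h uF; rewrite -/(act h F0 l) FE //.
apply: (Xi_dense _ (lv _) pf) Xh; rewrite ?iN // => c y Xy.
apply: (IH (ltnW iN) (fun y => f (Ez (v i.+1) (j i.+1) (s i.+1) (th i.+1) c *m y))) Xy.
  exact: polymx_mull.
move=> _ [c' [b [bu bB ->]]]; apply: Hf.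
exists (fun l => if l == i.+1 then c else c' l), b; split=> //=.
rewrite eqxx; congr (_ *m _); apply: pi_ext => l /andP[_ li].
by rewrite ltn_eqF.
Qed.

Lemma inY_Xi i y : (i <= N)%N -> inY i y -> Xi i y.
Proof.
elim: i y => [|i IH] y iN [c [b [bu bB ->]]].
  have bF l : (l <= N)%N -> act b F0 l = F0 l.
    by move=> lN; apply: mv_stable => // u; move/borelP: bB; apply.
  split; first exact: bu.
    exact: (eq_instrat (full_flag_act bu ff0) bF sF0).
  by move=> l /andP[_ lN]; apply: bF.
have [|hu sF FE] := IH (pi_ i c b) (ltnW iN); first by exists c, b.
have iN' : (0 < i.+1 <= N)%N by [].
have zgp := Ez_levelgp iN' (lv iN') (c i.+1).
have FE' : agree i.+1 (act (pi_ i c b) F0) by move=> l il; apply: FE; lia.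
have [sy ay] := levelgp_act iN' zgp sF FE'.
by split; rewrite /= ?actM // unitmx_GL //; case: zgp.
Qed.

Lemma fr_pi X (P : (X -> k) -> Prop) i (c : X -> nat -> nat -> k) (b : X -> gl) :
  funring P -> (forall a l, P (fun x => c x a l)) -> fr_mx P b ->
  fr_mx P (fun x => pi_ i (c x) (b x)).
Proof.
move=> rP Pc Pb; elim: i => //= i IH; apply: (fr_mx_mul rP) IH.
apply: (fr_mx_add rP); first exact: (fr_mx_const rP).
rewrite /fmat; apply: (fr_mx_sum rP) => a; apply: (fr_mx_mul rP); last exact: (fr_mx_const rP).
apply: (fr_mx_mul rP); first exact: (fr_mx_const rP).
apply: (fr_mx_sum rP) => l; apply: (fr_mx_scale rP); first exact: Pc.
exact: (fr_mx_const rP).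
Qed.

Definition stratum : set {vspace gl} := [set b | exists2 F, instrat F & b = borel F].

Lemma stratum_preim h : h \in unitmx -> stratum (borel (act h F0)) <-> Xi N h.
Proof.
move=> hu; split=> [[F sF E]|[_ sF _]]; last by exists (act h F0).
have FE := borel_inj (full_flag_act hu ff0) sF.1 E.
have agN : agree N (act h F0).
  move=> l lN; have -> : l = N by lia.
  by rewrite (flag_top ff0) (flag_top (full_flag_act hu ff0)).
by split=> //; apply: (eq_instrat (full_flag_act hu ff0) FE sF).
Qed.

Lemma stratum_irreducible_level : irreducible (@zclosed_flag k N) stratum.
Proof.
split; first by exists (borel F0), F0.
move=> Z1 Z2 c1 c2 sub; apply: contrapT => /not_orP[n1 n2].
have [I1 [p1 z1]] := zclosed_preim ff0 c1; have [I2 [p2 z2]] := zclosed_preim ff0 c2.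
have get Z (I : set (gl -> k)) : (forall f, I f -> polymx f) ->
    (forall h, h \in unitmx -> Z (borel (act h F0)) <-> forall f, I f -> f h = 0) ->
    ~ (stratum `<=` Z) -> exists f y, [/\ I f, inY N y & f y != 0].
  move=> pI zI nZ; apply: contrapT => H; apply: nZ => _ [F sF ->].
  have [h hu hE] := flag_conj ff0 sF.1.
  have E : borel F = borel (act h F0) by apply: eq_borel.
  rewrite E; apply/zI => // f If; apply: (inY_dense (leqnn N) (pI f If)).
    move=> y Yy; apply/eqP; rewrite -[_ == _]negbK; apply/negP => fy.
    by apply: H; exists f, y.
  by apply/stratum_preim => //; rewrite -E; exists F.
have [f1 [y1 [If1 Y1 f1y]]] := get Z1 I1 p1 z1 n1.
have [f2 [y2 [If2 Y2 f2y]]] := get Z2 I2 p2 z2 n2.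
have [C1 [b1 [b1u b1B y1E]]] := Y1; have [C2 [b2 [b2u b2B y2E]]] := Y2.
have rt := funring_polyt k.
pose ct t a l := C1 a l + t * (C2 a l - C1 a l).
pose bt t := b1 + t *: (b2 - b1).
pose ga t := pi_ N (ct t) (bt t).
have pbt : fr_mx (@polyt k) bt.
  apply: (fr_mx_add rt); first exact: (fr_mx_const rt).
  by apply: (fr_mx_scale rt); [exact: polyt_id | exact: (fr_mx_const rt)].
have pga : fr_mx (@polyt k) ga.
  by apply: (fr_pi N rt) => // a l; apply: polyt_line.
have ga0 : ga 0 = y1.
  rewrite y1E /ga /bt scale0r addr0; apply: pi_ext => l _; apply: funext => m.
  by rewrite /ct mul0r addr0.
have ga1 : ga 1 = y2.
  rewrite y2E /ga /bt scale1r addrC subrK; apply: pi_ext => l _; apply: funext => m.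
  by rewrite /ct mul1r addrC subrK.
have q1 := polymx_comp rt (p1 f1 If1) pga.
have q2 := polymx_comp rt (p2 f2 If2) pga.
have qd := fr_det rt pbt.
have H t : \det (bt t) * (f1 (ga t) * f2 (ga t)) = 0.
  have [->|dn] := eqVneq (\det (bt t)) 0; first by rewrite mul0r.
  have btu : bt t \in unitmx by rewrite unitmxE unitfE.
  have Yt : inY N (ga t).
    by exists (ct t), (bt t); split=> //; rewrite memvD ?memvZ ?memvB.
  have [gu sg ag] := inY_Xi (leqnn N) Yt.
  have [|z|z] := sub (borel (act (ga t) F0)); first by apply/stratum_preim.
    by rewrite (proj1 (z1 _ gu) z f1 If1) mul0r mulr0.
  by rewrite (proj1 (z2 _ gu) z f2 If2) !mulr0.
have [|/(_ 0) d0|/(polyt_domain q1 q2)[/(_ 0)|/(_ 1)]] := polyt_domain qd (fr_mul rt q1 q2).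
- exact: H.
- by move: b1u; rewrite unitmxE unitfE -[b1]addr0 -(scale0r (b2 - b1)) -/(bt 0) d0 eqxx.
- by rewrite ga0 => E; rewrite E eqxx in f1y.
- by rewrite ga1 => E; rewrite E eqxx in f2y.
Qed.

End Levels.

Lemma levels_exist : exists (j s : nat -> nat) (v : nat -> kN) (th : nat -> nat -> 'rV[k]_N),
  forall i, (0 < i <= N)%N -> level i (j i) (v i) (s i) (th i).
Proof.
have /choice[d dP] : forall i, exists d : nat * nat * kN * (nat -> 'rV[k]_N),
    (0 < i <= N)%N -> level i d.1.1.1 d.1.2 d.1.1.2 d.2.
  move=> i; case: (boolP (0 < i <= N)%N) => iN; last by exists (0%N, 0%N, 0, fun=> 0).
  by have [j [v [s [th H]]]] := level_exists iN; exists (j, s, v, th).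
exists (fun i => (d i).1.1.1), (fun i => (d i).1.1.2), (fun i => (d i).1.2), (fun i => (d i).2).
exact: dP.
Qed.

Lemma stratum_irreducible : irreducible (@zclosed_flag k N) stratum.
Proof.
have [j [s [v [th lv]]]] := levels_exist; exact: stratum_irreducible_level lv.
Qed.

End Tower.

(** * Closure relations between strata *)

Section Dependence.
Variables (k : closedFieldType) (M : nat).

Lemma msize_prod_le I (r : seq I) (p : I -> {mpoly k[M]}) (a : I -> nat) S :
  (forall i, (msize (p i) <= S.+1)%N) ->
  (msize (\prod_(i <- r) p i ^+ a i) <= (\sum_(i <- r) a i * S).+1)%N.
Proof.
move=> pS; have mulS (q1 q2 : {mpoly k[M]}) n1 n2 :
    (msize q1 <= n1.+1)%N -> (msize q2 <= n2.+1)%N -> (msize (q1 * q2) <= (n1 + n2).+1)%N.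
  move=> h1 h2; have [->|q10] := eqVneq q1 0; first by rewrite mul0r msize0.
  have [->|q20] := eqVneq q2 0; first by rewrite mulr0 msize0.
  rewrite msizeM // -subn1 leq_subLR; apply: leq_trans (leq_add h1 h2) _; lia.
elim: r => [|i r IH]; first by rewrite !big_nil msize1.
rewrite !big_cons; apply: (mulS) IH; elim: (a i) => [|n IHn]; first by rewrite expr0 msize1.
by rewrite exprS mulSn; apply: (mulS).
Qed.

(* There are more products of powers < D than monomials of the degrees that occur, for D large. *)
Lemma mpoly_dependent (q : 'I_M.+1 -> {mpoly k[M]}) :
  exists D (c : {ffun 'I_M.+1 -> 'I_D} -> k), (exists a, c a != 0) /\
    forall v, \sum_a c a * \prod_i (q i).@[v] ^+ a i = 0.
Proof.
pose S := (\max_i msize (q i))%N.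
have qS i : (msize (q i) <= S.+1)%N by apply: leqW; apply: (@leq_bigmax _ (fun i => msize (q i))).
pose B := (M.+1 * S).+1; pose D := (B ^ M).+1; pose K := (D * M.+1 * S).+1.
pose mon (m : {ffun 'I_M -> 'I_K}) : 'X_{1..M} := [multinom nat_of_ord (m j) | j < M].
pose P (a : {ffun 'I_M.+1 -> 'I_D}) := \prod_i q i ^+ a i.
have Pm a : (msize (P a) <= K)%N.
  apply: leq_trans (msize_prod_le _ _ qS) _; rewrite ltnS.
  rewrite -big_distrl /= leq_mul2r; apply/orP; right.
  apply: leq_trans (_ : \sum_(i < M.+1) D <= _)%N.
    by apply: leq_sum => i _; apply: ltnW.
  by rewrite sum_nat_const card_ord mulnC.
pose Mx := \matrix_(i < #|{ffun 'I_M.+1 -> 'I_D}|, j < #|{ffun 'I_M -> 'I_K}|)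
  (P (enum_val i))@_(mon (enum_val j)).
have rc : (#|{ffun 'I_M -> 'I_K}| < #|{ffun 'I_M.+1 -> 'I_D}|)%N.
  rewrite !card_ffun !card_ord expnS.
  have KB : (K <= D * B)%N by rewrite /K /B -mulnA [X in (_ <= X)%N]mulnS addnC -addn1 leq_add2l.
  have KM : (K ^ M <= (D * B) ^ M)%N by elim: (M) => // m IHm; rewrite !expnS leq_mul.
  by apply: leq_ltn_trans KM _; rewrite expnMn mulnC ltn_pmul2r // expn_gt0.
have : kermx Mx != 0.
  rewrite kermx_eq0 /row_free; apply: contraTN rc => /eqP <-.
  by rewrite -leqNgt rank_leq_col.
case/rowV0Pn => u /sub_kermxP uM u0.
exists D, (fun a => u 0 (enum_rank a)); split.
  have [i ui] : exists i, u 0 i != 0.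
    by apply/existsP; apply: contraNT u0 => /existsPn H; apply/eqP/rowP => i; rewrite mxE; apply/eqP; rewrite -[_ == _]negbK H.
  by exists (enum_val i); rewrite enum_valK.
have Z : \sum_a u 0 (enum_rank a) *: P a = 0.
  apply/mpolyP => m; rewrite mcoeff0 raddf_sum /=.
  case: (leqP K (mdeg m)) => mK.
    rewrite big1 // => a _; rewrite mcoeffZ memN_msupp_eq0 ?mulr0 //.
    by apply: msize_mdeg_ge; apply: leq_trans mK.
  have mj j : (m j < K)%N.
    by apply: leq_ltn_trans mK; rewrite mdegE (bigD1 j) //= leq_addr.
  pose f := [ffun j => Ordinal (mj j)].
  have mE : m = mon f by apply/mnmP => j; rewrite mnmE ffunE.
  have := congr1 (fun X : 'rV_ _ => X 0 (enum_rank f)) uM; rewrite !mxE => E.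
  rewrite -[RHS]E; apply/esym.
  rewrite (reindex (@enum_rank {ffun 'I_M.+1 -> 'I_D})) /=; last first.
    by apply: onW_bij; apply: enum_rank_bij.
  by apply: eq_bigr => a _; rewrite mcoeffZ mxE !enum_rankK mE.
move=> v; have := congr1 (meval v) Z; rewrite raddf_sum meval0 => E.
rewrite -[RHS]E; apply: eq_bigr => a _; rewrite /= mevalZ /P rmorph_prod /=.
by congr (_ * _); apply: eq_bigr => i _; rewrite rmorphXn.
Qed.

End Dependence.

Lemma digits_lt n D (a : nat -> nat) : (forall i, (i < n)%N -> (a i < D)%N) ->
  (\sum_(i < n) a i * D ^ i < D ^ n)%N.
Proof.
elim: n => [|n IH] aD; first by rewrite big_ord0.
rewrite big_ord_recr /= expnS.
have h1 := IH (fun i h => aD i (ltnW h)); have h2 := aD n (ltnSn n).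
apply: leq_trans (_ : (a n).+1 * D ^ n <= _)%N; last by rewrite leq_mul2r h2 orbT.
by rewrite mulSn -addSn leq_add2r.
Qed.

Lemma digits_inj n D (a b : nat -> nat) :
    (forall i, (i < n)%N -> (a i < D)%N) -> (forall i, (i < n)%N -> (b i < D)%N) ->
    (\sum_(i < n) a i * D ^ i = \sum_(i < n) b i * D ^ i)%N ->
  forall i, (i < n)%N -> a i = b i.
Proof.
elim: n => // n IH aD bD; rewrite !big_ord_recr /= => E i.
have la := digits_lt (fun i h => aD i (ltnW h)); have lb := digits_lt (fun i h => bD i (ltnW h)).
have D0 : (0 < D ^ n)%N by apply: leq_ltn_trans la.
have E1 : a n = b n.
  have := congr1 (fun x => x %/ D ^ n)%N E.
  by rewrite !divnDMl // !divn_small.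
rewrite ltnS leq_eqVlt => /orP[/eqP -> //|lt]; apply: IH lt.
- by move=> m h; apply: aD; apply: ltnW.
- by move=> m h; apply: bD; apply: ltnW.
- by move: E; rewrite E1 => /addIn.
Qed.

Section Compare.
Variables (k : closedFieldType) (N M : nat).
Notation gl := 'M[k]_N.

(* If all polynomials vanishing on the image of P vanish on T, and if T carries M
   independent functions, then T is dense in the image: a relation between the p_i
   and a polynomial f vanishing on T, divided by a power of f, restricts to a
   relation between the p_i on T.  Independence is tested on curves along which
   p_i vanishes to order exactly w_i, with weights making all monomials distinct. *)
Lemma dimension_compare (P : ('I_M -> k) -> gl) (f del : gl -> k)
    (p : 'I_M -> gl -> k) (T : gl -> Prop) :
    fr_mx (@polyv k M) P -> polymx f -> polymx del -> (forall i, polymx (p i)) ->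
    (forall g, polymx g -> (forall x, del (P x) * g (P x) = 0) -> forall y, T y -> g y = 0) ->
    (forall y, T y -> f y = 0) ->
    (forall W (w : nat -> nat), (forall q : 'I_M, (W <= w q < 2 * W)%N) ->
      exists (ga : k -> gl) (d : k -> k), [/\ fr_mx (@polyt k) ga, polyt d, d 0 != 0,
        forall t, d t != 0 -> T (ga t) &
        forall q : 'I_M, exists R, polyt R /\
          forall t, p q (ga t) = t ^+ w q + t ^+ (2 * W) * R t]) ->
  forall x, del (P x) * f (P x) = 0.
Proof.
move=> pP pf pd pp TS fT L x0; apply/eqP; rewrite -[_ == _]negbK; apply/negP => nz.
have rv := @funring_polyv k M; have rt := funring_polyt k; have rx := @funring_polymx k N.
have pv g : polymx g -> polyv (fun x => g (P x)) by move=> pg; apply: (polymx_comp rv pg).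
pose fn (i : 'I_M.+1) : gl -> k := if insub (nat_of_ord i) is Some o then p o else f.
have fnw o : fn (widen_ord (leqnSn M) o) = p o by rewrite /fn /= valK.
have fnm : fn ord_max = f by rewrite /fn insubF //= ltnn.
have pfn i : polymx (fn i) by rewrite /fn; case: insubP.
have /choice[q qE] : forall i, exists q : {mpoly k[M]}, forall v, fn i (P v) = q.@[v].
  by move=> i; have [q qE] := pv _ (pfn i); exists q.
have [D [c [[a0 ca0] rel]]] := mpoly_dependent q.
pose mn (a : {ffun 'I_M.+1 -> 'I_D}) y := \prod_(i < M) p i y ^+ a (widen_ord (leqnSn M) i).
have {}rel v : \sum_a c a * (mn a (P v) * f (P v) ^+ a ord_max) = 0.
  rewrite -[RHS](rel v); apply: eq_bigr => a _; rewrite big_ord_recr /= -qE fnm.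
  by congr (_ * (_ * _)); apply: eq_bigr => i _; rewrite -qE fnw.
pose Q d := [exists a : {ffun 'I_M.+1 -> 'I_D}, (c a != 0) && (a ord_max == d :> nat)].
have exQ : exists d, Q d by exists (a0 ord_max); apply/existsP; exists a0; rewrite ca0 eqxx.
case: (ex_minnP exQ) => d0 /existsP[a1 /andP[ca1 /eqP a1d]] dmin.
have cmin a : c a != 0 -> (d0 <= a ord_max)%N.
  by move=> ca; apply: dmin; apply/existsP; exists a; rewrite ca eqxx.
pose G y := \sum_a c a * (mn a y * f y ^+ (a ord_max - d0)).
have pmn a : polymx (mn a) by apply: (fr_prod rx) => i; apply: (fr_exp rx).
have pG : polymx G.
  apply: (fr_sum rx) => a; apply: (fr_mul rx); first exact: (fr_const rx).
  by apply: (fr_mul rx) => //; apply: (fr_exp rx).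
have fG v : f (P v) ^+ d0 * G (P v) = 0.
  rewrite -[RHS](rel v) /G mulr_sumr; apply: eq_bigr => a _.
  have [->|ca] := eqVneq (c a) 0; first by rewrite !mul0r mulr0.
  by rewrite mulrCA; congr (_ * _); rewrite mulrCA -exprD subnKC // cmin.
have GP v : G (P v) = 0.
  have [] := polyv_domain (fr_exp rv d0 (pv f pf)) (pv G pG) fG; last by [].
  move/(_ x0)/eqP; rewrite expf_eq0 => /andP[_ /eqP f0].
  by rewrite f0 mulr0 eqxx in nz.
have GT := TS G pG (fun v => ltac:(by rewrite GP mulr0)).
have D0 : (0 < D)%N by apply: leq_ltn_trans (ltn_ord (a0 ord_max)).
pose W := (D ^ M).+1; pose w q := (W + D ^ q)%N.
have wW (i : 'I_M) : (W <= w i < 2 * W)%N.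
  rewrite leq_addr mul2n -addnn ltn_add2l ltnS /=; apply: leq_pexp2l => //.
  exact: ltnW.
have [ga [d [pga pdd dn0 Tga /choice[R RP]]]] := L W w wW.
pose ex (a : {ffun 'I_M.+1 -> 'I_D}) := (\sum_(i < M) w i * a (widen_ord (leqnSn M) i))%N.
pose dig (a : {ffun 'I_M.+1 -> 'I_D}) i := if insub i is Some o then a (widen_ord (leqnSn M) o) : nat else 0%N.
have digD a i : (dig a i < D)%N by rewrite /dig; case: insubP.
have digE a (i : 'I_M) : dig a i = a (widen_ord (leqnSn M) i) by rewrite /dig valK.
have exE a : ex a = (W * (\sum_(i < M) dig a i) + \sum_(i < M) dig a i * D ^ i)%N.
  rewrite big_distrr -big_split /=; apply: eq_bigr => i _.
  by rewrite digE /w mulnDl [(D ^ i * _)%N]mulnC.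
have ex_inj a b : ex a = ex b -> forall i, a (widen_ord (leqnSn M) i) = b (widen_ord (leqnSn M) i).
  rewrite !exE => E i; apply: val_inj; rewrite /= -!digE.
  apply: (@digits_inj M D (dig a) (dig b)) => //.
  have lt z : (\sum_(i < M) dig z i * D ^ i < W)%N by apply: ltnW; rewrite ltnS; apply: digits_lt.
  by have := congr1 (fun x => x %% W)%N E; rewrite ![(W * _)%N]mulnC !modnMDl !modn_small.
pose c' a := c a * (a ord_max - d0 == 0)%N%:R.
have c'1 : c' a1 != 0 by rewrite /c' a1d subnn eqxx mulr1.
have c'max a : c' a != 0 -> nat_of_ord (a ord_max) = d0.
  rewrite mulf_eq0 negb_or => /andP[/cmin le].
  case: (eqVneq (a ord_max - d0)%N 0%N) => [E _|_]; last by rewrite eqxx.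
  by apply/eqP; rewrite eqn_leq le -subn_eq0 E.
pose U (a : {ffun 'I_M.+1 -> 'I_D}) t := \prod_(i < M) (1 + t ^+ (2 * W - w i) * R i t) ^+ a (widen_ord (leqnSn M) i).
have pU a : polyt (U a).
  apply: (fr_prod rt) => i; apply: (fr_exp rt); apply: (fr_add rt); first exact: (fr_const rt).
  by apply: (fr_mul rt); [apply: (fr_exp rt); exact: polyt_id | case: (RP i)].
have U0 a : U a 0 = 1.
  rewrite /U big1 // => i _; rewrite expr0n; have := wW i; case: eqP => [|_ _]; first lia.
  by rewrite mul0r addr0 expr1n.
have mnU a t : mn a (ga t) = t ^+ ex a * U a t.
  rewrite /mn /U /ex; rewrite (big_morph (fun n => t ^+ n) (exprD t) (expr0 t)) -big_split /=.
  apply: eq_bigr => i _; have [_ ->] := RP i.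
  have -> : t ^+ w i + t ^+ (2 * W) * R i t = t ^+ w i * (1 + t ^+ (2 * W - w i) * R i t).
    by rewrite mulrDr mulr1 mulrA -exprD subnKC //; have := wW i; lia.
  by rewrite exprMn exprM.
have Z t : d t != 0 -> \sum_a c' a * (t ^+ ex a * U a t) = 0.
  move=> dt; rewrite -[RHS](GT _ (Tga t dt)); apply: eq_bigr => a _.
  by rewrite -mnU fT ?expr0n; [rewrite mulrAC -mulrA | exact: Tga].
case: (@arg_minnP _ a1 (fun a => c' a != 0) ex c'1) => a2 c'2 amin.
pose H t := \sum_a c' a * (t ^+ (ex a - ex a2) * U a t).
have pH : polyt H.
  apply: (fr_sum rt) => a; apply: (fr_mul rt); first exact: (fr_const rt).
  by apply: (fr_mul rt) => //; apply: (fr_exp rt); exact: polyt_id.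
have HZ t : t ^+ ex a2 * H t = \sum_a c' a * (t ^+ ex a * U a t).
  rewrite /H mulr_sumr; apply: eq_bigr => a _.
  have [->|ca] := eqVneq (c' a) 0; first by rewrite !mul0r mulr0.
  by rewrite mulrCA; congr (_ * _); rewrite mulrA -exprD subnKC // amin.
have dH t : d t * (t ^+ ex a2 * H t) = 0.
  by rewrite HZ; have [->|/Z ->] := eqVneq (d t) 0; rewrite ?mul0r ?mulr0.
have ptH : polyt (fun t => t ^+ ex a2 * H t).
  by apply: (fr_mul rt) => //; apply: (fr_exp rt); exact: polyt_id.
have [/(_ 0)/eqP|tH0] := polyt_domain pdd ptH dH; first by rewrite (negPf dn0).
have [/(_ 1)/eqP|H0] := polyt_domain (fr_exp rt _ (polyt_id k)) pH tH0.
  by rewrite expr1n oner_eq0.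
move: (H0 0); rewrite /H (bigD1 a2) //= subnn expr0 mul1r U0 mulr1 big1 ?addr0.
  by move/eqP; rewrite (negPf c'2).
move=> a ne; have [->|ca] := eqVneq (c' a) 0; first by rewrite mul0r.
have lt : (ex a2 < ex a)%N.
  rewrite ltn_neqAle amin // andbT; apply: contraNneq ne => E.
  apply/eqP/ffunP => i; case: (unliftP ord_max i) => [i' ->|->].
    have -> : lift ord_max i' = widen_ord (leqnSn M) i' by apply: val_inj; exact: lift_max.
    exact: ex_inj.
  by apply: val_inj; rewrite /= !c'max.
by rewrite expr0n; case: eqP => [|_]; [lia | rewrite mul0r mulr0].
Qed.

End Compare.

Lemma second_order (k : closedFieldType) N (p : k) (B S R : 'M[k]_N) :
  (1 + p *: B) *m (1 + p *: S + p * p *: R) =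
  1 + (p *: S + p *: B) + p * p *: (B *m S + (1 + p *: B) *m R).
Proof.
rewrite mulmxDr -scalemxAr scalerDr addrA; congr (_ + _).
by rewrite mulmxDl mul1mx mulmxDr mulmx1 -!scalemxAl -scalemxAr scalerA !addrA.
Qed.

Section PlainStrata.
Variables (k : closedFieldType) (N : nat) (e : 'M[k]_N).
Notation gl := 'M[k]_N.
Notation kN := 'cV[k]_N.
Hypothesis eN : e ^+ N = 0.

Definition zflag (_ : nat) : {vspace kN} := 0%VS.
Notation A0 := zflag.

Lemma A0_stab l : (0 < l <= N)%N -> stab e (A0 l). Proof. by move=> _; apply: stab0. Qed.
Lemma A0_top i : (0 < i <= N)%N -> A0 (\dim (A0 i)).+1 = A0 i. Proof. by []. Qed.
Lemma A0_eq l i : (0 < l <= i)%N -> (i <= N)%N -> (\dim (A0 i) < l)%N -> A0 l = A0 i.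
Proof. by []. Qed.

Lemma dim_borel_act g (F : nat -> {vspace kN}) : g \in unitmx ->
  \dim (borel (act g F)) = \dim (borel F).
Proof.
have le g' (G : nat -> {vspace kN}) : g' \in unitmx ->
    (\dim (borel (act g' G)) <= \dim (borel G))%N.
  move=> gu; rewrite -AdV_borel // /AdV.
  by rewrite -(limg_ker_dim (linfun (Ad g')) (borel G)) leq_addl.
move=> gu; apply/eqP; rewrite eqn_leq le //=.
have := le (invmx g) (act g F); rewrite unitmx_inv -actM mulVmx // act1; exact.
Qed.

Section OneFlag.
Variable F0 : nat -> {vspace kN}.
Hypothesis sF0 : instrat e A0 F0 F0.
Variables (j s : nat -> nat) (v : nat -> kN) (th : nat -> nat -> 'rV[k]_N).
Hypothesis lv : forall i, (0 < i <= N)%N -> level e A0 F0 i (j i) (v i) (s i) (th i).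

Let ff := sF0.1.
Notation db := (\dim (borel F0)).

Definition off i := (db + \sum_(m < i) s m.+1)%N.

Lemma offS i : off i.+1 = (off i + s i.+1)%N.
Proof. by rewrite /off big_ord_recr /= addnA. Qed.

Lemma off_mono i i' : (i <= i')%N -> (off i <= off i')%N.
Proof. by move=> /subnK <-; elim: (_ - _)%N => // d IH; rewrite addSn offS (leq_trans IH) ?leq_addr. Qed.

Definition cx (x : nat -> k) i l := x (off i.-1 + l)%N.

Lemma Ez_sum i (c : nat -> k) : Ez e (v i) (j i) (s i) (th i) c =
  1 + \sum_(l < s i) c l *: fmat e (v i) (th i l) (j i).
Proof. by rewrite /Ez fmat_sum; congr (_ + _); apply: eq_bigr => l _; rewrite fmatZ. Qed.

Lemma pi_eq i c c' b : (forall m l, (0 < m <= i)%N -> (l < s m)%N -> c m l = c' m l) ->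
  pi_ e j s v th i c b = pi_ e j s v th i c' b.
Proof.
elim: i => //= i IH E; rewrite !Ez_sum IH => [|m l /andP[m0 mi] ls].
  by congr (_ *m _); congr (_ + _); apply: eq_bigr => l _; rewrite E ?leqnn.
by apply: E; rewrite ?m0 ?leqW.
Qed.

Definition bx (x : nat -> k) : gl := \sum_(q < db) x q *: (vbasis (borel F0))`_q.

Lemma encode (c : nat -> nat -> k) b i : b \in borel F0 -> exists x : nat -> k,
  b = bx x /\ forall m l, (0 < m <= i)%N -> (l < s m)%N -> cx x m l = c m l.
Proof.
move=> bB; elim: i => [|i [x [xb xc]]].
  exists (fun q => if insub q is Some o then coord (vbasis (borel F0)) o b else 0).
  split; last by case.
  by rewrite /bx {1}(coord_vbasis bB); apply: eq_bigr => q _; rewrite valK.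
exists (fun q => if (off i <= q)%N then c i.+1 (q - off i)%N else x q); split.
  rewrite xb; apply: eq_bigr => q _.
  by rewrite leqNgt (leq_trans (ltn_ord q) (leq_addr _ _)).
move=> m l /andP[m0 mi] ls; rewrite /cx; case: (ltnP i m) => im.
  have -> : m = i.+1 by apply/eqP; rewrite eqn_leq mi.
  by rewrite /= leq_addr addKn.
rewrite leqNgt (_ : (_ < _)%N) /=; first by apply: xc; rewrite ?m0.
apply: leq_trans (off_mono im); case: m m0 mi ls im => // m _ _ ls _.
by rewrite offS /= ltn_add2l.
Qed.

Definition param (x : nat -> k) : gl := pi_ e j s v th N (cx x) (bx x).

Lemma param_surj y : inY e F0 j s v th N y -> exists x, y = param x.
Proof.
case=> c [b [_ bB ->]]; have [x [-> xc]] := encode c N bB.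
by exists x; rewrite /param; apply: pi_eq => m l mN ls; rewrite xc.
Qed.

Lemma param_eq x x' : (forall q, (q < off N)%N -> x q = x' q) -> param x = param x'.
Proof.
move=> E; rewrite /param (_ : bx x = bx x').
  apply: pi_eq => m l /andP[m0 mN] ls; rewrite /cx E //.
  apply: leq_trans (off_mono mN); case: m m0 mN ls => // m _ _ ls.
  by rewrite offS /= ltn_add2l.
apply: eq_bigr => q _; rewrite E //.
by apply: leq_trans (ltn_ord q) (leq_addr _ _).
Qed.

Fixpoint tangents i : seq gl :=
  if i is i'.+1 then tangents i' ++ mkseq (fun l => fmat e (v i) (th i l) (j i)) (s i)
  else vbasis (borel F0).

Lemma size_tangents i : size (tangents i) = off i.
Proof.
elim: i => [|i IH]; first by rewrite size_tuple /off big_ord0 addn0.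
by rewrite size_cat IH size_mkseq offS.
Qed.

Lemma tangents_stab i y : (i < N)%N -> y \in <<tangents i>>%VS -> stab y (F0 i).
Proof.
move=> iN yG u uF.
pose st (m : nat) := flag_stab 0 (fun=> F0 m).
have stP m z : reflect (stab z (F0 m)) (z \in st m).
  by apply: (iffP (flag_stabP _ _ _)) => [H|H] //; apply: (H 0%N).
suff /subvP/(_ y yG)/stP : (<<tangents i>> <= st i)%VS by apply.
have fin m l z : (0 < m <= N)%N -> (l < s m)%N -> fmat e (v m) (th m l) (j m) *m z \in F0 m.
  move=> mN ls; apply: fmat_in; first by apply: (instrat_stab sF0); case/andP: mN.
  by have := lv_v (lv mN); rewrite mem_qker => /andP[].
suff H m : (m <= i)%N -> (<<tangents m>> <= st i)%VS by exact: H.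
elim: m => [|m IH] mi /=.
  apply/span_subvP => z /vbasis_mem/borelP zB; apply/stP => w; apply: zB; exact: ltnW.
rewrite span_cat subv_add IH 1?ltnW //=; apply/span_subvP => z /mapP[l].
rewrite mem_iota add0n => /andP[_ ls] ->; apply/stP => w _.
apply: (subvP (flag_mono ff _)); last by apply: (fin m.+1) => //; lia.
by rewrite mi ltnW.
Qed.

Lemma tangents_free i : (i <= N)%N -> free (tangents i).
Proof.
elim: i => [|i IH] iN; first exact: (basis_free (vbasisP _)).
have iN' : (0 < i.+1 <= N)%N by [].
have lvi := lv iN'; rewrite /= cat_free IH 1?ltnW //=.
have [phi [phiF phiv]] := sep_form (lv_vH lvi).
have vU : v i.+1 \in F0 i.+1 by have := lv_v lvi; rewrite mem_qker => /andP[].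
have sU : stab e (F0 i.+1) by apply: (instrat_stab sF0).
have sH : stab e (F0 i) by apply: (instrat_stab sF0); apply: ltnW.
have HU : (F0 i <= F0 i.+1)%VS by apply: (flagS ff).
have dU : \dim (F0 i.+1) = (\dim (F0 i)).+1 by rewrite !(flag_dim ff) // ltnW.
have key (c : nat -> k) : \sum_(l < s i.+1) c l *: fmat e (v i.+1) (th i.+1 l) (j i.+1)
      \in <<tangents i>>%VS -> forall l, (l < s i.+1)%N -> c l = 0.
  move=> yG; apply: (lv_free lvi) => u uU.
  set Th := \sum_(l < _) _.
  have fE : \sum_(l < s i.+1) c l *: fmat e (v i.+1) (th i.+1 l) (j i.+1) =
      fmat e (v i.+1) Th (j i.+1).
    by rewrite /Th fmat_sum; apply: eq_bigr => l _; rewrite fmatZ.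
  have onH w : w \in F0 i -> (Th *m (e ^+ (j i.+1).-1 *m w)) 0 0 = 0.
    move=> wF; have := phiF _ (tangents_stab iN yG wF); rewrite fE.
    rewrite (fmat_form _ sU vU (lv_j lvi)) ?phiv ?mulr1 // => z zU.
    apply: phiF; exact: (nilp_hyper eN sH sU HU dU zU).
  have [a aH] := hyper_dec HU dU vU (lv_vH lvi) uU.
  have := onH _ aH; rewrite mulmxBr formB -scalemxAr formZ.
  rewrite [X in _ - a * X](_ : _ = 0) ?mulr0 ?subr0 // mulmx_suml summxE big1 // => l _.
  by rewrite -scalemxAl mxE (lv_thv lvi) mulr0.
have szs : size (mkseq (fun l => fmat e (v i.+1) (th i.+1 l) (j i.+1)) (s i.+1)) = s i.+1.
  by rewrite size_mkseq.
have sumE (c : nat -> k) : \sum_(l < s i.+1) c l *: fmat e (v i.+1) (th i.+1 l) (j i.+1) =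
    \sum_(l < s i.+1) c l *: (mkseq (fun l => fmat e (v i.+1) (th i.+1 l) (j i.+1)) (s i.+1))`_l.
  by apply: eq_bigr => l _; rewrite nth_mkseq.
set Y := mkseq _ _ in szs sumE *.
have fY : free Y.
  have /freeP H : forall c, \sum_(l < size Y) c l *: (in_tuple Y)`_l = 0 -> forall l, c l = 0.
    move=> c Z l; pose c' m := if insub m is Some o then c o else 0.
    have c'E (m : 'I_(size Y)) : c' m = c m by rewrite /c' valK.
    rewrite -c'E; apply: (key c'); last by rewrite -szs.
    rewrite (sumE c') -szs (_ : \sum_(_ < _) _ = 0) ?mem0v // -[RHS]Z.
    by apply: eq_bigr => m _; rewrite c'E.
  exact: H.
rewrite fY /=; apply/directv_addP/eqP; rewrite -subv0; apply/subvP => z.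
rewrite memv_cap memv0 => /andP[zG zY].
pose cc l := coord (in_tuple Y) l z.
pose c' m := if insub m is Some o then cc o else 0.
have zE : z = \sum_(l < s i.+1) c' l *: Y`_l.
  rewrite [LHS](@coord_span _ _ _ (in_tuple Y) _ zY) -szs.
  by apply: eq_bigr => l _; rewrite /c' valK.
move: zG; rewrite {1}zE -(sumE c') => /key K.
by rewrite zE; apply/eqP; rewrite big1 // => l _; rewrite K ?scale0r.
Qed.

Lemma tangents_curve W (w : nat -> nat) i :
    (i <= N)%N -> (forall q, (q < off N)%N -> (W <= w q < 2 * W)%N) ->
  exists R : k -> gl, fr_mx (@polyt k) R /\ forall t,
    pi_ e j s v th i (cx (fun q => t ^+ w q)) (1 + bx (fun q => t ^+ w q)) =
    1 + \sum_(0 <= q < off i) t ^+ w q *: (tangents i)`_q + t ^+ (2 * W) *: R t.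
Proof.
move=> + wW; have rt := funring_polyt k.
have ptn a : polyt (fun t : k => t ^+ a) by apply: (fr_exp rt); exact: polyt_id.
elim: i => [|i IH] iN.
  exists (fun=> 0); split; first exact: (fr_mx_const rt).
  move=> t; rewrite scaler0 addr0 /= /bx /off big_ord0 addn0; congr (_ + _).
  by rewrite big_mkord.
have [R [pR RE]] := IH (ltnW iN).
pose fi l := fmat e (v i.+1) (th i.+1 l) (j i.+1).
pose al t := \sum_(0 <= l < s i.+1) t ^+ (w (off i + l)%N - W) *: fi l.
pose S t := \sum_(0 <= q < off i) t ^+ (w q - W) *: (tangents i)`_q.
have lts l : (l < s i.+1)%N -> (off i + l < off N)%N.
  by move=> ls; apply: leq_trans (off_mono iN); rewrite offS ltn_add2l.
have alE t : \sum_(0 <= l < s i.+1) t ^+ w (off i + l)%N *: fi l = t ^+ W *: al t.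
  rewrite scaler_sumr; apply: eq_big_nat => l /andP[_ ls].
  by rewrite scalerA -exprD subnKC //; case/andP: (wW _ (lts l ls)).
have SE t : \sum_(0 <= q < off i) t ^+ w q *: (tangents i)`_q = t ^+ W *: S t.
  rewrite scaler_sumr; apply: eq_big_nat => q /andP[_ qo].
  by rewrite scalerA -exprD subnKC //; case/andP: (wW _ (leq_trans qo (off_mono (ltnW iN)))).
have pal : fr_mx (@polyt k) al.
  by apply: (fr_mx_sum rt) => l; apply: (fr_mx_scale rt) => //; exact: (fr_mx_const rt).
have pS : fr_mx (@polyt k) S.
  by apply: (fr_mx_sum rt) => l; apply: (fr_mx_scale rt) => //; exact: (fr_mx_const rt).
exists (fun t => al t *m S t + (1 + t ^+ W *: al t) *m R t); split.
  apply: (fr_mx_add rt); apply: (fr_mx_mul rt) => //.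
  apply: (fr_mx_add rt); first exact: (fr_mx_const rt).
  exact: (fr_mx_scale rt).
move=> t; rewrite /= RE Ez_sum -(big_mkord xpredT (fun l => cx (fun q => t ^+ w q) i.+1 l *: fi l)).
rewrite {1}/cx /= alE SE.
have -> : \sum_(0 <= q < off i.+1) t ^+ w q *: (tangents i.+1)`_q = t ^+ W *: S t + t ^+ W *: al t.
  rewrite offS (@big_cat_nat _ _ _ (off i)) ?leq_addr //=; congr (_ + _).
    rewrite -SE; apply: eq_big_nat => q /andP[_ qo].
    by rewrite nth_cat size_tangents qo.
  rewrite -alE -{1}[off i]add0n big_addn addKn; apply: eq_big_nat => l /andP[_ ls].
  by rewrite nth_cat size_tangents ltnNge leq_addl /= addnK nth_mkseq // addnC.
by rewrite mul2n -addnn exprD; apply: second_order.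
Qed.

End OneFlag.

Section TwoFlags.
Variables F0 F1 : nat -> {vspace kN}.
Hypotheses (sF0 : instrat e A0 F0 F0) (sF1 : instrat e A0 F1 F1).
Variables (j0 s0 j1 s1 : nat -> nat) (v0 v1 : nat -> kN) (th0 th1 : nat -> nat -> 'rV[k]_N).
Hypothesis lv0 : forall i, (0 < i <= N)%N -> level e A0 F0 i (j0 i) (v0 i) (s0 i) (th0 i).
Hypothesis lv1 : forall i, (0 < i <= N)%N -> level e A0 F1 i (j1 i) (v1 i) (s1 i) (th1 i).
Hypothesis same_dim : (\sum_(m < N) s0 m.+1 = \sum_(m < N) s1 m.+1)%N.
Notation X0 := (stratum e A0 F0).
Notation X1 := (stratum e A0 F1).
Notation cl := (closure_of (@zclosed_flag k N)).

Lemma stratum_flags F : stratum e A0 F `<=` @flag_variety k N.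
Proof. by move=> b [G [fG _] ->]; exists G. Qed.

Lemma stratum_closure_sym : X1 `<=` cl X0 -> X0 `<=` cl X1.
Proof.
move=> X10; have ff0 := sF0.1; have ff1 := sF1.1.
have [g gu gE] := flag_conj ff1 ff0.
have bE y : borel (act y F0) = borel (act (y *m g) F1).
  by apply: eq_borel => i iN; rewrite actM /act gE.
pose M := size (tangents F1 j1 s1 v1 th1 N).
have MN : M = off F0 s0 N.
  rewrite /M size_tangents /off same_dim; congr (_ + _)%N.
  by rewrite (@eq_borel _ _ F0 (act g F1) gE) dim_borel_act.
pose ext (x : 'I_M -> k) q := if insub q is Some o then x o else 0.
pose P x := param F0 j0 s0 v0 th0 (ext x) *m g.
pose T y := y \in unitmx /\ X1 (borel (act y F1)).
have rv := @funring_polyv k M; have rt := funring_polyt k; have rx := @funring_polymx k N.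
have pcoord q : polymx (fun y : gl => coord (in_tuple (tangents F1 j1 s1 v1 th1 N)) q y).
  pose cf : {linear gl -> k^o} := coord (in_tuple (tangents F1 j1 s1 v1 th1 N)) q.
  exact: (polymx_form cf).
have van f : polymx f -> (forall x, \det (P x) * f (P x) = 0) -> vanishing F1 X0 f.
  move=> pf H; split=> // h hu Xh.
  have hg : h = h *m invmx g *m g by rewrite mulmxKV.
  have hgu : h *m invmx g \in unitmx by rewrite unitmx_GL // unitmx_inv.
  rewrite hg; apply: (inY_dense eN sF0 A0_stab A0_top A0_eq lv0 (leqnn N) (polymx_mulr g pf)).
    move=> y Yy; have [x0 yE] := param_surj Yy.
    have [yu _ _] := inY_Xi sF0 A0_stab A0_top A0_eq lv0 (leqnn N) Yy.
    pose x (o : 'I_M) := x0 o.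
    have PE : P x = y *m g.
      rewrite /P yE; congr (_ *m _); apply: param_eq => q; rewrite -MN => qM.
      by rewrite /ext insubT.
    have := H x; rewrite PE => /eqP; rewrite mulf_eq0 => /orP[|/eqP //].
    by have : y *m g \in unitmx by [rewrite unitmx_GL]; rewrite unitmxE unitfE => /negPf ->.
  by apply/(stratum_preim sF0) => //; rewrite bE mulmxKV.
move=> b X0b; have [F [fF _] bF] := X0b.
have [h hu hE] := flag_conj ff1 fF.
have bh : b = borel (act h F1) by rewrite bF; apply: eq_borel.
rewrite bh; apply/(closureP ff1 hu (stratum_flags (F := F1))) => f [pf vf].
apply: (van f pf _).2; rewrite -?bh //.
apply: (@dimension_compare k N M P f (fun y => \det y)
  (fun q y => coord (in_tuple (tangents F1 j1 s1 v1 th1 N)) q (y - 1)) T) => //.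
- apply: (fr_mx_mul rv); last exact: (fr_mx_const rv).
  have pe q : polyv (fun x : 'I_M -> k => ext x q).
    by rewrite /ext; case: insubP => [o _ _|_]; [exact: polyv_coord | exact: (fr_const rv)].
  apply: (fr_pi e j0 s0 v0 th0 N (c := fun x => cx F0 s0 (ext x)) (b := fun x => bx F0 (ext x)) rv) => [a l|]; first exact: pe.
  apply: (fr_mx_sum rv) => q; apply: (fr_mx_scale rv); first exact: pe.
  exact: (fr_mx_const rv).
- exact: polymx_det.
- move=> q; apply: (fr_eq (f := fun y => coord (in_tuple (tangents F1 j1 s1 v1 th1 N)) q y +
      - coord (in_tuple (tangents F1 j1 s1 v1 th1 N)) q 1)) => [y|].
    by rewrite linearB.
  apply: (fr_add rx); last exact: (fr_const rx).
  exact: pcoord.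
- move=> f' pf' H y [yu Xy].
  have := X10 _ Xy => /(closureP ff1 yu (stratum_flags (F := F0))); apply.
  exact: van.
- by move=> y [yu Xy]; apply: vf.
move=> W w wW.
have wW' q : (q < off F1 s1 N)%N -> (W <= w q < 2 * W)%N.
  by rewrite -(size_tangents F1 j1 s1 v1 th1) => qM; apply: (wW (Ordinal qM)).
have [R [pR RE]] := tangents_curve j1 v1 th1 (leqnn N) wW'.
pose xt (t : k) q := t ^+ w q.
pose ga t := pi_ e j1 s1 v1 th1 N (cx F1 s1 (xt t)) (1 + bx F1 (xt t)).
have pxt q : polyt (fun t => xt t q) by apply: (fr_exp rt); exact: polyt_id.
have pb : fr_mx (@polyt k) (fun t => 1 + bx F1 (xt t)).
  apply: (fr_mx_add rt); first exact: (fr_mx_const rt).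
  apply: (fr_mx_sum rt) => q; apply: (fr_mx_scale rt); first exact: pxt.
  exact: (fr_mx_const rt).
exists ga, (fun t => \det (1 + bx F1 (xt t))); split.
- by apply: (fr_pi e j1 s1 v1 th1 N (c := fun t => cx F1 s1 (xt t)) rt) => // a l; apply: pxt.
- exact: (fr_det rt).
- rewrite (_ : bx F1 (xt 0) = 0) ?addr0 ?det1 ?oner_eq0 // /bx big1 // => q _.
  have := wW' q (leq_trans (ltn_ord q) (leq_addr _ _)).
  by rewrite /xt expr0n; case: eqP => [->|_ _]; [lia | rewrite scale0r].
- move=> t dt; have bu : 1 + bx F1 (xt t) \in unitmx by rewrite unitmxE unitfE.
  have Yt : inY e F1 j1 s1 v1 th1 N (ga t).
    exists (cx F1 s1 (xt t)), (1 + bx F1 (xt t)); split=> //.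
    apply: memvD; first by apply/borelP => i _ u uF; rewrite mul1mx.
    by apply: memv_suml => q _; apply: memvZ; apply/vbasis_mem/mem_nth; rewrite size_tuple.
  have [gau sg ag] := inY_Xi sF1 A0_stab A0_top A0_eq lv1 (leqnn N) Yt.
  by split=> //; apply/(stratum_preim sF1).
move=> q; exists (fun t => coord (in_tuple (tangents F1 j1 s1 v1 th1 N)) q (R t)); split.
  exact: (polymx_comp rt (pcoord q) pR).
move=> t; have -> : ga t - 1 = \sum_(0 <= q < off F1 s1 N) t ^+ w q *: (tangents F1 j1 s1 v1 th1 N)`_q
    + t ^+ (2 * W) *: R t.
  by apply/eqP; rewrite subr_eq [X in _ == X]addrC addrA; apply/eqP; exact: RE.
rewrite linearD linearZ /=; congr (_ + _).
rewrite -(size_tangents F1 j1 s1 v1 th1) big_mkord.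
have fT : free (in_tuple (tangents F1 j1 s1 v1 th1 N)) := tangents_free sF1 lv1 (leqnn N).
by move: (coord_sum_free (fun i : 'I_M => t ^+ w i) q fT) => <-.
Qed.

End TwoFlags.

End PlainStrata.

(** * The Lusztig--Spaltenstein embedding *)

Section Levi.
Variables (k : closedFieldType) (N n : nat) (V : 'I_n -> {vspace 'cV[k]_N}).
Notation gl := 'M[k]_N.
Notation kN := 'cV[k]_N.
Hypotheses (dV : directv (\sum_(i < n) V i)%VS) (fV : (\sum_(i < n) V i)%VS = fullv).
Implicit Types (u w : kN) (x h z : gl) (G : 'I_n -> nat -> {vspace kN}).

Notation Lam := (psum (fun i => \dim (V i))).

Definition Wn (j : nat) : {vspace kN} := (\sum_(i < n | (i < j)%N) V i)%VS.

Lemma Wn0 : Wn 0 = 0%VS. Proof. by rewrite /Wn big_pred0. Qed.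

Lemma WnS (j : 'I_n) : Wn j.+1 = (Wn j + V j)%VS.
Proof.
rewrite /Wn (bigD1 j) //= addvC; congr (_ + _)%VS; apply: eq_bigl => l.
by rewrite ltnS andbC -ltn_neqAle.
Qed.

Lemma Wn_all : Wn n = fullv.
Proof. by rewrite -fV; apply: eq_bigl => i; rewrite ltn_ord. Qed.

Lemma Lam_all : Lam n = N.
Proof.
rewrite psum_all -[RHS](@dimN k N) -fV; apply/esym.
by have /directvP/= -> := dV.
Qed.

Lemma Wn_mono i j : (i <= j)%N -> (Wn i <= Wn j)%VS.
Proof.
move=> ij; apply/subv_sumP => l li; rewrite /Wn (sumv_sup l) //.
exact: leq_trans li ij.
Qed.

Lemma sub_Wn (l : 'I_n) j : (l < j)%N -> (V l <= Wn j)%VS.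
Proof. by move=> lj; rewrite /Wn (sumv_sup l). Qed.

Lemma dim_Wn j : \dim (Wn j) = Lam j.
Proof.
have E : (Wn j + \sum_(i < n | ~~ (i < j)%N) V i)%VS = fullv.
  by rewrite -fV [RHS](bigID (fun i : 'I_n => i < j)%N).
have := dimv_sum_cap (Wn j) (\sum_(i < n | ~~ (i < j)%N) V i)%VS.
have := dimv_leq_sum (index_enum 'I_n) (fun i : 'I_n => ~~ (i < j)%N) V.
have LN : (Lam j + \sum_(i < n | ~~ (i < j)%N) \dim (V i))%N = N.
  by apply: etrans Lam_all; rewrite psum_all [RHS](bigID (fun i : 'I_n => i < j)%N).
have D := dimv_leq_sum (index_enum 'I_n) (fun i : 'I_n => i < j)%N V.
rewrite E dimN => H1 H2; move: LN D H1 H2.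
rewrite -/(Wn j) -/(Lam j).
set a := \dim (Wn j); set b := Lam j.
set c := (\sum_(i < n | _) _)%N; set d := \dim (\sum_(i < n | _) _)%VS; set e := \dim (_ :&: _).
move: a b c d e => a b c d e; lia.
Qed.

Lemma Wn_capV (j : 'I_n) : (Wn j :&: V j = 0)%VS.
Proof.
apply/eqP; rewrite -dimv_eq0; have := dimv_sum_cap (Wn j) (V j).
rewrite -WnS !dim_Wn psumS; lia.
Qed.

Lemma Lam_le_N j : (Lam j <= N)%N.
Proof. by rewrite -dim_Wn dim_le. Qed.

Lemma levi_stabP x : reflect (forall i u, u \in V i -> x *m u \in V i) (x \in levi V).
Proof.
apply: (iffP (memv_bigcapP _ _)) => [H i|H i]; first by have /transporterP := H i.
exact/transporterP/H.
Qed.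

Lemma nilradicalP x : reflect (forall (j : 'I_n) u, u \in Wn j.+1 -> x *m u \in Wn j)
  (x \in nilradical V).
Proof.
apply: (iffP (memv_bigcapP _ _)) => [H i|H i]; first by have /transporterP := H i.
exact/transporterP/H.
Qed.

Lemma parabolicP x : reflect (forall (j : 'I_n) u, u \in Wn j.+1 -> x *m u \in Wn j.+1)
  (x \in parabolic V).
Proof.
apply: (iffP (memv_bigcapP _ _)) => [H i|H i]; first by have /transporterP := H i.
exact/transporterP/H.
Qed.

Lemma parabolic_stab x j : x \in parabolic V -> (j <= n)%N -> stab x (Wn j).
Proof.
case: j => [|j] xP jn; last by have /parabolicP/(_ (Ordinal jn)) := xP.
by rewrite Wn0; apply: stab0.
Qed.

Lemma levi_stab_Wn x j : x \in levi V -> stab x (Wn j).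
Proof.
move=> /levi_stabP xL u /memv_sumP[us usV ->]; rewrite mulmx_sumr.
by apply: memv_suml => i ij; apply: (subvP (sub_Wn ij)); apply/xL/usV.
Qed.

Definition flags0 G := forall i, full_flag (V i) (G i).

Definition comb G (i : nat) : {vspace kN} :=
  (\sum_(j < n) G j (minn (i - Lam j) (\dim (V j))))%VS.

Section Comb.
Variable G : 'I_n -> nat -> {vspace kN}.
Hypothesis fG : flags0 G.

Lemma flags0_dim j i : (i <= \dim (V j))%N -> \dim (G j i) = i.
Proof. by case: (fG j) => + _ _; apply. Qed.

Lemma flags0_mono j i i' : (i <= i' <= \dim (V j))%N -> (G j i <= G j i')%VS.
Proof.
case/andP => /subnK <-; elim: (i' - i)%N => [|m IH] lt; first exact: subvv.
case: (fG j) => _ H _; apply: subv_trans (H _ lt); exact: IH (ltnW lt).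
Qed.

Lemma flags0_top j : G j (\dim (V j)) = V j. Proof. by case: (fG j). Qed.

Lemma flags0_0 j : G j 0%N = 0%VS.
Proof. by apply/eqP; rewrite -dimv_eq0 flags0_dim. Qed.

Lemma flags0_sub j i : (i <= \dim (V j))%N -> (G j i <= V j)%VS.
Proof. by move=> id; rewrite -[V j]flags0_top flags0_mono ?id /=. Qed.

Lemma comb_block (j : 'I_n) i : (Lam j <= i <= Lam j.+1)%N -> comb G i = (Wn j + G j (i - Lam j)%N)%VS.
Proof.
move=> ij; rewrite /comb (bigID (fun l : 'I_n => l < j)%N) /=; congr (_ + _)%VS.
  apply: eq_bigr => l lj; rewrite -[RHS]flags0_top; congr (G l _).
  by have := @leq_psum _ (fun i => \dim (V i)) l.+1 j lj; rewrite psumS; lia.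
rewrite (bigD1 j) ?ltnn //= big1 ?addv0 => [|l /andP[lj nlj]].
  by congr (G j _); move: ij; rewrite psumS; lia.
have jl : (j < l)%N by rewrite ltn_neqAle eq_sym nlj leqNgt lj.
have := @leq_psum _ (fun i => \dim (V i)) j.+1 l jl => H.
by rewrite (_ : minn _ _ = 0%N) ?flags0_0 //; lia.
Qed.

Lemma comb_Wn j : (j <= n)%N -> comb G (Lam j) = Wn j.
Proof.
case: j => [|j] jn.
  rewrite psum0 Wn0 /comb big1 // => l _.
  by rewrite sub0n min0n flags0_0.
rewrite (@comb_block (Ordinal jn)) /=; last by rewrite leq_psum //= leqnn.
rewrite (psumS _ (Ordinal jn)) addKn flags0_top (WnS (Ordinal jn)) //.
Qed.

Lemma comb_top : comb G N = fullv.
Proof. by rewrite -Wn_all -(comb_Wn (leqnn n)) Lam_all. Qed.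

Lemma dim_block (j : 'I_n) (U : {vspace kN}) : (U <= V j)%VS ->
  \dim (Wn j + U) = (Lam j + \dim U)%N.
Proof.
move=> UV; rewrite dimv_disjoint_sum ?dim_Wn //.
by apply/eqP; rewrite -subv0 -(Wn_capV j) capvS.
Qed.

Lemma block_exists i : (i < N)%N -> exists j : 'I_n, (Lam j <= i < Lam j.+1)%N.
Proof. by move=> iN; apply: psum_block; rewrite Lam_all. Qed.

Lemma comb_full : full_flag fullv (comb G).
Proof.
split=> [i|i|]; rewrite dimN.
- rewrite leq_eqVlt => /orP[/eqP ->|iN]; first by rewrite comb_top dimN.
  have [j ij] := block_exists iN; rewrite (@comb_block j); last lia.
  have id : (i - Lam j <= \dim (V j))%N by move: ij; rewrite psumS; lia.
  by rewrite dim_block ?flags0_sub // flags0_dim //; lia.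
- move=> iN; apply/subv_sumP => j _; rewrite /comb (sumv_sup j) //.
  by apply: flags0_mono; lia.
- exact: comb_top.
Qed.

Lemma comb_cap j i : (i <= \dim (V j))%N -> (comb G (Lam j + i) :&: V j)%VS = G j i.
Proof.
move=> id; rewrite (@comb_block j); last by rewrite psumS; lia.
rewrite addKn addvC -vspace_modl ?flags0_sub //.
by rewrite Wn_capV addv0.
Qed.

Lemma nilradical_comb x : x \in nilradical V -> x \in borel (comb G).
Proof.
move=> /nilradicalP xn; apply/borelP => i; rewrite leq_eqVlt => /orP[/eqP ->|iN] u uC.
  by rewrite comb_top memvf.
have [j ij] := block_exists iN; move: uC; rewrite (@comb_block j); last lia.
move=> uC; apply: (subvP (addvSl _ _)); apply: xn; apply: subvP uC.
rewrite WnS; apply: addvS; first exact: subvv.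
by apply: flags0_sub; move: ij; rewrite psumS; lia.
Qed.

Lemma borel0P x : reflect (x \in levi V /\
    forall j i, (i <= \dim (V j))%N -> forall u, u \in G j i -> x *m u \in G j i)
  (x \in borel0 V G).
Proof.
rewrite memv_cap; apply: (iffP andP) => [[xL /memv_bigcapP H]|[xL H]]; split=> //.
  by move=> j; apply/flag_stabP.
by apply/memv_bigcapP => j; apply/flag_stabP/H.
Qed.

Lemma LS_borel : LS V (borel0 V G) = borel (comb G).
Proof.
apply/eqP; rewrite eqEsubv; apply/andP; split.
  rewrite /LS subv_add; apply/andP; split; apply/subvP => x; last exact: nilradical_comb.
  case/borel0P => xL xG; apply/borelP => i iN u /memv_sumP[us usG ->].
  rewrite mulmx_sumr; apply: memv_suml => j _.
  by rewrite /comb (subvP (sumv_sup j _ (subvv _))) // xG ?geq_minr ?usG.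
apply/subvP => x xB.
have : x \in parabolic V.
  apply/parabolicP => j u; rewrite -comb_Wn // => uC.
  by move/borelP: xB; apply=> //; apply: Lam_le_N.
rewrite -(proj2 (levi_nilradical dV fV)) => /memv_addP[l lL [z zn xE]].
rewrite xE memv_add //; apply/borel0P; split=> // j i id u uG.
rewrite -(comb_cap id) memv_cap; apply/andP; split; last first.
  by have /levi_stabP := lL; apply; apply: (subvP (flags0_sub id)).
have lB : l \in borel (comb G).
  by rewrite -[l](addrK z) -xE memvB // nilradical_comb.
move/borelP: lB; apply.
  by apply: leq_trans (Lam_le_N j.+1); rewrite psumS leq_add2l.
by move: uG; rewrite -(comb_cap id) memv_cap => /andP[].
Qed.

End Comb.

Lemma eq_borel0 G G' : (forall j i, (i <= \dim (V j))%N -> G j i = G' j i) ->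
  borel0 V G = borel0 V G'.
Proof.
move=> E; apply/vspaceP => x; apply/borel0P/borel0P => -[xL H]; split=> // j i id u.
  by rewrite -E //; apply: H.
by rewrite E //; apply: H.
Qed.

Lemma LS_inj G G' : flags0 G -> flags0 G' -> LS V (borel0 V G) = LS V (borel0 V G') ->
  forall j i, (i <= \dim (V j))%N -> G j i = G' j i.
Proof.
move=> fG fG'; rewrite !LS_borel // => /(borel_inj (comb_full fG) (comb_full fG')) E j i id.
rewrite -(comb_cap fG id) -(comb_cap fG' id) E //.
by apply: leq_trans (Lam_le_N j.+1); rewrite psumS leq_add2l.
Qed.

Notation B0 := (flag_variety0 V).
Notation B := (@flag_variety k N).

Lemma LS_injB b b' : B0 b -> B0 b' -> LS V b = LS V b' -> b = b'.
Proof. by move=> [G fG ->] [G' fG' ->] /(LS_inj fG fG'); apply: eq_borel0. Qed.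

Lemma LS_flags b : B0 b -> B (LS V b).
Proof. by move=> [G fG ->]; rewrite LS_borel //; exists (comb G) => //; apply: comb_full. Qed.

Lemma split_flag (F : nat -> {vspace kN}) : full_flag fullv F -> (forall j, (j <= n)%N -> F (Lam j) = Wn j) ->
  flags0 (fun j i => F (Lam j + i)%N :&: V j)%VS /\
  forall i, (i <= N)%N -> F i = comb (fun j i => F (Lam j + i)%N :&: V j)%VS i.
Proof.
move=> fF FW.
have blk (j : 'I_n) i : (i <= \dim (V j))%N -> F (Lam j + i)%N = (Wn j + (F (Lam j + i)%N :&: V j))%VS.
  move=> id; have iN : (Lam j + i <= Lam j.+1)%N by rewrite psumS leq_add2l.
  rewrite capvC vspace_modl; last first.
    by rewrite -(FW j (ltnW (ltn_ord j))) (flag_mono fF) // leq_addr (leq_trans iN) ?Lam_le_N.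
  apply/esym/capv_idPr; rewrite -WnS -(FW j.+1) // (flag_mono fF) // iN.
  exact: Lam_le_N.
have dimb (j : 'I_n) i : (i <= \dim (V j))%N -> \dim (F (Lam j + i)%N :&: V j) = i.
  move=> id; have := dim_block (capvSr (F (Lam j + i)%N) (V j)); rewrite -blk // (flag_dim fF).
    by move/addnI.
  by apply: leq_trans (Lam_le_N j.+1); rewrite psumS leq_add2l.
have fG : flags0 (fun j i => F (Lam j + i)%N :&: V j)%VS.
  move=> j; split=> [i id|i id|]; first exact: dimb.
    apply: capvS; last exact: subvv.
    apply: (flag_mono fF); rewrite leq_add2l leqnSn /=.
    by apply: leq_trans (Lam_le_N j.+1); rewrite psumS leq_add2l.
  by apply/eqP; rewrite eqEdim capvSr dimb ?leqnn.
split=> // i; rewrite leq_eqVlt => /orP[/eqP ->|iN]; first by rewrite (comb_top fG) (flag_top fF).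
have [j ij] := block_exists iN; rewrite (@comb_block _ fG j); last lia.
by rewrite -{1}(subnKC (proj1 (andP ij))) -blk //; move: ij; rewrite psumS; lia.
Qed.

Definition act0 h G : 'I_n -> nat -> {vspace kN} := fun j i => mv h (G j i).

Lemma levi_mv h j : levi_group V h -> mv h (V j) = V j.
Proof. by move=> [hu /levi_stabP hL]; apply: mv_stable => // u; apply: hL. Qed.

Lemma flags0_act h G : levi_group V h -> flags0 G -> flags0 (act0 h G).
Proof.
move=> hL fG j; case: (fG j) => d m t; have hu := hL.1; split=> [i id|i id|].
- by rewrite /act0 dim_mv // d.
- exact/mvS/m.
- by rewrite /act0 t levi_mv.
Qed.

Lemma comb_act h G i : comb (act0 h G) i = act h (comb G) i.
Proof. by rewrite /act /comb /mv limg_sum. Qed.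

Lemma LS_act h G : levi_group V h -> flags0 G ->
  AdV h (borel0 V G) = borel0 V (act0 h G) /\
  LS V (borel0 V (act0 h G)) = borel (act h (comb G)).
Proof.
move=> hL fG; have hu := hL.1; split; last first.
  by rewrite LS_borel; [apply: eq_borel => i _; apply: comb_act | apply: flags0_act].
have hV j u : (h *m u \in V j) = (u \in V j) by rewrite -{1}(levi_mv j hL) mem_mv_mul.
have hV' j u : (invmx h *m u \in V j) = (u \in V j).
  by rewrite -[LHS]hV mulKVmx.
apply/vspaceP => x; rewrite memv_AdV //; apply/borel0P/borel0P => -[/levi_stabP xL xG]; split.
- by apply/levi_stabP => j u uV; have := xL j (invmx h *m u); rewrite hV' -!mulmxA mulKVmx // hV'; apply.
- move=> j i id _ /mvP[u uG ->]; rewrite mem_mvE //.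
  by have := xG j i id u uG; rewrite -!mulmxA.
- by apply/levi_stabP => j u uV; rewrite -!mulmxA hV'; apply: xL; rewrite hV.
- move=> j i id u uG; have := xG j i id (h *m u) (mem_mv h uG).
  by rewrite mem_mvE // !mulmxA.
Qed.

Definition lev : gl -> gl := daddv_pi (levi V) (nilradical V).

Lemma lev_parabolic h : h \in parabolic V -> lev h \in levi V /\ h - lev h \in nilradical V.
Proof.
have [LN0 LNP] := levi_nilradical dV fV.
rewrite -{1}LNP => /(daddv_pi_add LN0) E; split; first exact: memv_pi.
by rewrite -{1}E addrAC subrr add0r memv_pi.
Qed.

Lemma lev_unit h : h \in parabolic V -> h \in unitmx -> levi_group V (lev h).
Proof.
move=> hP hu; have [lL zn] := lev_parabolic hP; split=> //; apply: unitmxP => u lu.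
suff H j u' : (j <= n)%N -> u' \in Wn j -> lev h *m u' = 0 -> u' = 0.
  by apply: (H n u) => //; rewrite Wn_all memvf.
elim: j u' {u lu} => [|j IH] u jn uW lu; first by move: uW; rewrite Wn0 memv0 => /eqP.
move: uW lu; rewrite (WnS (Ordinal jn)) => /memv_addP[w wW [v vV ->]]; rewrite mulmxDr => lu.
have lw : lev h *m w \in Wn j by apply: levi_stab_Wn.
have lv : lev h *m v = 0.
  apply/eqP; rewrite -memv0 -(Wn_capV (Ordinal jn)) memv_cap; apply/andP; split; last first.
    by have /levi_stabP := lL; apply.
  by have /eqP := lu; rewrite addrC addr_eq0 => /eqP ->; rewrite memvN.
have lw0 : lev h *m w = 0 by rewrite lv addr0 in lu.
rewrite (IH w (ltnW jn) wW lw0) add0r; apply/eqP.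
rewrite -memv0 -(Wn_capV (Ordinal jn)) memv_cap vV andbT /=.
have hW : mv h (Wn j) = Wn j.
  by apply: mv_stable => //; apply: parabolic_stab => //; apply: ltnW.
rewrite -(mem_mv_mul (Wn j) v hu) hW.
have -> : h *m v = (h - lev h) *m v by rewrite mulmxBl lv subr0.
have /nilradicalP/(_ (Ordinal jn)) := zn; apply.
exact: (subvP (@sub_Wn (Ordinal jn) j.+1 (ltnSn j))) _ vV.
Qed.

Lemma act_lev h G i : h \in parabolic V -> h \in unitmx -> flags0 G -> (i <= N)%N ->
  act h (comb G) i = act (lev h) (comb G) i.
Proof.
move=> hP hu fG iN; have [lu lL] := lev_unit hP hu; have [_ zn] := lev_parabolic hP.
apply/esym/eqP; rewrite eqEdim !dim_mv // leqnn andbT.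
move: iN; rewrite leq_eqVlt => /orP[/eqP ->|iN].
  by rewrite /act (comb_top fG) (mv_stable hu) ?subvf // => u _; rewrite memvf.
have [j ij] := block_exists iN; apply: mv_sub => u uC.
have -> : lev h *m u = h *m u - (h - lev h) *m u by rewrite mulmxBl opprB addrC subrK.
rewrite memvB ?mem_mv //.
have hW : mv h (Wn j) = Wn j.
  by apply: mv_stable => //; apply: parabolic_stab => //; apply: ltnW.
apply: (subvP (mvS h (_ : (Wn j <= _)%VS))); first by rewrite (@comb_block _ fG j) ?addvSl //; lia.
rewrite hW; have /nilradicalP := zn; apply; apply: subvP uC.
rewrite (@comb_block _ fG j) ?WnS; last lia.
apply: addvS; first exact: subvv.
by apply: (flags0_sub fG); move: ij; rewrite psumS; lia.
Qed.

Lemma parabolic_of_act h G G' : h \in unitmx -> flags0 G -> flags0 G' ->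
  (forall i, (i <= N)%N -> act h (comb G) i = comb G' i) -> h \in parabolic V.
Proof.
move=> hu fG fG' E; apply/parabolicP => j u uW.
have := E _ (Lam_le_N j.+1); rewrite /act !comb_Wn // => W.
by rewrite -W mem_mv.
Qed.

Notation LSi := (fun X : set {vspace gl} => LS V @` X).

Lemma LS_mem Z b : Z `<=` B0 -> B0 b -> (LSi Z) (LS V b) <-> Z b.
Proof.
move=> ZB Bb; split=> [[b' Zb' /(LS_injB (ZB _ Zb') Bb) <-] //|Zb].
by exists b.
Qed.

Lemma polymx_lin (f : {linear gl -> gl}) : fr_mx (@polymx k N) f.
Proof.
have rx := @funring_polymx k N => i j.
apply: (fr_eq (f := fun x : gl => \sum_a \sum_b x a b * f (delta_mx a b) i j)) => [x|].
  rewrite [in RHS](matrix_sum_delta x) linear_sum summxE; apply: eq_bigr => a _.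
  rewrite linear_sum summxE; apply: eq_bigr => b _.
  by rewrite linearZ mxE.
apply: (fr_sum rx) => a; apply: (fr_sum rx) => b; apply: (fr_mul rx); first exact: polymx_coord.
exact: (fr_const rx).
Qed.

Lemma zclosed0_of Z : Z `<=` B0 -> zclosed_flag (LSi Z) -> zclosed_flag0 V Z.
Proof.
move=> ZB [_ Zc]; split=> // _ [G fG ->].
have [|P PE] := Zc (borel (comb G)); first by exists (comb G) => //; apply: comb_full.
exists P; apply/seteqP; split=> h [hL].
  have [E1 E2] := LS_act hL fG => Zh; split=> //.
  have [] : (@GL k N `&` zero_locus P) h; last by [].
  rewrite -PE; split; first exact: hL.1.
  rewrite AdV_borel; last exact: hL.1.
  by rewrite -E2 -E1; exists (AdV h (borel0 V G)).
move=> zh; have [E1 E2] := LS_act hL fG; split=> //.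
have [] : [set h0 | GL h0 /\ LSi Z (AdV h0 (borel (comb G)))] h by rewrite PE; split=> //; exact: hL.1.
move=> _; rewrite AdV_borel -?E2 -?E1; last exact: hL.1.
move/LS_mem; apply=> //; rewrite E1; exists (act0 h G) => //; exact: flags0_act.
Qed.

Lemma zclosed_of Z : zclosed_flag0 V Z -> zclosed_flag (LSi Z).
Proof.
move=> [ZB Zc]; have rx := @funring_polymx k N.
split=> [_ [b /ZB Bb <-]|_ [F fF ->]]; first exact: LS_flags.
case: (pselect (exists2 h0, h0 \in unitmx & LSi Z (borel (act h0 F)))) => [[h0 h0u [b0 Zb0 E0]]|none]; last first.
  exists [set 1]; apply/seteqP; split=> h [hu].
    by rewrite AdV_borel // => Zh; case: none; exists h.
  by move=> /(_ 1 erefl); rewrite meval1 => /eqP; rewrite oner_eq0.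
have [G fG b0E] := ZB _ Zb0.
have FE i : (i <= N)%N -> act h0 F i = comb G i.
  by move=> iN; apply: (borel_inj (full_flag_act h0u fF) (comb_full fG)) iN; rewrite -E0 b0E LS_borel.
have [P0 P0E] := Zc b0 (ZB _ Zb0).
have bE h : borel (act h F) = borel (act (h *m invmx h0) (comb G)).
  by apply: eq_borel => i iN; rewrite actM /act -FE // mvV.
pose ph h : gl := h *m invmx h0.
pose I : set (gl -> k) := [set f | (exists i j, f = fun h => (ph h - projv (parabolic V) (ph h)) i j) \/
  (exists2 p, P0 p & f = fun h => p.@[fun i => mxvec (lev (ph h)) 0 i])].
have pph : fr_mx (@polymx k N) ph.
  by apply: (fr_mx_mul rx); [exact: polymx_coord | exact: (fr_mx_const rx)].
have Ip f : I f -> polymx f.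
  case=> [[i [j ->]]|[p Pp ->]].
    apply: (fr_eq (f := fun h => ph h i j + (-1) * projv (parabolic V) (ph h) i j)) => [h|].
      by rewrite mulN1r [RHS]mxE [X in _ = _ + X]mxE.
    apply: (fr_add rx); first exact: pph.
    apply: (fr_mul rx); first exact: (fr_const rx).
    by apply: (polymx_comp rx (f := fun x => projv (parabolic V) x i j)) pph; apply: polymx_lin.
  have p1 : polymx (fun x => p.@[fun i => mxvec x 0 i]) by exists p.
  by apply: (polymx_comp rx p1) => a b; apply: (polymx_comp rx (f := fun x => lev x a b)) pph; apply: polymx_lin.
exists [set p | exists2 f, I f & forall x, f x = p.@[fun i => mxvec x 0 i]].
have main h : h \in unitmx -> LSi Z (borel (act h F)) <-> forall f, I f -> f h = 0.
  move=> hu; have pu : ph h \in unitmx by rewrite unitmx_GL // unitmx_inv.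
  have key : ph h \in parabolic V -> LSi Z (borel (act h F)) <-> zero_locus P0 (lev (ph h)).
    move=> pP; have lL := lev_unit pP pu; have [E1 E2] := LS_act lL fG.
    have -> : borel (act h F) = LS V (AdV (lev (ph h)) b0).
      by rewrite bE b0E E1 E2; apply: eq_borel => i iN; apply: act_lev.
    have Bl : B0 (AdV (lev (ph h)) b0).
      by rewrite b0E E1; exists (act0 (lev (ph h)) G) => //; apply: flags0_act.
    split=> [/LS_mem Zl|zl].
      have [] : (levi_group V `&` zero_locus P0) (lev (ph h)); last by [].
      by rewrite -P0E; split=> //; apply: Zl.
    apply/LS_mem => //.
    by have [] : [set h1 | levi_group V h1 /\ Z (AdV h1 b0)] (lev (ph h)) by rewrite P0E.
  split=> [Zh|H].
    have pP : ph h \in parabolic V.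
      have [b' Zb' E'] := Zh; have [G' fG' b'E] := ZB _ Zb'.
      apply: (parabolic_of_act pu fG fG') => i iN.
      apply: (borel_inj (full_flag_act pu (comb_full fG)) (comb_full fG')) iN.
      by rewrite -bE -E' b'E LS_borel.
    move=> f [[i [j ->]]|[p Pp ->]]; first by rewrite projv_id // subrr mxE.
    by have := proj1 (key pP) Zh; apply.
  have pP : ph h \in parabolic V.
    suff <- : projv (parabolic V) (ph h) = ph h by exact: memv_proj.
    apply/esym/eqP; rewrite -subr_eq0; apply/eqP/matrixP => i j; rewrite [RHS]mxE.
    by apply: (H (fun h => (ph h - projv (parabolic V) (ph h)) i j)); left; exists i, j.
  apply/key => // p Pp; apply: (H (fun h => p.@[fun i => mxvec (lev (ph h)) 0 i])).
  by right; exists p.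
apply/seteqP; split=> h [hu].
  rewrite AdV_borel // => Zh; split=> // p [f If pE].
  by rewrite -pE; apply: (proj1 (main h hu)).
move=> zh; split=> //; rewrite AdV_borel //; apply/main => // f If.
by have [p pE] := Ip f If; rewrite pE; apply: zh; exists f.
Qed.

Lemma zclosed_setI (Z1 Z2 : set {vspace gl}) : zclosed_flag Z1 -> zclosed_flag Z2 -> zclosed_flag (Z1 `&` Z2).
Proof.
move=> [s1 c1] [s2 c2]; split=> [b [/s1]|b Bb] //.
have [P1 E1] := c1 b Bb; have [P2 E2] := c2 b Bb.
exists (P1 `|` P2); apply/seteqP; split=> h [hu].
  move=> [z1 z2]; split=> // p [P1p|P2p].
    by have [_ /(_ p P1p)] : (@GL k N `&` zero_locus P1) h by rewrite -E1.
  by have [_ /(_ p P2p)] : (@GL k N `&` zero_locus P2) h by rewrite -E2.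
move=> zh; split=> //; split.
  have [] // : [set h0 | GL h0 /\ Z1 (AdV h0 b)] h.
  by rewrite E1; split=> // p Pp; apply: zh; left.
have [] // : [set h0 | GL h0 /\ Z2 (AdV h0 b)] h.
by rewrite E2; split=> // p Pp; apply: zh; right.
Qed.

Lemma zclosed0_full : zclosed_flag0 V B0.
Proof.
split=> // _ [G fG ->]; exists set0; apply/seteqP; split=> h [hL _]; split=> //.
have [-> _] := LS_act hL fG; exists (act0 h G) => //; exact: flags0_act.
Qed.

Lemma zclosed0_preim Z : zclosed_flag Z -> zclosed_flag0 V (B0 `&` LS V @^-1` Z).
Proof.
move=> Zc; apply: zclosed0_of; first by move=> b [].
have -> : LSi (B0 `&` LS V @^-1` Z) = LSi B0 `&` Z.
  apply/seteqP; split=> [_ [b [Bb Zb] <-]|b [[b0 Bb0 <-] Zb]]; last by exists b0.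
  by split=> //; exists b.
by apply: zclosed_setI => //; apply/zclosed_of/zclosed0_full.
Qed.

Lemma LS_closure X : X `<=` B0 ->
  LSi (closure_of (zclosed_flag0 V) X) = closure_of (@zclosed_flag k N) (LSi X).
Proof.
move=> XB; apply/seteqP; split=> [_ [b clb <-] Z Zc XZ|b clb].
  have [] // := clb _ (zclosed0_preim Zc) _.
  by move=> c Xc; split; [exact: XB | apply: XZ; exists c].
have [b0 Bb0 bE] : LSi B0 b.
  apply: clb; first exact/zclosed_of/zclosed0_full.
  by move=> _ [c /XB Bc <-]; exists c.
exists b0 => // Z Zc XZ; have ZB := Zc.1.
apply/(LS_mem ZB Bb0); rewrite bE; apply: clb; first exact: zclosed_of.
by move=> _ [c /XZ Zc' <-]; exists c.
Qed.

Lemma LS_irreducible X : X `<=` B0 ->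
  irreducible (zclosed_flag0 V) X <-> irreducible (@zclosed_flag k N) (LSi X).
Proof.
move=> XB; split=> -[[b Xb] H]; split.
- by exists (LS V b), b.
- move=> Z1 Z2 c1 c2 sub.
  have [|s|s] := H _ _ (zclosed0_preim c1) (zclosed0_preim c2).
  + move=> c Xc; have [z|z] := sub (LS V c) (ex_intro2 _ _ c Xc erefl); [left|right]; split=> //; exact: XB.
  + by left=> _ [c /s[_ zc] <-].
  + by right=> _ [c /s[_ zc] <-].
- by have [b0 Xb0 _] := Xb; exists b0.
- move=> Z1 Z2 c1 c2 sub.
  have [|s|s] := H _ _ (zclosed_of c1) (zclosed_of c2).
  + by move=> _ [c /sub[z|z] <-]; [left|right]; exists c.
  + by left=> c Xc; apply/(LS_mem c1.1 (XB _ Xc))/s; exists c.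
  + by right=> c Xc; apply/(LS_mem c2.1 (XB _ Xc))/s; exists c.
Qed.

End Levi.

(** * The induced orbit *)

Lemma chain_kernel (k : closedFieldType) (N : nat) (x : 'M[k]_N) w (f : nat -> nat) a :
    basis_of fullv (chains x w N (fun=> 0%N) f) ->
  (\dim (qker x 0 a fullv) <= \sum_(r < N) minn (f r) a)%N.
Proof.
move=> bas; have fr := basis_free bas.
have sub := @chains_subseq k N x w N (fun=> a) (fun r => f r - a)%N f.
have := free_dim_le (U := mv (x ^+ a) fullv) (free_subseq (sub _) fr).
rewrite size_chains => H.
have sz : (\sum_(r < N) f r = N)%N.
  by have /eqP := fr; rewrite (span_basis bas) dimN size_chains.
have split : (\sum_(r < N) f r = \sum_(r < N) minn (f r) a + \sum_(r < N) (f r - a))%N.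
  by rewrite -big_split; apply: eq_bigr => r _ /=; lia.
have : (\sum_(r < N) (f r - a) <= \dim (mv (x ^+ a) fullv))%N.
  apply: H => [r|_ /chainsP[r [j [rN /andP[aj _] ->]]]].
    by case: (leqP (f r) a) => ?; [left|right]; lia.
  by rewrite -(subnKC aj) exprD_mulmx mem_mv // memvf.
by have := dim_qker x a fullv; rewrite dimN; lia.
Qed.

Section Induced.
Variables (k : closedFieldType) (N n : nat) (V : 'I_n -> {vspace 'cV[k]_N}).
Notation gl := 'M[k]_N.
Notation kN := 'cV[k]_N.
Hypotheses (dV : directv (\sum_(i < n) V i)%VS) (fV : (\sum_(i < n) V i)%VS = fullv).
Variables (mu : n.-tuple (seq nat)).
Hypothesis pmu : forall i, partition_of (tnth mu i) (\dim (V i)).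
Implicit Types (u : kN) (e x h z : gl) (U : {vspace kN}).

Notation Lam := (psum (fun i => \dim (V i))).
Notation Wn := (Wn V).
Notation m := (fun l r => nth 0%N (tnth mu l) r).
Notation Rs := (row_sum mu).

Lemma row_sum0 r : Rs 0 r = 0%N. Proof. by rewrite row_sumE psum0. Qed.

Lemma row_sumS (j : 'I_n) r : Rs j.+1 r = (Rs j r + m j r)%N.
Proof. by rewrite !row_sumE psumS. Qed.

Lemma row_sum_noninc j r : (Rs j r.+1 <= Rs j r)%N.
Proof. by apply: leq_sum => l _; apply: partition_noninc (pmu l) r. Qed.

Lemma sum_row_sum j : (\sum_(r < N) Rs j r = Lam j)%N.
Proof.
rewrite /row_sum exchange_big /=; apply: eq_bigr => l _.
exact: partition_sum (pmu l) (dim_le _).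
Qed.

Lemma row_sum_ge_N j r : (N <= r)%N -> Rs j r = 0%N.
Proof.
move=> Nr; apply: big1 => l _; apply/eqP; rewrite -leqn0 leqNgt -(partition_pos r (pmu l)).
by rewrite -leqNgt (leq_trans (partition_size (pmu l))) // (leq_trans (dim_le _)).
Qed.

Section Graded.
Variables (e0 z : gl).
Hypotheses (e0L : e0 \in levi V) (zn : z \in nilradical V).
Notation e := (e0 + z).

Lemma e_stab_Wn j : (j <= n)%N -> stab e (Wn j).
Proof.
move=> jn u uW; rewrite mulmxDl memvD //; first exact: levi_stab_Wn.
case: j jn uW => [|j] jn uW; first by move: uW; rewrite Wn0 memv0 => /eqP ->; rewrite mulmx0 mem0v.
have /nilradicalP/(_ (Ordinal jn) u uW) := zn; apply: subvP; exact: Wn_mono.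
Qed.

Lemma exp_graded (j : 'I_n) b u : u \in Wn j.+1 -> e ^+ b *m u - e0 ^+ b *m u \in Wn j.
Proof.
move=> uW; elim: b => [|b IH]; first by rewrite subrr mem0v.
rewrite !exprS_mulmx.
have -> : e *m (e ^+ b *m u) - e0 *m (e0 ^+ b *m u) =
    e *m (e ^+ b *m u - e0 ^+ b *m u) + z *m (e0 ^+ b *m u).
  move: (e ^+ b *m u) (e0 ^+ b *m u) => p q.
  by rewrite mulmxBr -addrA; congr (_ + _); rewrite mulmxDl opprD subrK.
rewrite memvD //; first by apply: e_stab_Wn => //; apply: ltnW.
have /nilradicalP/(_ j) := zn; apply; apply: stab_exp => //; exact: levi_stab_Wn.
Qed.

Lemma stab_block (j : 'I_n) U : (U <= V j)%VS -> stab e (Wn j + U)%VS <-> stab e0 U.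
Proof.
move=> UV; have UW u : u \in U -> u \in Wn j.+1.
  by move=> uU; apply: (subvP (@sub_Wn _ _ _ V j j.+1 _)) => //; apply: (subvP UV).
split=> s u uU.
  have eU : e *m u - e0 *m u \in Wn j by have := exp_graded 1 (UW _ uU); rewrite !expr1.
  have : e0 *m u \in ((Wn j + U) :&: V j)%VS.
    rewrite memv_cap; apply/andP; split; last by have /levi_stabP := e0L; apply; apply: (subvP UV).
    rewrite -[e0 *m u](subKr (e *m u)) memvB ?(subvP (addvSl _ _) _ eU) //.
    by apply: s; apply: (subvP (addvSr _ _)).
  by rewrite addvC -vspace_modl // Wn_capV // addv0.
move: uU => /memv_addP[w wW [v vU ->]]; rewrite mulmxDr memvD //.
  by apply: (subvP (addvSl _ _)); apply: e_stab_Wn => //; apply: ltnW.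
have eU : e *m v - e0 *m v \in Wn j by have := exp_graded 1 (UW _ vU); rewrite !expr1.
by rewrite -[e *m v](subrK (e0 *m v)) memv_add // s.
Qed.

Lemma qker_block (j : 'I_n) U b : (U <= V j)%VS -> stab e0 U ->
  qker e (Wn j) b (Wn j + U) = (Wn j + qker e0 0 b U)%VS.
Proof.
move=> UV sU; have UW u : u \in U -> u \in Wn j.+1.
  by move=> uU; apply: (subvP (@sub_Wn _ _ _ V j j.+1 _)) => //; apply: (subvP UV).
have sW w : w \in Wn j -> e ^+ b *m w \in Wn j.
  by apply: stab_exp; apply: e_stab_Wn; apply: ltnW.
have E v : v \in U -> (e ^+ b *m v \in Wn j) = (e0 ^+ b *m v \in 0%VS).
  move=> vU; have eU := exp_graded b (UW _ vU).
  apply/idP/idP => [eW|]; last by rewrite memv0 => /eqP E0; move: eU; rewrite E0 subr0.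
  rewrite -(Wn_capV dV fV j) memv_cap; apply/andP; split.
    by rewrite -[e0 ^+ b *m v](subKr (e ^+ b *m v)) memvB.
  by apply: (subvP UV); apply: stab_exp.
apply/vspaceP => u; rewrite mem_qker; apply/andP/memv_addP.
  case=> /memv_addP[w wW [v vU ->]]; rewrite mulmxDr => eu.
  exists w => //; exists v => //; rewrite mem_qker vU /= -E //.
  by rewrite -[e ^+ b *m v](addKr (e ^+ b *m w)) memvD // memvN sW.
case=> w wW [v]; rewrite mem_qker => /andP[vU ev] ->; split; first exact: memv_add.
by rewrite mulmxDr; apply: memvD; [exact: sW | rewrite E].
Qed.

Lemma has_type_block (j : 'I_n) U f : (U <= V j)%VS ->
  has_type e (Wn j) (Wn j + U)%VS f <-> has_type e0 0 U f.
Proof.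
move=> UV; have dq b (sU : stab e0 U) : \dim (qker e (Wn j) b (Wn j + U)) = (Lam j + \dim (qker e0 0 b U))%N.
  by rewrite qker_block // (dim_block dV fV) // (subv_trans (qker_sub _ _ _ _)).
split=> -[]; first move/(stab_block UV); move=> sU H; split.
- exact: sU.
- by move=> b; have := H b; rewrite (dq _ sU) (dim_Wn dV fV) dimv0 => /addnI.
- exact/stab_block.
- by move=> b; rewrite (dq _ sU) (dim_Wn dV fV) H dimv0.
Qed.

Hypothesis e0mu : forall i, jordan_type e0 (V i) (tnth mu i).

Lemma graded_type (j : 'I_n) : has_type e (Wn j) (Wn j.+1) (m j).
Proof. by rewrite WnS; apply/has_type_block; [exact: subvv | apply: jordan_has_type]. Qed.

Lemma Wn_type_ge j a : (j <= n)%N -> (\sum_(r < N) minn (Rs j r) a <= \dim (qker e 0 a (Wn j)))%N.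
Proof.
elim: j a => [|j IH] a jn.
  by rewrite big1 // => r _; rewrite row_sum0 min0n.
have /= := @ext_type_ge k N e (Wn j) (Wn j.+1) (Rs j) (m (Ordinal jn)) a.
under eq_bigr => r _ do rewrite -(row_sumS (Ordinal jn)).
apply.
- exact: row_sum_noninc.
- exact: partition_noninc (pmu _).
- exact: Wn_mono.
- by move=> b; apply/IH/ltnW.
- exact: (graded_type (Ordinal jn)).
Qed.

Hypothesis top_le : forall a, (\dim (qker e 0 a fullv) <= \sum_(r < N) minn (Rs n r) a)%N.

Lemma Wn_type j : (j <= n)%N -> has_type e 0 (Wn j) (Rs j).
Proof.
move=> jn; rewrite -(subKn jn); elim: (n - j)%N (leq_subr j n) => [|i IH] iN.
  rewrite subn0; split=> [u _|a]; first by rewrite Wn_all // memvf.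
  apply/eqP; rewrite dimv0 add0n eqn_leq Wn_type_ge // andbT Wn_all //.
have lt : (n - i.+1 < n)%N by lia.
have E : (n - i = (n - i.+1).+1)%N by lia.
have := IH (ltnW iN); rewrite E => ty.
apply: (@ext_type_sub k N e (Wn (n - i.+1)) (Wn (n - i.+1).+1) _ (m (Ordinal lt))).
- exact: row_sum_noninc.
- exact: partition_noninc (pmu _).
- exact: Wn_mono.
- exact/e_stab_Wn/ltnW.
- by move=> b; apply: Wn_type_ge; apply: ltnW.
- exact: (graded_type (Ordinal lt)).
- by apply: eq_has_type ty => r _; rewrite (row_sumS (Ordinal lt)).
Qed.

Lemma induced_nilp : e ^+ N = 0.
Proof.
have [_ /(_ N)] := Wn_type (leqnn n); rewrite Wn_all // dimv0 add0n.
have -> : (\sum_(r < N) minn (Rs n r) N = N)%N.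
  rewrite (eq_bigr (fun r : 'I_N => Rs n r)) ?sum_row_sum ?Lam_all // => r _.
  apply/minn_idPl; rewrite -[X in (_ <= X)%N](Lam_all dV fV); apply: leq_sum => l _.
  exact: partition_nth_le (pmu l).
move=> dq; have full : qker e 0 N fullv = fullv.
  by apply/eqP; rewrite eqEdim subvf dimN dq leqnn.
apply/matrixP => a b; have : delta_mx b 0 \in qker e 0 N fullv by rewrite full memvf.
rewrite mem_qker memvf memv0 /= -colE => /eqP/matrixP/(_ a 0).
by rewrite !mxE.
Qed.

End Graded.

Section Richardson.
Variable e0 : gl.
Hypotheses (e0L : e0 \in levi V) (e0mu : forall i, jordan_type e0 (V i) (tnth mu i)).

Lemma chain_form (j : 'I_n) (v : nat -> kN) r :
    (V j <= <<chains e0 v (size (tnth mu j)) (fun=> 0%N) (m j)>>)%VS -> (0 < m j r)%N ->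
  exists xi : 'rV[k]_N,
    [/\ forall (l : 'I_n) u, l != j -> u \in V l -> (xi *m u) 0 0 = 0,
        (xi *m (e0 ^+ (m j r).-1 *m v r)) 0 0 = 1 &
        forall r' i, (r' < size (tnth mu j))%N -> (i < m j r')%N -> (r' != r) || (i != (m j r).-1) ->
          (xi *m (e0 ^+ i *m v r')) 0 0 = 0].
Proof.
move=> sp m0; set s := size _ in sp *.
have rs : (r < s)%N by rewrite (partition_pos _ (pmu j)).
pose len r' := if r' == r then (m j r).-1 else m j r'.
pose X := <<chains e0 v s (fun=> 0%N) len>>%VS.
pose A := (X + \sum_(l < n | l != j) V l)%VS.
have inX r' i : (r' < s)%N -> (i < len r')%N -> e0 ^+ i *m v r' \in X.
  by move=> r's il; apply: memv_span; apply: mem_chains.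
have notA : e0 ^+ (m j r).-1 *m v r \notin A.
  apply/negP => vA.
  have full : (fullv <= A)%VS.
    rewrite -fV; apply/subv_sumP => l _; case: (eqVneq l j) => [->|lj]; last first.
      by apply: subv_trans (addvSr _ _); apply: (sumv_sup l).
    apply: subv_trans sp _; apply/span_subvP => _ /chainsP[r' [i [r's /andP[_ im] ->]]].
    case: (boolP (i < len r')%N) => [il|]; first by apply: (subvP (addvSl _ _)); apply: inX.
    rewrite /len; case: eqP im => [->|_] im; last by rewrite im.
    by rewrite -leqNgt => il; rewrite (_ : i = (m j r).-1) //; move: im il; lia.
  have dA : (\dim A <= \sum_(r' < s) len r' + \sum_(l < n | l != j) \dim (V l))%N.
    have d1 := dimv_add_leqif X (\sum_(l < n | l != j) V l)%VS.
    have d2 := dim_span (chains e0 v s (fun=> 0%N) len).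
    have d3 := dimv_leq_sum (index_enum 'I_n) (fun l => l != j) V.
    rewrite size_chains in d2.
    exact: leq_trans d1.1 (leq_add d2 d3).
  have dj : (\sum_(r' < s) m j r' = \dim (V j))%N.
    by rewrite (sum_nth_le (leqnn _)) (proj2 (proj2 (pmu j))).
  have dl : (\sum_(r' < s) m j r' = (\sum_(r' < s) len r').+1)%N.
    rewrite (bigD1 (Ordinal rs)) //= [in RHS](bigD1 (Ordinal rs)) //= -addSn.
    congr (_ + _)%N; first by rewrite /len eqxx prednK.
    by apply: eq_bigr => i ir; rewrite /len ifN // .
  have := dimvS full; rewrite dimN.
  have := Lam_all dV fV; rewrite psum_all (bigD1 j) //=.
  move: dA dj dl.
  set a := (\sum_(r' < s) len r')%N; set b := (\sum_(i < n | _) _)%N.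
  set c := (\sum_(r' < s) m j r')%N; move: (\dim (V j)) (\dim A) a b c => p q a b c; lia.
have [xi [xiA xi1]] := sep_form notA; exists xi; split=> // [l u lj uV|r' i r's im d].
  by apply/xiA/(subvP (addvSr _ _)); apply: (subvP _ _ uV); apply: (sumv_sup l).
apply/xiA/(subvP (addvSl _ _))/inX => //.
by rewrite /len; case: eqP d im => [->|] //=; move: m0; lia.
Qed.

(* The r-th Jordan chain of V j is continued by the r-th chain built on W_j, so that the lengths add up. *)
Lemma richardson j : (j <= n)%N -> exists (z : gl) (w : nat -> kN),
  [/\ z \in nilradical V, (forall (l : 'I_n) u, (j <= l)%N -> u \in V l -> z *m u = 0),
      (forall r, (e0 + z) ^+ Rs j r *m w r = 0) &
      basis_of (Wn j) (chains (e0 + z) w N (fun=> 0%N) (Rs j))].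
Proof.
elim: j => [_|j IH jn].
  exists 0, (fun=> 0); split=> [|l u _ _|r|]; rewrite ?mem0v ?mul0mx ?mulmx0 //.
  rewrite basisEdim Wn0 sub0v dimv0 size_chains big1 // => r _.
  exact: row_sum0.
have [z [w [zn zV wz bw]]] := IH (ltnW jn).
pose J := Ordinal jn.
have [_ [v [bv vz]]] := e0mu J.
have spv : (V J <= <<chains e0 v (size (tnth mu J)) (fun=> 0%N) (m J)>>)%VS.
  by rewrite (span_basis bv).
have [xi xiP] : exists xi : nat -> 'rV[k]_N, forall r, (0 < m J r)%N ->
    [/\ forall (l : 'I_n) u, l != J -> u \in V l -> (xi r *m u) 0 0 = 0,
        (xi r *m (e0 ^+ (m J r).-1 *m v r)) 0 0 = 1 &
        forall r' i, (r' < size (tnth mu J))%N -> (i < m J r')%N -> (r' != r) || (i != (m J r).-1) ->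
          (xi r *m (e0 ^+ i *m v r')) 0 0 = 0].
  suff /choice[xi H] : forall r, exists x : 'rV[k]_N, (0 < m J r)%N ->
    [/\ forall (l : 'I_n) u, l != J -> u \in V l -> (x *m u) 0 0 = 0,
        (x *m (e0 ^+ (m J r).-1 *m v r)) 0 0 = 1 &
        forall r' i, (r' < size (tnth mu J))%N -> (i < m J r')%N -> (r' != r) || (i != (m J r).-1) ->
          (x *m (e0 ^+ i *m v r')) 0 0 = 0] by exists xi.
  move=> r; case: (posnP (m J r)) => [->|m0]; first by exists 0.
  by have [x xP] := chain_form spv m0; exists x.
have pos r : (r < size (tnth mu J))%N = (0 < m J r)%N by apply: partition_pos (pmu J).
have rN r : (0 < m J r)%N -> (r < N)%N.
  by rewrite -pos => /leq_trans; apply; apply: leq_trans (partition_size (pmu J)) (dim_le _).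
pose del : gl := \sum_(r < N | (0 < m J r)%N) w r *m xi r.
have delE u : del *m u = \sum_(r < N | (0 < m J r)%N) (xi r *m u) 0 0 *: w r.
  by rewrite mulmx_suml; apply: eq_bigr => r _; rewrite form_scale.
have del0 (l : 'I_n) u : l != J -> u \in V l -> del *m u = 0.
  move=> lJ uV; rewrite delE big1 // => r mr; have [H _ _] := xiP r mr.
  by rewrite (H l u) // scale0r.
have delW u : u \in Wn j -> del *m u = 0.
  case/memv_sumP => us usV ->; rewrite mulmx_sumr big1 // => l lj; apply: (del0 l).
    by apply/eqP => /(congr1 val) /= E; rewrite E ltnn in lj.
  exact: usV.
have w_in r : (r < N)%N -> w r \in Wn j.
  move=> rN'; case: (posnP (Rs j r)) => [E|Rp].
    by have := wz r; rewrite E expr0_mulmx => ->; apply: mem0v.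
  have : (e0 + z) ^+ 0 *m w r \in chains (e0 + z) w N (fun=> 0%N) (Rs j) by apply: mem_chains.
  by rewrite expr0_mulmx => /(basis_mem bw).
have del_in u : del *m u \in Wn j.
  by rewrite delE; apply: memv_suml => r _; rewrite memvZ // w_in.
have delv r i : (0 < m J r)%N -> (i < m J r)%N ->
    del *m (e0 ^+ i *m v r) = if i == (m J r).-1 then w r else 0.
  move=> mr im; rewrite delE (bigD1 (Ordinal (rN r mr))) //= big1 => [|r' /andP[mr' r'r]].
    rewrite addr0; have [_ H1 H2] := xiP r mr.
    case: eqP => [->|/eqP ni]; first by rewrite H1 scale1r.
    by rewrite H2 ?scale0r ?pos // ni orbT.
  have [_ _ H2] := xiP r' mr'; rewrite H2 ?scale0r ?pos //.
  by rewrite eq_sym (_ : _ != _) //; apply: contra r'r => /eqP E; apply/eqP/val_inj.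
pose x := e0 + (z + del); pose y r := if (0 < m J r)%N then v r else w r.
have xW i u : u \in Wn j -> x ^+ i *m u = (e0 + z) ^+ i *m u.
  move=> uW; elim: i => [|i IHi]; first by rewrite !expr0_mulmx.
  rewrite !exprS_mulmx IHi /x addrA mulmxDl delW ?addr0 //.
  by apply: stab_exp uW; apply: e_stab_Wn => //; apply: ltnW.
have e0v r i : e0 ^+ i *m v r \in V J \/ (size (tnth mu J) <= r)%N.
  case: (leqP (size (tnth mu J)) r) => rs; [by right|left].
  have sJ : stab e0 (V J) by have /levi_stabP := e0L; apply.
  apply: stab_exp => //; have : e0 ^+ 0 *m v r \in chains e0 v (size (tnth mu J)) (fun=> 0%N) (m J).
    by apply: mem_chains => //=; rewrite -pos.
  by rewrite expr0_mulmx => /(basis_mem bv).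
have xv r i : (0 < m J r)%N -> (i < m J r)%N -> x ^+ i *m v r = e0 ^+ i *m v r.
  move=> mr; elim: i => [|i IHi] im; first by rewrite !expr0_mulmx.
  rewrite !exprS_mulmx IHi ?(ltnW im) // /x !mulmxDl delv ?(ltnW im) //.
  rewrite ifN; last by apply/eqP; lia.
  rewrite addr0 (zV J) ?addr0 //.
  by have [|] := e0v r i => //; rewrite leqNgt pos mr.
have xy r i : (r < N)%N -> x ^+ (m J r + i) *m y r = (e0 + z) ^+ i *m w r.
  move=> rN'; rewrite /y; case: posnP => [->|mr]; first by rewrite add0n xW // w_in.
  have -> : (m J r + i = i + (m J r).-1.+1)%N by rewrite prednK // addnC.
  rewrite exprD_mulmx exprS_mulmx xv //; last by rewrite prednK.
  have -> : x *m (e0 ^+ (m J r).-1 *m v r) = w r.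
    rewrite /x !mulmxDl delv ?prednK // eqxx (zV J) //; last first.
      by have [|] := e0v r (m J r).-1 => //; rewrite leqNgt pos mr.
    by rewrite -exprS_mulmx prednK // vz ?pos // !add0r.
  by apply: xW; apply: w_in.
exists (z + del), y; split.
- apply: memvD => //; apply/nilradicalP => i u uW.
  case: (leqP j i) => ji; first by apply: subvP (del_in u); apply: Wn_mono.
  by rewrite delW ?mem0v //; apply: subvP uW; apply: Wn_mono.
- move=> l u jl uV; rewrite mulmxDl (zV l) ?(ltnW jl) // (del0 l) ?addr0 //.
  by apply/eqP => /(congr1 val) /= E; rewrite E ltnn in jl.
- move=> r; case: (ltnP r N) => rN'; last first.
    rewrite row_sum_ge_N // expr0_mulmx /y; have := wz r; rewrite row_sum_ge_N // expr0_mulmx => ->.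
    by case: ifP => // /rN; rewrite ltnNge rN'.
  by rewrite (row_sumS J) addnC xy.
rewrite basisEdim size_chains (sum_row_sum j.+1) (dim_Wn dV fV) leqnn andbT (WnS _ J).
rewrite subv_add; apply/andP; split.
  rewrite -(span_basis bw); apply/span_subvP => _ /chainsP[r [i [rN' /andP[_ ir] ->]]].
  rewrite -xy //; apply: memv_span; apply: mem_chains => //=.
  by rewrite (row_sumS J) add0n addnC ltn_add2r.
apply: subv_trans spv _; apply/span_subvP => _ /chainsP[r [i [rs /andP[_ ir] ->]]].
have mr : (0 < m J r)%N by rewrite -pos.
rewrite -xv //; have -> : v r = y r by rewrite /y mr.
apply: memv_span; apply: mem_chains; first exact: rN.
by rewrite (row_sumS J) /= add0n; apply: leq_trans ir _; apply: leq_addl.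
Qed.

End Richardson.

Lemma Ad_exp g x a : g \in unitmx -> Ad g x ^+ a = Ad g (x ^+ a).
Proof.
move=> gu; elim: a => [|a IH]; first by rewrite !expr0 /Ad mulmx1 mulmxV.
by rewrite !exprS IH /Ad -!mulmxE !mulmxA mulmxKV.
Qed.

Lemma induced_top e0 e : nilp_orbit V mu e0 -> Ind V (nilp_orbit V mu) e ->
  forall a, (\dim (qker e 0 a fullv) <= \sum_(r < N) minn (Rs n r) a)%N.
Proof.
move=> [e0L e0mu] [_ dense] a.
have [z [w [zn _ _ bas]]] := richardson e0L e0mu (leqnn n).
rewrite Wn_all // in bas; set x := e0 + z in bas.
have kx := chain_kernel a bas; apply: leq_trans kx.
have de := dim_qker e a fullv; have dx := dim_qker x a fullv.
suff : (\dim (mv (x ^+ a) fullv) <= \dim (mv (e ^+ a) fullv))%N by move: de dx; lia.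
rewrite leqNgt; apply/negP => /dim_mv_gt[L [R [_ /eqP nz]]]; apply: nz.
have rx := @funring_polymx k N.
have [p pE] : polymx (fun y : gl => \det (L *m y ^+ a *m R)).
  apply: (fr_det rx); apply: (fr_mx_mul rx); last exact: (fr_mx_const rx).
  apply: (fr_mx_mul rx); first exact: (fr_mx_const rx).
  by apply: (fr_mx_exp rx); apply: polymx_coord.
have sx : Ad_saturation V (nilp_orbit V mu) x.
  exists 1%:M, e0, z; split=> //; first exact: unitmx1.
  by rewrite /Ad mul1mx invmx1 mulmx1.
rewrite pE; apply: (dense _ sx (zero_locus [set p])) => //.
- by exists [set p]; rewrite setTI.
- move=> _ [g gu <-] _ ->; rewrite -pE Ad_exp //; apply/eqP/negPn/negP => nz.
  have : (\dim (mv (e ^+ a) fullv) < \dim (mv (Ad g (e ^+ a)) fullv))%N.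
    by apply/dim_mv_gt; exists L, R; split=> // c; apply: memvf.
  rewrite /Ad !mvM (dim_mv _ gu) ltnNge => /negP; apply; apply: dimvS.
  by apply: mvS; apply: subvf.
Qed.

End Induced.

(** * Components of Springer fibres *)

Section Types.
Variables (k : closedFieldType) (N : nat).
Notation gl := 'M[k]_N.
Notation kN := 'cV[k]_N.
Implicit Types (x e : gl) (A U H : {vspace kN}) (u : kN) (f g : nat -> nat) (F : nat -> {vspace kN}).

Lemma has_type_upto x A U f : (A <= U)%VS -> stab x U -> (forall r, (f r <= N)%N) ->
    (forall u, u \in U -> x ^+ N *m u = 0) ->
    (forall a, (a <= N)%N -> \dim (qker x A a U) = (\dim A + \sum_(r < N) minn (f r) a)%N) ->
  has_type x A U f.
Proof.
move=> AU sU fN xN dq; split=> // a; case: (leqP a N) => aN; first exact: dq.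
have full b : (N <= b)%N -> qker x A b U = U.
  move=> Nb; apply/vspaceP => u; rewrite mem_qker andb_idr // => uU.
  by rewrite -(subnK Nb) exprD_mulmx xN // mulmx0 mem0v.
have := dq N (leqnn N); rewrite !full ?(ltnW aN) // => ->; congr (_ + _)%N.
by apply: eq_bigr => r _; have := fN r; lia.
Qed.

Lemma has_type_nilp x U f : (forall r, (f r <= N)%N) -> (\sum_(r < N) f r = \dim U)%N ->
  has_type x 0 U f -> forall u, u \in U -> x ^+ N *m u = 0.
Proof.
move=> fN sf [_ /(_ N)]; rewrite dimv0 add0n.
rewrite (eq_bigr (fun r : 'I_N => f r)) => [|r _]; last exact/minn_idPl.
rewrite sf => dq u uU; have : u \in qker x 0 N U.
  by have /eqP -> : qker x 0 N U == U by rewrite eqEdim qker_sub dq leqnn.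
by rewrite mem_qker memv0 => /andP[_ /eqP].
Qed.

Lemma has_type_refl x A : stab x A -> has_type x A A (fun=> 0%N).
Proof.
move=> sA; split=> // a; rewrite big1 => [|r _]; last by rewrite min0n.
rewrite addn0; congr (\dim _); apply/vspaceP => u; rewrite mem_qker andb_idr // => uA.
exact: stab_exp.
Qed.

(* The numerical hypothesis says that x has no Jordan block of size j.+1 on U. *)
Lemma qker_no_block x U j : stab x U ->
    (\dim (qker x 0 j.+2 U) + \dim (qker x 0 j U) = 2 * \dim (qker x 0 j.+1 U))%N ->
  (qker x 0 j.+1 U <= qker x 0 j U + mv x (qker x 0 j.+2 U))%VS.
Proof.
move=> sU D; set K := fun a => qker x 0 a U.
have dx a : (\dim (mv x (K a.+1)) + \dim (K 1%N) = \dim (K a.+1))%N.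
  rewrite -(dim_qker x 1 (K a.+1)) expr1 addnC; congr (\dim _ + _)%N.
  apply/vspaceP => u; rewrite !mem_qker !memv0 expr1; case: (u \in U) => //=.
  by rewrite andbC andb_idr // => /eqP xu; rewrite exprSr_mulmx xu mulmx0.
have cap : (K j :&: mv x (K j.+2))%VS = mv x (K j.+1).
  apply/vspaceP => w; rewrite memv_cap; apply/andP/mvP => [[wK /mvP[u uK wE]]|[u uK ->]].
    exists u => //; move: wK uK; rewrite wE !mem_qker !memv0 -exprSr_mulmx.
    by case/andP => _ -> /andP[->].
  move: uK; rewrite mem_qker memv0 => /andP[uU /eqP xu]; split.
    by rewrite mem_qker sU // -exprSr_mulmx xu mem0v.
  by apply: mem_mv; rewrite mem_qker uU exprS_mulmx xu mulmx0 mem0v.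
have sub : (K j + mv x (K j.+2) <= K j.+1)%VS.
  rewrite subv_add qker_mono ?leqnSn //=; last exact: stab0.
  apply: mv_sub => u; rewrite !mem_qker !memv0 => /andP[uU /eqP xu].
  by rewrite sU // -exprSr_mulmx xu eqxx.
suff /eqP -> : (K j + mv x (K j.+2) == K j.+1)%VS by [].
rewrite eqEdim sub /=; have := dimv_sum_cap (K j) (mv x (K j.+2)); rewrite cap.
have := dx j; have := dx j.+1; move: D; rewrite -/(K j) -/(K j.+1) -/(K j.+2); lia.
Qed.

Lemma hyper_type_exists x H U g : (H <= U)%VS -> \dim U = (\dim H).+1 -> stab x H ->
    (forall u, u \in U -> x *m u \in H) -> (forall u, u \in U -> x ^+ N *m u = 0) ->
    (forall r, g r.+1 <= g r)%N -> (forall r, (N <= r)%N -> g r = 0%N) -> has_type x 0 U g ->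
  exists f r0, [/\ (r0 < N)%N, forall r, g r = (f r + (r == r0))%N,
    forall r, (f r.+1 <= f r)%N & has_type x 0 H f].
Proof.
move=> HU dU sH xU xN gn gN ty; have sU := ty.1.
have exj : exists j, ~~ (qker x 0 j U <= H)%VS.
  exists N; have -> : qker x 0 N U = U.
    by apply/vspaceP => u; rewrite mem_qker andb_idr // => uU; rewrite xN // mem0v.
  by apply/negP => /dimvS; rewrite dU ltnn.
case: (ex_minnP exj) => -[|j] nj jmin.
  case/negP: nj; apply/subvP => u; rewrite mem_qker expr0_mulmx => /andP[_].
  by rewrite memv0 => /eqP ->; apply: mem0v.
have lo : (qker x 0 j U <= H)%VS.
  by apply/negPn/negP => /jmin; rewrite ltnn.
have [c cE] : exists c : nat -> nat, forall a, c a = (\sum_(r < N) (a < g r))%N by eexists.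
have dq a : \dim (qker x 0 a.+1 U) = (\dim (qker x 0 a U) + c a)%N.
  by rewrite !ty.2 sum_minnSr addnA cE.
have cP a r : (r < N)%N -> (r < c a)%N = (a < g r)%N.
  by rewrite cE; apply: (@sum_prefix N (fun r => a < g r)%N) => r' /leq_trans; apply.
have cj : (c j.+1 < c j)%N.
  have le : (c j.+1 <= c j)%N by rewrite !cE; apply: leq_sum => r _; case: ltnP => // /ltnW ->.
  rewrite ltn_neqAle le andbT; apply/eqP => E; case/negP: nj.
  have D : (\dim (qker x 0 j.+2 U) + \dim (qker x 0 j U) = 2 * \dim (qker x 0 j.+1 U))%N.
    rewrite (dq j.+1) (dq j) E; move: (\dim _) (c j) => p q; lia.
  apply: subv_trans (qker_no_block sU D) _.
  by rewrite subv_add lo /=; apply: mv_sub => u /(subvP (qker_sub _ _ _ _)); apply: xU.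
have cN : (c j <= N)%N.
  by rewrite cE -[X in (_ <= X)%N](card_ord N) -sum1_card; apply: leq_sum => r _; case: ltnP.
have r0N : ((c j).-1 < N)%N by lia.
have gr0 : g (c j).-1 = j.+1.
  have := cP j _ r0N; have := cP j.+1 _ r0N.
  have -> : ((c j).-1 < c j)%N by lia.
  have -> : ((c j).-1 < c j.+1)%N = false by lia.
  by move=> *; lia.
have gc : (g (c j) <= j)%N.
  case: (ltnP (c j) N) => cjN; last by rewrite gN.
  by rewrite leqNgt -cP // ltnn.
pose f r := (g r - (r == (c j).-1))%N.
have gE r : g r = (f r + (r == (c j).-1))%N.
  by rewrite /f subnK //; case: eqP => // ->; rewrite gr0.
have fn r : (f r.+1 <= f r)%N.
  rewrite /f; have := gn r; case: (eqVneq r (c j).-1) => [->|_]; last by lia.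
  by rewrite prednK ?gr0; [lia | lia].
exists f, (c j).-1; split=> //.
apply: (hyper_type (@stab0 k N x) HU dU sH r0N gE ty); rewrite gr0 //.
Qed.

Lemma tableau_exists x U nu F : full_flag U F -> (forall i, (i <= \dim U)%N -> stab x (F i)) ->
    x ^+ N = 0 -> jordan_type x U nu ->
  exists2 T, is_std nu T & forall i, (i <= \dim U)%N -> has_type x 0 (F i) (rowle T i).
Proof.
move=> [dF FS Ftop] sF xN ty; have [pnu _] := ty; set d := \dim U in dF FS Ftop sF pnu *.
have xN0 u : x ^+ N *m u = 0 by rewrite xN mul0mx.
suff [g [gd gn gz gt gS]] : exists g : nat -> nat -> nat,
    [/\ forall r, g d r = nth 0%N nu r,
        forall i r, (0 <= i <= d)%N -> (g i r.+1 <= g i r)%N,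
        forall i r, (0 <= i <= d)%N -> (N <= r)%N -> g i r = 0%N,
        forall i, (0 <= i <= d)%N -> has_type x 0 (F i) (g i) &
        forall i, (0 <= i < d)%N -> exists r0, forall r, g i.+1 r = (g i r + (r == r0))%N].
  have g0 r : g 0%N r = 0%N.
    case: (ltnP r N) => rN; last by apply: gz.
    have [_ /(_ 1%N)] := gt 0%N isT; rewrite (_ : qker x 0 1 (F 0%N) = 0%VS).
      rewrite dimv0 => /esym/eqP; rewrite sum_nat_eq0 => /forallP/(_ (Ordinal rN))/=.
      by move=> /eqP; lia.
    apply/eqP; rewrite -subv0; apply: subv_trans (qker_sub _ _ _ _) _.
    by rewrite subv0 -dimv_eq0 dF.
  exists (tableau_of_chain nu d g).
    by apply: std_tableau_of_chain => // i; apply: gS.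
  move=> i id; apply: eq_has_type (gt i id) => r _.
  rewrite (rowle_tableau_of_chain g0) //.
suff H m : (m <= d)%N -> exists g : nat -> nat -> nat,
    [/\ forall r, g d r = nth 0%N nu r,
        forall i r, (d - m <= i <= d)%N -> (g i r.+1 <= g i r)%N,
        forall i r, (d - m <= i <= d)%N -> (N <= r)%N -> g i r = 0%N,
        forall i, (d - m <= i <= d)%N -> has_type x 0 (F i) (g i) &
        forall i, (d - m <= i < d)%N -> exists r0, forall r, g i.+1 r = (g i r + (r == r0))%N].
  by have := H d (leqnn d); rewrite subnn.
elim: m => [_|m IH md].
  exists (fun _ r => nth 0%N nu r); split=> // [i r _|i r _ Nr|i id|i id].
  - exact: partition_noninc pnu r.
  - by rewrite nth_default // (leq_trans (partition_size pnu)) // (leq_trans (dim_le _)).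
  - have -> : i = d by lia.
    by rewrite Ftop; apply: jordan_has_type.
  - lia.
have [g [gd gn gz gt gS]] := IH (ltnW md).
have E : (d - m)%N = (d - m.+1).+1 by lia.
have dm : (d - m <= d - m <= d)%N by lia.
set i0 := (d - m.+1)%N in E *.
have i0d : (i0 < d)%N by rewrite /i0; lia.
have [] := @hyper_type_exists x (F i0) (F i0.+1) (g i0.+1).
- exact: FS.
- by rewrite !dF //; lia.
- by apply: sF; lia.
- apply: nilp_hyper => //; [by apply: sF; lia | by apply: sF; lia | exact: FS |].
  by rewrite !dF //; lia.
- by move=> u _; apply: xN0.
- by move=> r; rewrite -E; apply: gn.
- by move=> r; rewrite -E; apply: gz.
- by rewrite -E; apply: gt.
move=> f [r0 [r0N gE fn ft]].
exists (fun i r => if i == i0 then f r else g i r); split.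
- by move=> r; rewrite ifN ?gd //; lia.
- by move=> i r id; case: eqP => // ii; apply: gn; lia.
- move=> i r id Nr; case: eqP => ii; last by apply: gz => //; lia.
  by have := gz i0.+1 r _ Nr; rewrite gE; lia.
- by move=> i id; case: eqP => [->|ii] //; apply: gt; lia.
- move=> i id; have -> : (i.+1 == i0) = false by lia.
  case: eqP => [->|ii]; first by exists r0.
  by apply: gS; lia.
Qed.

Lemma matrix_of_lin (f : {linear kN -> kN}) : exists P : gl, forall u, P *m u = f u.
Proof.
exists (\matrix_(a, b) f (delta_mx b 0) a 0) => u.
rewrite [in RHS](matrix_sum_delta u) linear_sum; apply/colP => a; rewrite mxE summxE.
by apply: eq_bigr => b _; rewrite big_ord1 linearZ !mxE mulrC.
Qed.

(* Relative kernels are thus subject to rank semicontinuity. *)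
Lemma rank_qker A : exists P : gl, forall x a U,
  (\dim (qker x A a U) + \dim (mv (P *m x ^+ a) U) = \dim U)%N.
Proof.
have [P PE'] := matrix_of_lin (projv A).
have PE u : P *m u = projv A u := PE' u.
exists (1%:M - P) => x a U.
have := limg_ker_dim (linfun (mulmx ((1%:M - P) *m x ^+ a) : kN -> kN)) U.
rewrite /mv => <-; congr (\dim _ + _)%N; apply/vspaceP => u; rewrite mem_qker memv_cap.
congr (_ && _); rewrite memv_ker lfunE /= -mulmxA mulmxBl mul1mx PE subr_eq0.
by apply/idP/eqP => [/projv_id|] E; [rewrite E | rewrite E memv_proj].
Qed.

End Types.

Section Fibre.
Variables (k : closedFieldType) (N : nat) (e : 'M[k]_N) (nu : seq nat).
Notation gl := 'M[k]_N.
Notation kN := 'cV[k]_N.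
Hypotheses (eN : e ^+ N = 0) (pnu : partition_of nu N) (tnu : jordan_type e fullv nu).
Implicit Types (T : tableau) (F : nat -> {vspace kN}).
Notation cl := (closure_of (@zclosed_flag k N)).
Notation flags := (@flag_variety k N).
Notation irr := (irreducible (@zclosed_flag k N)).

Definition typed_flag T F := full_flag fullv F /\ forall i, (i <= N)%N -> has_type e 0 (F i) (rowle T i).

Lemma fibre_flags T : Phi_fibre e T `<=` flags.
Proof. by move=> b [[]]. Qed.

Lemma fibreP T F : is_std nu T -> full_flag fullv F ->
  Phi_fibre e T (borel F) <-> forall i, (i <= N)%N -> has_type e 0 (F i) (rowle T i).
Proof.
move=> sT fF; have sh : shape T = nu by case: sT.
split=> [[_ [F' [fF' E sp]]] i iN|H].
  rewrite (borel_inj fF fF' E iN).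
  by have [] := proj1 (spaltensteinP e T (flag_dim fF') (flagS fF')) sp => _ _; apply.
split.
  split; first by exists F.
  by apply/borelP => i iN; case: (H i iN).
exists F; split=> //; apply/(spaltensteinP e T (flag_dim fF) (flagS fF)).
by rewrite sh.
Qed.

Lemma fibre_ex T b : is_std nu T -> Phi_fibre e T b -> exists2 F, typed_flag T F & b = borel F.
Proof.
move=> sT fb; have [_ [F [fF E _]]] := fb; exists F => //; split=> //.
by apply/(fibreP sT fF); rewrite -E.
Qed.

Lemma std_size_N T : is_std nu T -> (size T <= N)%N.
Proof. by move=> /size_std ->; apply: partition_size pnu. Qed.

Lemma rowle_ge_N T i r : is_std nu T -> (N <= r)%N -> rowle T i r = 0%N.
Proof. by move=> sT Nr; rewrite /rowle nth_default // (leq_trans (std_size_N sT)). Qed.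

Lemma rowle_leN T i r : is_std nu T -> (rowle T i r <= N)%N.
Proof. move=> sT; apply: leq_trans (rowle_max sT i r) _; exact: partition_nth_le pnu. Qed.

Lemma step_row T i : is_std nu T -> (i < N)%N ->
  exists2 r0, (r0 < N)%N & forall r, rowle T i.+1 r = (rowle T i r + (r == r0))%N.
Proof.
move=> sT iN; have [r0 r0T H] := rowle_step pnu sT iN; exists r0 => //.
exact: leq_trans r0T (std_size_N sT).
Qed.

Lemma typed_flag_exists T : is_std nu T -> exists F, typed_flag T F.
Proof.
move=> sT.
suff H m : (m <= N)%N -> exists F, [/\ F N = fullv,
    forall i, (N - m <= i <= N)%N -> \dim (F i) = i,
    forall i, (N - m <= i < N)%N -> (F i <= F i.+1)%VS &
    forall i, (N - m <= i <= N)%N -> has_type e 0 (F i) (rowle T i)].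
  have [F [Ft dF FS FT]] := H N (leqnn N); rewrite subnn in dF FS FT.
  by exists F; split=> //; split; rewrite dimN.
elim: m => [_|m IH mN].
  exists (fun=> fullv); split=> // i iN; first by rewrite dimN; lia.
  have -> : i = N by lia.
  apply: eq_has_type (jordan_has_type tnu) => r _.
  by rewrite (rowle_full pnu sT).
have [F [Ft dF FS FT]] := IH (ltnW mN).
have E : (N - m)%N = (N - m.+1).+1 by lia.
set i0 := (N - m.+1)%N in E *; have i0N : (i0 < N)%N by rewrite /i0; lia.
have [r0 r0N rS] := step_row sT i0N.
have [|H [HF dH tH]] := hyper_exists eN (rowle_noninc pnu sT i0) r0N rS (FT i0.+1 _); first by lia.
exists (fun i => if i == i0 then H else F i); split.
- by rewrite ifN //; lia.
- move=> i id; case: eqP => [->|ii]; last by apply: dF; lia.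
  by apply: succn_inj; rewrite -dH dF //; lia.
- move=> i id; have -> : (i.+1 == i0) = false by lia.
  by case: eqP => [->|ii] //; apply: FS; lia.
- by move=> i id; case: eqP => [->|ii] //; apply: FT; lia.
Qed.

Lemma fibre_stratum T F0 : is_std nu T -> typed_flag T F0 ->
  Phi_fibre e T = stratum e (@zflag k N) F0.
Proof.
move=> sT [fF0 tF0]; apply/seteqP; split=> [b fb|b [F [fF H] ->]].
  have [F [fF tF] ->] := fibre_ex sT fb; exists F => //; split=> // l lN.
  have [sl tl] := tF l (proj2 (andP lN)); split=> // [|b']; first exact: sub0v.
  by rewrite tl (tF0 l (proj2 (andP lN))).2.
apply/(fibreP sT fF) => -[|i] iN.
  rewrite (flag0 fF); apply: eq_has_type (has_type_refl (@stab0 _ _ e)) => r _.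
  by rewrite (rowle0 pnu sT).
have [_ sl tl] := H i.+1 iN; split=> // a.
by rewrite tl (tF0 i.+1 iN).2.
Qed.

Lemma typed_instrat T F0 : typed_flag T F0 -> instrat e (@zflag k N) F0 F0.
Proof.
move=> [fF0 tF0]; split=> // l lN; split=> //; first exact: sub0v.
by case: (tF0 l (proj2 (andP lN))).
Qed.

Lemma fibre_irreducible T : is_std nu T -> irr (Phi_fibre e T).
Proof.
move=> sT; have [F tF] := typed_flag_exists sT; rewrite (fibre_stratum sT tF).
apply: stratum_irreducible => //; first exact: typed_instrat tF.
- exact: A0_stab.
Qed.

Lemma C_irreducible T : is_std nu T -> irr (C e T).
Proof. by move=> sT; apply: irreducible_closure (fibre_irreducible sT); apply: fibre_flags. Qed.

Lemma closure_springer S : S `<=` springer e -> cl S `<=` springer e.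
Proof.
move=> SX; have SB : S `<=` flags by move=> b /SX[].
move=> b clb; have [F fF bE] := closure_flags SB clb; split; first by exists F.
have clF : cl S (borel (act 1%:M F)) by rewrite act1 -bE.
have rx := @funring_polymx k N.
have /(closureP fF (unitmx1 _ _) SB) van := clF.
pose M h : gl := \adj h *m e *m h.
have pM : fr_mx (@polymx k N) M.
  apply: (fr_mx_mul rx); last exact: polymx_coord.
  apply: (fr_mx_mul rx); last exact: (fr_mx_const rx).
  by apply: (fr_adj rx); apply: polymx_coord.
have ME h : h \in unitmx -> (M h \in borel F) = (e \in borel (act h F)).
  move=> hu; rewrite -AdV_borel // memv_AdV // /M.
  have dh : \det h != 0 by rewrite -unitfE -unitmxE.
  have -> : \adj h = \det h *: invmx h by rewrite /invmx hu scalerA divff // scale1r.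
  by rewrite -!scalemxAl rpredZeq (negPf dh).
have : M 1%:M \in borel F.
  suff <- : projv (borel F) (M 1%:M) = M 1%:M by exact: memv_proj.
  apply/esym/eqP; rewrite -subr_eq0; apply/eqP/matrixP => a c; rewrite [RHS]mxE.
  apply: (van (fun h => (M h - projv (borel F) (M h)) a c)); split=> [|x xu Sx].
    apply: (fr_eq (f := fun h => M h a c + (-1) * projv (borel F) (M h) a c)) => [h|].
      by rewrite mulN1r [RHS]mxE [X in _ = _ + X]mxE.
    apply: (fr_add rx); first exact: pM.
    apply: (fr_mul rx); first exact: (fr_const rx).
    by apply: (polymx_comp rx (f := fun x => projv (borel F) x a c)) pM; apply: polymx_lin.
  by rewrite projv_id ?subrr ?mxE // ME //; case: (SX _ Sx).
by rewrite ME ?unitmx1 // act1 bE.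
Qed.

Lemma C_springer T : C e T `<=` springer e.
Proof. by apply: closure_springer => b []. Qed.

(* The rank conditions which determine the Jordan types on the terms of a flag,
   relative to the kernels of the matrices in Ps. *)
Definition probes (Ps : seq gl) : seq (gl * nat) :=
  [seq (Q, l) | Q <- [seq P *m e ^+ a | P <- Ps, a <- iota 0 N.+1], l <- iota 0 N.+1].

Lemma probes_le Ps : all (fun m => m.2 <= N)%N (probes Ps).
Proof.
apply/allP => -[Q l] /allpairsP[[Q' l'] [_ l'N [_ ->]]].
by move: l'N; rewrite mem_iota add0n ltnS.
Qed.

Lemma mem_probes Ps P a l : P \in Ps -> (a <= N)%N -> (l <= N)%N -> (P *m e ^+ a, l) \in probes Ps.
Proof.
move=> PP aN lN; apply/allpairsP; exists (P *m e ^+ a, l); split=> //; last by rewrite mem_iota.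
by apply/allpairsP; exists (P, a); split=> //; rewrite mem_iota.
Qed.

Lemma springer_covered X : X `<=` springer e -> irr X ->
  exists2 T, is_std nu T & X `<=` C e T.
Proof.
move=> XS iX; have XB : X `<=` flags by move=> b /XS[].
have [F [fF XF Xcl]] := irreducible_generic XB (probes_le [:: 1%:M]) iX.
have sF i : (i <= N)%N -> stab e (F i).
  by move=> iN; have [_ /borelP] := XS _ XF; apply.
have [T sT tT] : exists2 T, is_std nu T & forall i, (i <= N)%N -> has_type e 0 (F i) (rowle T i).
  by have := @tableau_exists k N e fullv nu F fF; rewrite dimN; apply.
exists T => //; apply: subset_trans Xcl _; apply: closureS => b [Xb H].
have [F' fF' bE] := XB _ Xb; rewrite bE; apply/(fibreP sT fF') => i iN.
apply: has_type_upto => [||r|u _|a aN].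
- exact: sub0v.
- by have [_] := XS _ Xb; rewrite bE => /borelP; apply.
- exact: rowle_leN.
- by rewrite eN mul0mx.
have := H F' fF' bE _ (mem_probes (mem_head _ _) aN iN); rewrite /= mul1mx => E.
have := dim_qker e a (F' i); have := dim_qker e a (F i); rewrite E !flag_dim //.
by rewrite -(tT i iN).2; lia.
Qed.

Lemma closure_rowle T T' : is_std nu T -> is_std nu T' -> C e T = C e T' -> T = T'.
Proof.
move=> sT sT' E.
have sub S S' F F' : is_std nu S -> is_std nu S' -> C e S = C e S' -> typed_flag S F -> typed_flag S' F' ->
    forall i a, (i <= N)%N -> (\dim (mv (e ^+ a) (F i)) <= \dim (mv (e ^+ a) (F' i)))%N.
  move=> sS sS' ES [fF tF] [fF' tF'] i a iN.
  apply: (closure_rank_le (S := Phi_fibre e S') fF) => //; first exact: fibre_flags.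
    move=> G fG /(fibreP sS' fG)/(_ i iN) tG.
    have := dim_qker e a (G i); have := dim_qker e a (F' i); rewrite !flag_dim //.
    by rewrite tG.2 (tF' i iN).2; lia.
  have : C e S (borel F) by apply: sub_closure; apply/(fibreP sS fF).
  by rewrite ES.
have [F tF] := typed_flag_exists sT; have [F' tF'] := typed_flag_exists sT'.
apply: (std_inj pnu pnu sT sT') => i r iN.
case: (ltnP r N) => rN; last by rewrite !rowle_ge_N.
apply: (@sum_minn_inj N) => // [r'|r'|a]; first exact: rowle_noninc pnu sT i r'.
  exact: rowle_noninc pnu sT' i r'.
have le1 := sub T T' F F' sT sT' E tF tF' i a iN.
have le2 := sub T' T F' F sT' sT (esym E) tF' tF i a iN.
have [fF tyF] := tF; have [fF' tyF'] := tF'.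
have := dim_qker e a (F i); have := dim_qker e a (F' i); rewrite !flag_dim //.
by rewrite (tyF i iN).2 (tyF' i iN).2 dimv0; lia.
Qed.

(* A box in row r contributes r to the dimension of the fibre. *)
Lemma level_sum T F (j s : nat -> nat) v th : is_std nu T -> typed_flag T F ->
    (forall i, (0 < i <= N)%N -> level e (@zflag k N) F i (j i) (v i) (s i) (th i)) ->
  (\sum_(m < N) s m.+1 = \sum_(r < N) r * nth 0%N nu r)%N.
Proof.
move=> sT [fF tF] lv.
have step i : (i < N)%N -> (s i.+1 < N)%N /\ forall r, rowle T i.+1 r = (rowle T i r + (r == s i.+1))%N.
  move=> iN; have [r0 r0N rS] := step_row sT iN.
  have lvi : level e (@zflag k N) F i.+1 (j i.+1) (v i.+1) (s i.+1) (th i.+1) by apply: lv.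
  have ti := tF _ (ltnW iN); have tS := tF _ iN.
  have [lo hi] := hyper_threshold (flagS fF iN) r0N rS tS ti.
  have gp : (0 < rowle T i.+1 r0)%N by rewrite rS eqxx addn1.
  have jE : j i.+1 = rowle T i.+1 r0.
    apply/eqP; rewrite eqn_leq; apply/andP; split; rewrite leqNgt; apply/negP => lt.
      have := hi (j i.+1).-1; rewrite (lv_lo lvi) => H; have : ~~ true by apply: H; lia.
      by [].
    have /subvP/(_ _ (lv_v lvi)) := lo _ lt; have := lv_vH lvi; rewrite /= => /negP; exact.
  have := lv_dim lvi erefl; rewrite !tS.2 dimv0 jE -{2}(prednK gp) sum_minnSr.
  suff -> : (\sum_(r < N) ((rowle T i.+1 r0).-1 < rowle T i.+1 r) = r0.+1)%N.
    by rewrite addnC add0n => /addnI[->].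
  have := @sum_prefix N (fun r => (rowle T i.+1 r0).-1 < rowle T i.+1 r)%N.
  set c := (\sum_(r < N) _)%N => cP.
  have {}cP := cP (fun r H => leq_trans H (rowle_noninc pnu sT i.+1 r)).
  have r0c : (r0 < c)%N by rewrite cP // prednK.
  apply/eqP; rewrite eqn_leq r0c andbT leqNgt; apply/negP => lt.
  have cN : (c <= N)%N.
    by rewrite -[X in (_ <= X)%N](card_ord N) -sum1_card; apply: leq_sum => r _; case: ltnP.
  have := cP r0.+1 (leq_trans lt cN); rewrite lt => /esym.
  have := rowle_noninc pnu sT i r0; rewrite !rS eqxx; lia.
suff H m : (m <= N)%N -> (\sum_(i < m) s i.+1 = \sum_(r < N) r * rowle T m r)%N.
  rewrite H //; apply: eq_bigr => r _; by rewrite (rowle_full pnu sT).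
elim: m => [_|m IH mN].
  by rewrite big_ord0 big1 // => r _; rewrite (rowle0 pnu sT) muln0.
have [sN sE] := step m mN; rewrite big_ord_recr /= IH ?(ltnW mN) //.
under [RHS]eq_bigr => r _ do rewrite sE mulnDr.
rewrite big_split /=; congr (_ + _)%N; rewrite (bigD1 (Ordinal sN)) //= eqxx muln1.
by rewrite big1 ?addn0 // => r rs; rewrite (_ : (_ == _) = false) ?muln0 //; apply/negP => /eqP E; case/negP: rs; apply/eqP/val_inj.
Qed.

Lemma C_sub T T' : is_std nu T -> is_std nu T' -> C e T `<=` C e T' -> C e T' `<=` C e T.
Proof.
move=> sT sT' sub; have [F tF] := typed_flag_exists sT; have [F' tF'] := typed_flag_exists sT'.
have sF := typed_instrat tF; have sF' := typed_instrat tF'.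
have [j [s [v [th lv]]]] := levels_exist eN sF.
have [j' [s' [v' [th' lv']]]] := levels_exist eN sF'.
have E : (\sum_(m < N) s' m.+1 = \sum_(m < N) s m.+1)%N.
  by rewrite (level_sum sT tF lv) (level_sum sT' tF' lv').
have := stratum_closure_sym eN sF' sF lv' lv E.
rewrite -(fibre_stratum sT tF) -(fibre_stratum sT' tF') => H.
apply: closure_least; apply: H; apply: subset_trans sub; exact: sub_closure.
Qed.

Lemma C_component T : is_std nu T -> Comp e (C e T).
Proof.
move=> sT; split; [exact: C_springer | exact: C_irreducible |].
move=> X XS iX CX; have [T' sT' XT'] := springer_covered XS iX.
apply/seteqP; split=> //; apply: (subset_trans XT') _; apply: C_sub => //.
exact: subset_trans CX XT'.
Qed.

Lemma Phi_C T : is_std nu T -> Phi e nu (C e T) = T.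
Proof.
move=> sT; rewrite /Phi; case: xgetP => [T' _ [sT' E]|/(_ T)]; last by case.
exact: closure_rowle.
Qed.

End Fibre.

(** * Stacking *)

Section Stacked.
Variables (k : closedFieldType) (N n : nat) (V : 'I_n -> {vspace 'cV[k]_N}).
Notation gl := 'M[k]_N.
Notation kN := 'cV[k]_N.
Hypotheses (dV : directv (\sum_(i < n) V i)%VS) (fV : (\sum_(i < n) V i)%VS = fullv).
Variables (lam : n.-tuple nat) (mu : n.-tuple (seq nat)).
Hypothesis lamV : forall i, \dim (V i) = tnth lam i.
Hypothesis lam0 : forall i, (0 < \dim (V i))%N.
Hypothesis lmu : forall i, partition_of (tnth mu i) (tnth lam i).
Variables (e0 z : gl).
Notation e := (e0 + z).
Hypotheses (e0O : nilp_orbit V mu e0) (zn : z \in nilradical V)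
  (eInd : Ind V (nilp_orbit V mu) e).
Implicit Types (sg : n.-tuple tableau) (F : nat -> {vspace kN}) (G : 'I_n -> nat -> {vspace kN}).

Notation Lam := (psum (fun i => \dim (V i))).
Notation Wn := (Wn V).
Notation m := (fun l r => nth 0%N (tnth mu l) r).
Notation Rs := (row_sum mu).
Notation cl := (closure_of (@zclosed_flag k N)).
Notation flags := (@flag_variety k N).
Notation irr := (irreducible (@zclosed_flag k N)).
Notation nuS := (muSigma mu).

Let e0L : e0 \in levi V := e0O.1.
Let e0mu : forall i, jordan_type e0 (V i) (tnth mu i) := e0O.2.

Let pmu i : partition_of (tnth mu i) (\dim (V i)).
Proof. by rewrite lamV. Qed.

Let LamE j : psum (tnth lam) j = Lam j.
Proof. by apply: eq_bigr => l _; rewrite lamV. Qed.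

Let sumlam : (\sum_(l < n) tnth lam l = N)%N.
Proof. by rewrite -psum_all LamE (Lam_all dV fV). Qed.

Let top := induced_top dV fV pmu e0O eInd.

Lemma W_type j : (j <= n)%N -> has_type e 0 (Wn j) (Rs j).
Proof. exact: Wn_type. Qed.

Lemma e_nilp : e ^+ N = 0.
Proof. exact: (induced_nilp dV fV pmu e0L zn e0mu top). Qed.

Lemma e0_nilp : e0 ^+ N = 0.
Proof.
apply/matrixP => a b; suff /matrixP/(_ a 0) : e0 ^+ N *m delta_mx b 0 = 0 :> kN.
  by rewrite -colE !mxE.
have : (delta_mx b 0 : kN) \in (\sum_(i < n) V i)%VS by rewrite fV memvf.
case/memv_sumP => us usV ->; rewrite mulmx_sumr big1 // => i _.
apply: (has_type_nilp _ _ (jordan_has_type (e0mu i))); last exact: usV.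
  by move=> r; apply: leq_trans (partition_nth_le r (pmu i)) (dim_le _).
exact: partition_sum (pmu i) (dim_le _).
Qed.

Lemma partition_nuS : partition_of nuS N.
Proof. by rewrite -{1}sumlam; apply: partition_muSigma. Qed.

Lemma e_jordan : jordan_type e fullv nuS.
Proof.
apply: has_type_jordan; first by rewrite dimN; apply: partition_nuS.
have := W_type (leqnn n); rewrite Wn_all //; apply: eq_has_type => r _.
by rewrite nth_muSigma row_sumE psum_all.
Qed.

Lemma stk_isstd sg : (forall i, is_std (tnth mu i) (tnth sg i)) -> is_std nuS (stk lam mu sg).
Proof. by move=> ssg; apply: stk_std. Qed.

Lemma Lam_lt (j : 'I_n) : (Lam j < Lam j.+1)%N.
Proof. by rewrite psumS -[X in (X < _)%N]addn0 ltn_add2l. Qed.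

(* The space W_j below the block j which contains the index l. *)
Definition Al (l : nat) : {vspace kN} := (\sum_(i < n | (Lam i.+1 < l)%N) V i)%VS.

Lemma Al_block (j : 'I_n) l : (Lam j < l <= Lam j.+1)%N -> Al l = Wn j.
Proof.
move=> /andP[jl lj]; apply: eq_bigl => i; case: (ltnP i j) => ij.
  by apply: leq_ltn_trans jl; apply: leq_psum.
by apply/negbTE; rewrite -leqNgt; apply: leq_trans lj _; apply: leq_psum.
Qed.

Lemma block l : (0 < l <= N)%N -> exists j : 'I_n, (Lam j < l <= Lam j.+1)%N.
Proof.
case: l => // l /= lN; have [j jl] := block_exists dV fV lN; exists j; lia.
Qed.

Lemma Al_stab l : (0 < l <= N)%N -> stab e (Al l).
Proof.
move=> /block[j jl]; rewrite (Al_block jl); apply: e_stab_Wn => //; exact: ltnW.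
Qed.

Lemma Al_top i : (0 < i <= N)%N -> Al (\dim (Al i)).+1 = Al i.
Proof.
move=> /block[j ji]; rewrite (Al_block ji) (dim_Wn dV fV); apply: Al_block.
by rewrite leqnn Lam_lt.
Qed.

Lemma Al_eq l i : (0 < l <= i)%N -> (i <= N)%N -> (\dim (Al i) < l)%N -> Al l = Al i.
Proof.
move=> li iN; have /block[j ji] : (0 < i <= N)%N by lia.
rewrite (Al_block ji) (dim_Wn dV fV) => jl; apply: Al_block; lia.
Qed.

Lemma in_block (j : 'I_n) i : (i <= \dim (V j))%N -> (Lam j + i <= N)%N.
Proof. by move=> id; apply: leq_trans (Lam_le_N dV fV j.+1); rewrite psumS leq_add2l. Qed.

Section Tableaux.
Variable sg : n.-tuple tableau.
Hypothesis ssg : forall i, is_std (tnth mu i) (tnth sg i).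

Notation X := (LS V @` Phi0_fibre V e0 sg).
Notation tau := (stk lam mu sg).
Notation Y := (Phi_fibre e tau).

Definition block_typed F := (forall j, (j <= n)%N -> F (Lam j) = Wn j) /\
  forall (j : 'I_n) i, (i <= \dim (V j))%N ->
    has_type e (Wn j) (F (Lam j + i)%N) (rowle (tnth sg j) i).

Lemma LS_fibreP F : full_flag fullv F -> X (borel F) <-> block_typed F.
Proof.
move=> fF; split.
  case=> b0 [[_ e0b] [G [fG bE sp]]]; rewrite bE LS_borel // => E.
  have FE i : (i <= N)%N -> F i = comb V G i.
    by move=> iN; apply: (borel_inj fF (comb_full dV fV fG)).
  split=> [j jn|j i id]; first by rewrite FE ?comb_Wn // (Lam_le_N dV fV).
  rewrite FE ?in_block // (comb_block (j := j) dV fG); last by rewrite psumS; lia.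
  rewrite addKn; apply/has_type_block => //; first exact: flags0_sub.
  have [dG GS _] := fG j.
  by have [_ _] := proj1 (spaltensteinP e0 (tnth sg j) dG GS) (sp j); apply.
move=> [FW FT]; have [fG GE] := split_flag dV fV fF FW.
set G := (fun j i => _) in fG GE.
have Gt j i : (i <= \dim (V j))%N -> has_type e0 0 (G j i) (rowle (tnth sg j) i).
  move=> id; apply/(has_type_block dV fV e0L zn) => //; first exact: flags0_sub.
  have := FT j i id; rewrite GE ?in_block // (comb_block (j := j) dV fG); last by rewrite psumS; lia.
  by rewrite addKn.
exists (borel0 V G); last by rewrite LS_borel //; apply: eq_borel => i iN; rewrite -GE.
split.
  split; first by exists G.
  by apply/borel0P; split=> // j i id; case: (Gt j i id).
exists G; split=> // j; have [dG GS _] := fG j; apply/(spaltensteinP e0 (tnth sg j) dG GS).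
have -> : shape (tnth sg j) = tnth mu j by case: (ssg j).
by split=> // i id; apply: Gt.
Qed.

Lemma LS_fibre_flags : X `<=` flags.
Proof. by move=> _ [b0 [[Bb0 _] _] <-]; apply: LS_flags. Qed.

Lemma block_typed_le F j i : full_flag fullv F -> block_typed F -> (i <= \dim (V j))%N ->
  (Wn j <= F (Lam j + i)%N)%VS.
Proof.
move=> fF [FW _] id; rewrite -(FW j) ?(ltnW (ltn_ord j)) //.
by apply: (flag_mono fF); rewrite leq_addr in_block.
Qed.

Lemma LS_fibre_stratum F0 : full_flag fullv F0 -> block_typed F0 ->
  X = stratum e Al F0 /\ instrat e Al F0 F0.
Proof.
move=> fF0 bF0.
have sub F : full_flag fullv F -> block_typed F -> instrat e Al F0 F.
  move=> fF bF; split=> // l lN; have [j jl] := block lN; rewrite (Al_block jl).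
  have id : (l - Lam j <= \dim (V j))%N by move: jl; rewrite psumS; lia.
  have lE : l = (Lam j + (l - Lam j))%N by lia.
  have lE' : l.-1 = (Lam j + (l - Lam j).-1)%N by lia.
  have := bF.2 j _ id; have := bF0.2 j _ id; rewrite -lE => t0 [sl tl]; split=> //.
    by rewrite lE'; apply: block_typed_le => //; lia.
  by move=> b; rewrite tl t0.2.
split; last exact: sub.
apply/seteqP; split=> [b Xb|b [F [fF H] ->]].
  have [F fF bE] := LS_fibre_flags Xb; exists F => //; apply: sub => //.
  by apply/(LS_fibreP fF); rewrite -bE.
have iF : instrat e Al F0 F by [].
have FW j : (j <= n)%N -> F (Lam j) = Wn j.
  rewrite leq_eqVlt => /orP[/eqP ->|jn].
    by rewrite (Lam_all dV fV) Wn_all // (flag_top fF).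
  have jl : (Lam (Ordinal jn) < (Lam j).+1 <= Lam j.+1)%N by rewrite leqnn (Lam_lt (Ordinal jn)).
  have lN : (0 < (Lam j).+1 <= N)%N by rewrite /=; apply: leq_trans (Lam_lt (Ordinal jn)) (Lam_le_N dV fV _).
  by have := flag_dimA (sub F0 fF0 bF0) Al_top iF lN; rewrite (Al_block jl) (dim_Wn dV fV).
apply/(LS_fibreP fF); split=> // j [|i] id.
  rewrite addn0 (FW _ (ltnW (ltn_ord j))).
  have sW : stab e (Wn j) by apply: e_stab_Wn => //; apply: ltnW.
  by apply: eq_has_type (has_type_refl sW) => r _; rewrite (rowle0 (pmu j) (ssg j)).
have lN : (0 < Lam j + i.+1 <= N)%N by rewrite in_block // addnS.
have jl : (Lam j < Lam j + i.+1 <= Lam j.+1)%N by rewrite psumS leq_add2l id addnS ltnS leq_addr.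
have [_ sl] := H _ lN; rewrite (Al_block jl) => tl; split=> // a.
by rewrite tl (bF0.2 j _ id).2.
Qed.

Lemma rowle_tau (j : 'I_n) i r : (i <= \dim (V j))%N ->
  rowle tau (Lam j + i) r = (Rs j r + rowle (tnth sg j) i r)%N.
Proof.
move=> id; rewrite rowle_stk //; last by rewrite sumlam in_block.
rewrite (@stk_chain_block _ lam mu lmu sg ssg j).
  by rewrite LamE addKn row_sumE.
by rewrite !LamE psumS leq_addr leq_add2l.
Qed.

Lemma typed_block_typed F : typed_flag e tau F -> block_typed F.
Proof.
move=> [fF tF].
have blk (j : 'I_n) : F (Lam j.+1) = Wn j.+1 -> forall i, (i <= \dim (V j))%N ->
    (Wn j <= F (Lam j + i)%N)%VS /\ has_type e (Wn j) (F (Lam j + i)%N) (rowle (tnth sg j) i).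
  move=> FW i id; rewrite -(subKn id); elim: (_ - i)%N (leq_subr i (\dim (V j))) => [_|d IH dd].
    rewrite subn0 -psumS FW; split; first exact: Wn_mono.
    apply: eq_has_type (graded_type dV fV e0L zn e0mu j) => r _.
    by rewrite (rowle_full (pmu j) (ssg j)).
  set i' := (\dim (V j) - d.+1)%N.
  have E : (\dim (V j) - d = i'.+1)%N by rewrite /i'; lia.
  have i'd : (i' < \dim (V j))%N by rewrite /i'; lia.
  have [WF tW] := IH (ltnW dd); rewrite E in WF tW.
  have [r0 r0T rS] := rowle_step (pmu j) (ssg j) i'd.
  have r0N : (r0 < N)%N.
    apply: leq_trans r0T _; rewrite (size_std (ssg j)).
    exact: leq_trans (partition_size (pmu j)) (dim_le _).
  have iN : (Lam j + i' < N)%N by rewrite -addnS in_block.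
  apply: (generic_hyper (al := Rs j) (be := rowle (tnth sg j) i'.+1) (r0 := r0)
            (B := F (Lam j + i'.+1)%N)) => //.
  - exact: e_nilp.
  - exact: row_sum_noninc.
  - exact: rowle_noninc (pmu j) (ssg j) _.
  - exact: rowle_noninc (pmu j) (ssg j) _.
  - by apply: W_type; apply: ltnW.
  - by apply: eq_has_type (tF _ (in_block i'd)) => r _; rewrite rowle_tau.
  - by rewrite addnS; apply: (flagS fF).
  - by rewrite addnS !(flag_dim fF) // ltnW.
  - by apply: eq_has_type (tF _ (ltnW iN)) => r _; rewrite rowle_tau // ltnW.
have FW j : (j <= n)%N -> F (Lam j) = Wn j.
  move=> jn; rewrite -(subKn jn); elim: (n - j)%N (leq_subr j n) => [_|d IH dn].
    by rewrite subn0 (Lam_all dV fV) Wn_all // (flag_top fF).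
  have lt : (n - d.+1 < n)%N by lia.
  have E : (n - d = (n - d.+1).+1)%N by lia.
  have := IH (ltnW dn); rewrite E => /(blk (Ordinal lt))/(_ 0%N (leq0n _))/= [].
  rewrite addn0 => WF _; apply/esym/eqP.
  by rewrite eqEdim WF (flag_dim fF) ?(Lam_le_N dV fV) // (dim_Wn dV fV) leqnn.
by split=> // j i id; have [] := blk j (FW _ (ltn_ord j)) i id.
Qed.

Let tau_std : is_std nuS tau := stk_isstd ssg.

Lemma fibre_sub : Y `<=` X.
Proof.
move=> b /(fibre_ex partition_nuS tau_std)[F tF ->].
by apply/(LS_fibreP tF.1)/typed_block_typed.
Qed.

Lemma LS_fibre_irreducible : irr X.
Proof.
have [F tF] := typed_flag_exists e_nilp partition_nuS e_jordan tau_std.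
have [-> sF] := LS_fibre_stratum tF.1 (typed_block_typed tF).
apply: stratum_irreducible => //; first exact: e_nilp.
- exact: Al_stab.
- exact: Al_top.
- exact: Al_eq.
Qed.

Lemma sub_fibre_closure : X `<=` cl Y.
Proof.
have [F tF] := typed_flag_exists e_nilp partition_nuS e_jordan tau_std.
have XF : X (borel F) by apply/(LS_fibreP tF.1)/typed_block_typed.
apply: subset_trans (irreducible_opens tF.1 LS_fibre_flags (probes_le e [:: 1%:M]) LS_fibre_irreducible XF) _.
apply: closureS => b [Xb H]; have [F' fF' bE] := LS_fibre_flags Xb.
have bF' : block_typed F' by apply/(LS_fibreP fF'); rewrite -bE.
rewrite bE; apply/(fibreP e partition_nuS tau_std fF') => i iN.
have sF' : stab e (F' i).
  case: (posnP i) => [->|i0]; first by rewrite (flag0 fF'); apply: stab0.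
  have [j jl] : exists j : 'I_n, (Lam j < i <= Lam j.+1)%N by apply: block; rewrite i0.
  have id : (i - Lam j <= \dim (V j))%N by move: jl; rewrite psumS; lia.
  by have := bF'.2 j _ id; rewrite subnKC; [case | lia].
apply: has_type_upto => // [|r|u _|a aN].
- exact: sub0v.
- exact: (rowle_leN partition_nuS i r tau_std).
- by rewrite e_nilp mul0mx.
rewrite dimv0 add0n; apply/eqP; rewrite eqn_leq; apply/andP; split.
  have := H F' fF' bE _ (mem_probes e (mem_head _ _) aN iN); rewrite /= mul1mx.
  have := dim_qker e a (F' i); have := dim_qker e a (F i); rewrite !flag_dim //; last exact: tF.1.
  rewrite (tF.2 i iN).2 dimv0 add0n => d1 d2 le.
  by rewrite -(leq_add2r (\dim (mv (e ^+ a) (F' i)))) d2 -[X in (X <= _)%N]d1 leq_add2l.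
case: (posnP i) => [->|i0].
  by rewrite big1 // => r _; rewrite (rowle0 partition_nuS tau_std) min0n.
have [j jl] : exists j : 'I_n, (Lam j < i <= Lam j.+1)%N by apply: block; rewrite i0.
have id : (i - Lam j <= \dim (V j))%N by move: jl; rewrite psumS; lia.
have iE : i = (Lam j + (i - Lam j))%N by lia.
rewrite iE; under eq_bigr => r _ do rewrite rowle_tau //.
apply: ext_type_ge.
- exact: row_sum_noninc.
- exact: rowle_noninc (pmu j) (ssg j) _.
- exact: block_typed_le.
- by move=> c; apply: Wn_type_ge => //; apply: ltnW.
- exact: bF'.2.
Qed.

Lemma LS_C0 : LS V @` C0 V e0 sg = C e tau.
Proof.
rewrite /C0 LS_closure //; last by move=> b [[]].
apply/seteqP; split; last exact: closureS fibre_sub.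
exact: closure_least sub_fibre_closure.
Qed.

Lemma C0_flags : C0 V e0 sg `<=` flag_variety0 V.
Proof.
move=> b clb; apply: clb; first exact: zclosed0_full.
by move=> c [[]].
Qed.

Lemma C0_springer : C0 V e0 sg `<=` springer0 V e0.
Proof.
move=> b C0b; have Bb := C0_flags C0b; split=> //.
have [_] : springer e (LS V b).
  apply: (@C_springer k N e tau); rewrite -LS_C0; exists b => //.
have [G fG ->] := Bb; rewrite LS_borel // => eb.
have : e0 \in borel (comb V G) by rewrite -[e0](addrK z) memvB // nilradical_comb.
move=> /borelP e0b; apply/borel0P; split=> // j i id u uG.
rewrite -(comb_cap dV fV fG id) memv_cap; apply/andP; split; last first.
  by have /levi_stabP := e0L; apply; apply: (subvP (flags0_sub fG id)).
apply: e0b; first exact: in_block.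
by move: uG; rewrite -(comb_cap dV fV fG id) memv_cap => /andP[].
Qed.

Lemma C0_irreducible : irreducible (zclosed_flag0 V) (C0 V e0 sg).
Proof.
apply/(LS_irreducible dV fV C0_flags); rewrite LS_C0.
exact: (C_irreducible e_nilp partition_nuS e_jordan).
Qed.

End Tableaux.

Lemma LS_springer b0 : springer0 V e0 b0 -> springer e (LS V b0).
Proof.
by move=> [Bb e0b]; split; [apply: LS_flags | apply: memv_add].
Qed.

Lemma springer0_covered X : X `<=` springer0 V e0 -> irreducible (zclosed_flag0 V) X ->
  exists2 sg : n.-tuple tableau, (forall i, is_std (tnth mu i) (tnth sg i)) & X `<=` C0 V e0 sg.
Proof.
move=> XS iX; have XB : X `<=` flag_variety0 V by move=> b /XS[].
have LXB : LS V @` X `<=` flags by move=> _ [b /XB Bb <-]; apply: LS_flags.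
have [P PE] : exists P : nat -> gl, forall j x a U,
    (\dim (qker x (Wn j) a U) + \dim (mv (P j *m x ^+ a) U) = \dim U)%N.
  have /choice[P PE] := fun j => rank_qker (Wn j).
  by exists P.
have iLX : irr (LS V @` X) by apply/(LS_irreducible dV fV XB).
have [F [fF [b Xb LF] Fcl]] := irreducible_generic LXB (probes_le e (map P (iota 0 n))) iLX.
have [G fG bE] := XB _ Xb; have [_ e0b] := XS _ Xb.
have FE i : (i <= N)%N -> F i = comb V G i.
  move=> iN; apply: (borel_inj fF (comb_full dV fV fG)) => //.
  by rewrite -LF bE LS_borel.
have [_ e0G] : e0 \in levi V /\ forall j i, (i <= \dim (V j))%N -> forall u, u \in G j i -> e0 *m u \in G j i.
  by apply/borel0P; rewrite -bE.
have [T TP] : exists T : 'I_n -> tableau, forall j, is_std (tnth mu j) (T j) /\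
    forall i, (i <= \dim (V j))%N -> has_type e0 0 (G j i) (rowle (T j) i).
  have /choice[T TP] : forall j, exists T, is_std (tnth mu j) T /\
    forall i, (i <= \dim (V j))%N -> has_type e0 0 (G j i) (rowle T i); last by exists T.
  move=> j; have [T sT tT] := tableau_exists (fG j) (e0G j) e0_nilp (e0mu j).
  by exists T.
pose sg : n.-tuple tableau := [tuple T i | i < n].
have ssg i : is_std (tnth mu i) (tnth sg i) by rewrite tnth_mktuple; case: (TP i).
exists sg => // c Xc.
suff LXC : LS V @` X `<=` LS V @` C0 V e0 sg.
  by apply/(LS_mem dV fV (@C0_flags sg) (XB _ Xc))/LXC; exists c.
rewrite LS_closure //; last by move=> b' [[]].
apply: subset_trans Fcl _; apply: closureS => b1 [LXb1 H].
have [F1 fF1 b1E] := LXB _ LXb1; rewrite b1E; apply/(LS_fibreP ssg fF1).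
have [c1 Xc1 LE] := LXb1; have [G1 fG1 c1E] := XB _ Xc1.
have F1E i : (i <= N)%N -> F1 i = comb V G1 i.
  move=> iN; apply: (borel_inj fF1 (comb_full dV fV fG1)) => //.
  by rewrite -b1E -LE c1E LS_borel.
split=> [j jn|j i id]; first by rewrite F1E ?comb_Wn // (Lam_le_N dV fV).
have iN := in_block id.
have F1b : F1 (Lam j + i)%N = (Wn j + G1 j i)%VS.
  by rewrite F1E // (comb_block (j := j) dV fG1) ?addKn // psumS leq_addr leq_add2l.
have Fb : F (Lam j + i)%N = (Wn j + G j i)%VS.
  by rewrite FE // (comb_block (j := j) dV fG) ?addKn // psumS leq_addr leq_add2l.
have tF : has_type e (Wn j) (F (Lam j + i)%N) (rowle (tnth sg j) i).
  rewrite Fb; apply/has_type_block => //; first exact: flags0_sub.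
  by rewrite tnth_mktuple; apply: (TP j).2.
apply: has_type_upto => [||r|u _|a aN].
- by rewrite F1b addvSl.
- have [_] := LS_springer (XS _ Xc1); rewrite LE b1E => /borelP; apply.
  exact: iN.
- apply: leq_trans (rowle_max (ssg j) i r) _.
  exact: leq_trans (partition_nth_le r (pmu j)) (dim_le _).
- by rewrite e_nilp mul0mx.
have Pj : P j \in map P (iota 0 n) by apply: map_f; rewrite mem_iota add0n ltn_ord.
have := H F1 fF1 b1E _ (mem_probes e Pj aN iN) => /= E.
have := PE j e a (F1 (Lam j + i)%N); have := PE j e a (F (Lam j + i)%N).
rewrite E (flag_dim fF1 iN) (flag_dim fF iN) -tF.2 => d1 d2.
by apply: (@addIn (\dim (mv (P j *m e ^+ a) (F (Lam j + i)%N)))); rewrite d1 d2.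
Qed.

Lemma Comp0_C0 X : Comp0 V e0 X ->
  exists2 sg : n.-tuple tableau, (forall i, is_std (tnth mu i) (tnth sg i)) & C0 V e0 sg = X.
Proof.
move=> [XS iX Xmax]; have [sg ssg XC] := springer0_covered XS iX; exists sg => //.
by apply: Xmax => //; [apply: C0_springer | apply: C0_irreducible].
Qed.

Lemma LS_Phi X : Comp0 V e0 X ->
  exists sg : n.-tuple tableau, [/\ forall i, is_std (tnth mu i) (tnth sg i),
    LS V @` X = C e (stk lam mu sg) & Phi0 V e0 mu X = sg].
Proof.
move=> /Comp0_C0[sg1 ssg1 E1]; rewrite /Phi0.
case: xgetP => [sg _ [ssg E]|/(_ sg1)]; last by case.
by exists sg; split=> //; rewrite -E; apply: LS_C0.
Qed.

End Stacked.

Theorem mainTheorem1 (k : closedFieldType) (N : nat) (hN : (0 < N)%N)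
    (n : nat) (lam : n.-tuple nat) (hlam : composition lam N)
    (V : 'I_n -> {vspace 'cV[k]_N})
    (hVdirect : directv (\sum_(i < n) V i)%VS)
    (hVfull : (\sum_(i < n) V i)%VS = fullv)
    (hVdim : forall i, \dim (V i) = tnth lam i)
    (mu : n.-tuple (seq nat))
    (hmu : forall i, partition_of (tnth mu i) (tnth lam i))
    (e0 e : 'M[k]_N)
    (he0 : nilp_orbit V mu e0)
    (he : exists2 z, z \in nilradical V & e = e0 + z)
    (heInd : Ind V (nilp_orbit V mu) e) :
  [/\ (forall b0, springer0 V e0 b0 -> springer e (LS V b0)),
      (forall X, Comp0 V e0 X -> Comp e (LS V @` X)),
      (forall X, Comp0 V e0 X ->
         Phi e (muSigma mu) (LS V @` X) = stk lam mu (Phi0 V e0 mu X)) &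
      (forall sigma : n.-tuple tableau,
         (forall i, is_std (tnth mu i) (tnth sigma i)) ->
         LS V @` C0 V e0 sigma = C e (stk lam mu sigma))].
Proof.
case: he heInd => z zn -> eI.
have pos i : (0 < \dim (V i))%N by rewrite hVdim; apply: (allP hlam.1); apply: mem_tnth.
have eN := e_nilp hVdirect hVfull hVdim hmu he0 zn eI.
have pS := partition_nuS hVdirect hVfull hVdim hmu.
have tS := e_jordan hVdirect hVfull hVdim hmu he0 zn eI.
have ph := LS_Phi hVdirect hVfull hVdim pos hmu he0 zn eI.
split.
- exact: LS_springer.
- by move=> X /ph[sg [ssg -> _]]; apply: (C_component eN pS tS); apply: stk_isstd.
- by move=> X /ph[sg [ssg -> ->]]; apply: (Phi_C eN pS tS); apply: stk_isstd.
- by move=> sg ssg; apply: LS_C0.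
Qed.
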